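(* Let $n\ge1$, let $q$ be a power of an odd prime, and let $c$ be chosen uniformly at random among the $q^n$ semisimple conjugacy classes of $Sp(2n,q)$. Then for every conjugacy class $C$ of the Weyl group $C_n$, $$\mathrm{Probability}(\Phi(c)=C)=\sum_{w\in C}\bigl(\text{coefficient of } w\text{ in } x_q\bigr),$$ where $x_q$ is Cellini's element in type $C_n$.
   Context: $C_n$ also denotes the Weyl group of type $C_n$: the hyperoctahedral group of signed permutations $w$ of $\{\pm1,\dots,\pm n\}$ ($w(-i)=-w(i)$), acting on $\mathbb{R}^n$ by $w e_i=\mathrm{sgn}(w(i))e_{|w(i)|}$. Positive roots: $e_i\pm e_j$ ($i<j$) and $2e_i$; simple roots $\alpha_i=e_i-e_{i+1}$ ($1\le i\le n-1$), $\alpha_n=2e_n$; highest root $\theta=2e_1$ and $\alpha_0=-\theta$; coroot lattice $Y=\mathbb{Z}^n$ with the standard pairing $\langle\ ,\ \rangle$. Put $\Pi=\{\alpha_1,\dots,\alpha_n\}$ and $\tilde\Pi=\Pi\cup\{\alpha_0\}$, and let $Cdes(w)$ be the set of elements of $\tilde\Pi$ mapped to negative roots by $w$. Cellini's element: for a positive integer $k$ and $I\subseteq\tilde\Pi$, let $a_{k,I}$ be the number of $t\in Y$ with $\langle\alpha_i,t\rangle=0$ for $\alpha_i\in I\cap\Pi$, $\langle\alpha_i,t\rangle>0$ for $\alpha_i\in\Pi\setminus I$, and $\langle\theta,t\rangle=k$ if $\alpha_0\in I$, $\langle\theta,t\rangle<k$ if $\alpha_0\notin I$. Then $x_k$ is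 the element of the rational group algebra of $C_n$ in which the coefficient of $w$ is $\frac{1}{k^n}\sum_{I\subseteq\tilde\Pi\setminus Cdes(w)}a_{k,I}$. The map $\Phi$: in general, for $G$ a connected, semisimple, simply connected, $F$-split group over $F_q$ with Frobenius $F$, and $x$ in a semisimple class $c$ of $G^F$, a maximally split maximal torus $T$ of the centralizer $C_G(x)$ is an $F$-stable maximal torus of $G$ determined up to $G^F$-conjugacy, and $\Phi(c)$ is the conjugacy class of the Weyl group corresponding to $T$ under the standard bijection between $G^F$-classes of $F$-stable maximal tori and conjugacy classes of the Weyl group. For $G^F=Sp(2n,q)$ this is explicit: semisimple classes correspond, via characteristic polynomials, to monic degree $2n$ polynomials $f$ over $F_q$ with $f(z)=z^{2n}f(1/z)$. For a monic polynomial $\phi$ with $\phi(0)\ne 0$ let $\bar\phi(z)=z^{\deg\phi}\phi(1/z)/\phi(0)$. Factor $f$ uniquely as $\prod_{\{\phi,\bar\phi\}}[\phi\bar\phi]^{r_\phi}\prod_{\phi=\bar\phi}\phi^{s_\phi}$ with $\phi$ monic irreducible, $r_\phi\geq 0$, $s_\phi\in\{0,1\}$ (the first product is over all unordered pairs, including those with $\phi=\bar\phi$; $z\pm1$ occur only in the first product). Then $\Phi(c)$ is the class of signed permutations with $\lambda_i=\sum_{\deg\phi=i}r_\phi$ positive $i$-cycles and $\mu_i=\sum_{\deg\phi=2i}s_\phi$ negative $i$-cycles for each $i$, the first sum being over unordered pairs $\{\phi,\bar\phi\}$. A cycle of a signed permutation is positive or negative according to the product of its signs. *)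

(* Defs.v *)
(* Mathematical Components, with the classical sets of MathComp-Analysis. *)
From mathcomp Require Import all_boot all_order all_algebra all_fingroup all_field.
From mathcomp Require Import finmap.
From mathcomp Require Import boolp classical_sets cardinality.

Set Implicit Arguments.
Unset Strict Implicit.
Unset Printing Implicit Defensive.

Import Order.TTheory GRing.Theory Num.Theory.

Local Open Scope ring_scope.

Definition uniform_prob (T : finType) (A : {set T}) (P : pred T) : rat :=
  #|[set x in A | P x]%SET|%:R / #|A|%:R.

(** * Signed permutations *)

(* {+-1, ..., +-n}: (i, false) stands for i+1 and (i, true) for -(i+1). *)
Definition pmset (n : nat) : finType := ('I_n * bool)%type.

Definition pmopp (n : nat) (x : pmset n) : pmset n := (x.1, ~~ x.2).

Definition pmsgn (n : nat) (x : pmset n) : int := (-1) ^+ x.2.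

Definition weylC (n : nat) : {set {perm (pmset n)}} :=
  [set w : {perm (pmset n)} | [forall x, w (pmopp x) == pmopp (w x)]]%SET.

Lemma group_set_weylC (n : nat) : group_set (weylC n).
Proof.
apply/group_setP; split.
  by rewrite inE; apply/forallP => x; rewrite !perm1.
move=> u v; rewrite !inE => /forallP uP /forallP vP.
by apply/forallP => x; rewrite !permM (eqP (uP x)) (eqP (vP _)).
Qed.

Canonical weylC_group (n : nat) := Group (group_set_weylC n).

Definition abs_sperm (n : nat) (w : {perm (pmset n)}) (i : 'I_n) : 'I_n :=
  (w (i, false)).1.

(* For w in [weylC n] the map [abs_sperm w] is a bijection, so [fconnect] is
   the relation of lying in the same cycle. *)
Definition sperm_cycles (n : nat) (w : {perm (pmset n)}) : {set {set 'I_n}} :=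
  [set [set j | fconnect (abs_sperm w) i j]%SET | i : 'I_n]%SET.

Definition cycle_sign (n : nat) (w : {perm (pmset n)}) (c : {set 'I_n}) : int :=
  \prod_(i in c) pmsgn (w (i, false)).

Definition npos_cycles (n : nat) (w : {perm (pmset n)}) (i : nat) : nat :=
  #|[set c in sperm_cycles w | (#|c| == i) && (cycle_sign w c == 1)]%SET|.

Definition nneg_cycles (n : nat) (w : {perm (pmset n)}) (i : nat) : nat :=
  #|[set c in sperm_cycles w | (#|c| == i) && (cycle_sign w c == -1)]%SET|.

(** * The root system and Cellini's element *)

(* All vectors occurring here lie in the lattice Z^n of R^n. The basis e_1,
   ..., e_n is numbered from 1, and [evec n i] is 0 if i is out of range. *)
Definition evec (n i : nat) : 'rV[int]_n := \row_(j < n) (j.+1 == i)%:R.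

Definition pairing (n : nat) (v t : 'rV[int]_n) : int := \sum_i v 0 i * t 0 i.

Definition sperm_act (n : nat) (w : {perm (pmset n)}) (v : 'rV[int]_n) :
    'rV[int]_n :=
  \sum_(i < n) v 0 i *: (pmsgn (w (i, false)) *: evec n (abs_sperm w i).+1).

Definition positive_root (n : nat) (v : 'rV[int]_n) : bool :=
  [exists i : 'I_n, exists j : 'I_n,
     (i < j)%N && ((v == evec n i.+1 + evec n j.+1)
                || (v == evec n i.+1 - evec n j.+1))]
  || [exists i : 'I_n, v == 2 *: evec n i.+1].

Definition negative_root (n : nat) (v : 'rV[int]_n) : bool :=
  positive_root (- v).

Definition highest_root (n : nat) : 'rV[int]_n := 2 *: evec n 1.

(* alpha_0, alpha_1, ..., alpha_n. For n >= 1 these are pairwise distinct, and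
   subsets of the extended set of simple roots are given by their indices. *)
Definition alpha (n : nat) (i : 'I_n.+1) : 'rV[int]_n :=
  if (i == 0 :> nat)%N then - highest_root n
  else if (i == n :> nat)%N then 2 *: evec n n
  else evec n i - evec n i.+1.

Definition Cdes (n : nat) (w : {perm (pmset n)}) : {set 'I_n.+1} :=
  [set i | negative_root (sperm_act w (alpha i))]%SET.

Definition cellini_point (n k : nat) (I : {set 'I_n.+1}) (t : 'rV[int]_n) : Prop :=
  (forall i : 'I_n.+1, i != ord0 ->
     if i \in I then pairing (alpha i) t = 0 else 0 < pairing (alpha i) t) /\
  (if ord0 \in I then pairing (highest_root n) t = k%:Z
   else pairing (highest_root n) t < k%:Z).

(* For n >= 1 the set is finite, since its points satisfy
   t_1 >= ... >= t_n >= 0 and 2 t_1 <= k. *)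
Definition cellini_a (n k : nat) (I : {set 'I_n.+1}) : nat :=
  #|` fset_set [set t : 'rV[int]_n | cellini_point k I t]%classic |%fset.

(* The coefficient of w in x_k. *)
Definition cellini_coef (n k : nat) (w : {perm (pmset n)}) : rat :=
  (k%:R ^+ n)^-1 *
  \sum_(I : {set 'I_n.+1} | I \subset ~: Cdes w) (cellini_a k I)%:R.

(** * Semisimple conjugacy classes of Sp(2n, F) *)

Definition symplectic_form (F : finFieldType) (n : nat) : 'M[F]_(n + n) :=
  block_mx 0 1%:M (- 1%:M) 0.

Definition Sp (F : finFieldType) (n : nat) : {set 'M[F]_(n + n)} :=
  [set x : 'M[F]_(n + n) |
    x *m symplectic_form F n *m x^T == symplectic_form F n]%SET.

(* Being diagonalizable over the algebraic closure of F is the same as being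
   so over some finite extension of F. *)
Definition semisimple_mx (F : finFieldType) (m : nat) (x : 'M[F]_m) : Prop :=
  exists L : fieldExtType F, diagonalizable (map_mx (in_alg L) x).

Definition Sp_class (F : finFieldType) (n : nat) (x : 'M[F]_(n + n)) :
    {set 'M[F]_(n + n)} :=
  [set g *m x *m invmx g | g in Sp F n]%SET.

Definition semisimple_classes (F : finFieldType) (n : nat) :
    {set {set 'M[F]_(n + n)}} :=
  [set Sp_class x | x in Sp F n & `[< semisimple_mx x >]]%SET.

(** * The map Phi *)

(* z^(deg phi) phi(1/z) / phi(0) *)
Definition poly_bar (F : fieldType) (phi : {poly F}) : {poly F} :=
  phi.[0]^-1 *: \poly_(i < size phi) phi`_((size phi).-1 - i).

(* f is the product of the [phi * poly_bar phi] ^+ r phi over unordered pairs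
   {phi, poly_bar phi}, times the product of the phi ^+ s phi over the phi equal
   to poly_bar phi. D is a finite list containing at most one member of each
   pair {phi, poly_bar phi}; the pairs not met by D have exponents 0. *)
Definition bar_factorization (F : fieldType) (f : {poly F}) (D : seq {poly F})
    (r : {poly F} -> nat) (s : {poly F} -> bool) : Prop :=
  [/\ uniq D,
      forall phi, phi \in D ->
        [/\ phi \is monic, irreducible_poly phi & phi.[0] != 0],
      forall phi, phi \in D -> poly_bar phi \in D -> poly_bar phi = phi,
      s ('X - 1) = false /\ s ('X + 1) = false
    & f = \prod_(phi <- D) (phi * poly_bar phi) ^+ r phi *
          \prod_(phi <- D | phi == poly_bar phi) phi ^+ s phi].

Definition lambda_of (F : fieldType) (D : seq {poly F}) (r : {poly F} -> nat)
    (i : nat) : nat :=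
  (\sum_(phi <- D | (size phi).-1 == i) r phi)%N.

Definition mu_of (F : fieldType) (D : seq {poly F}) (s : {poly F} -> bool)
    (i : nat) : nat :=
  (\sum_(phi <- D | (phi == poly_bar phi) && ((size phi).-1 == i.*2)) s phi)%N.

(* The elements of a class have the same characteristic polynomial, and the
   factorization is unique up to the choice of representatives in D. *)
Definition Phi (F : finFieldType) (n : nat) (c : {set 'M[F]_(n + n)}) :
    {set {perm (pmset n)}} :=
  [set w in weylC n | `[< exists2 x, x \in c &
     exists D r s, bar_factorization (char_poly x) D r s /\
       forall i, (0 < i)%N ->
         npos_cycles w i = lambda_of D r i /\
         nneg_cycles w i = mu_of D s i >]]%SET.

(* Main.v *)
From HB Require Import structures.
Require Import Defs.
From mathcomp Require Import finmap boolp classical_sets cardinality.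
From mathcomp Require Import all_boot all_order all_algebra all_fingroup all_field.
From mathcomp Require Import cyclic zify ring.

Set Implicit Arguments.
Unset Strict Implicit.
Unset Printing Implicit Defensive.

Import Order.TTheory GRing.Theory Num.Theory.
Local Open Scope ring_scope.

(** Both sides of the identity count the same finite set. Write [q = 2m+1].

   On the side of the Weyl group, [2 t_1 = q] is impossible for an integer
   point, so [q^n] times the coefficient of [w] is the number of dominant points
   [t] of [[0,m]^n] that are strict at the simple roots which [w] makes negative
   ([cellini_coefE]). Extend [t] to an odd function on the signed indices,
   ordered as [1 > ... > n > -n > ... > -1]. The condition on [(w, t)] becomes
   that [x |-> (t(x), w(x))] is increasing for the lexicographic order
   ([shuffle_pair]): equivalently, [w] is the permutation that sorts the odd word
   [t o w^-1] with letters in [[-m,m]], equal letters keeping their order. Every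
   word is sorted by exactly one [w], so there are [q^n] pairs
   ([card_shuffle_pairs]).

   To a pair [(w, t)] and a signed index [x] attach the periodic word
   [t(x), t(w x), t(w^2 x), ...], and read it as an integer [e(x)] with balanced
   digits in base [q], of length [N] with [w^N = 1]. If [g] is a primitive
   element of the field [L] with [q^N] elements and [y(x) = g^e(x)], then
   [y(w x) = y(x)^q] and [y(-x) = 1/y(x)]. Hence the product of the [X - y(x)] is
   a self-reciprocal polynomial [f] over [F] of degree [2n]. On indices with
   equal words [w] preserves the order while negation reverses it. The first fact
   shows that [y] is injective on each orbit of [w] ([value_porbit_inj]), so that
   orbits give irreducible factors [phi]; the second one shows that no two orbits
   stable under negation give the same factor ([value_negative_inj]). So a
   positive cycle contributes [phi * bar phi], and the negative cycles contribute
   distinct self-dual [phi]: the cycle type of [w] is read off the factorization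
   of [f] ([pieces_of_pair]). The words are weakly decreasing along the order of
   the indices, and balanced expansions represent every power of [g] once, except
   that the two extreme ones both give [-1] and occur equally often; therefore
   [f] determines [(w, t)] ([values_determine_pair]).

   On the side of the group, a semisimple element is determined up to conjugacy
   in the symplectic group by its characteristic polynomial ([Sp_class_eq]). For
   an irreducible factor [phi] one splits off an orthogonal summand which depends
   only on [phi]: a copy of [F[z]/phi] together with its dual, or, when [phi] is
   self-dual and not [X - 1] or [X + 1], a single copy carrying an invariant
   alternating form. In the second case all such forms are equivalent because the
   norm from a finite field to the fixed field of an involution is surjective
   ([self_dual_norm]). The same pieces realize every product of factors
   [phi * bar phi] and self-dual [phi] ([realize_pieces]), in particular [f].

   Thus the [q^n] pairs inject into the semisimple classes. Characteristic
   polynomials of symplectic elements are self-reciprocal with constant term [1],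
   which leaves [n] free coefficients and at most [q^n] classes; so the injection
   is a bijection. A signed permutation is determined up to conjugacy by its
   numbers of positive and negative cycles ([weylC_conjugate]), and the exponents
   of the factorization of [f] are unique ([factorization_numbers_unique]).
   Therefore the class attached to [(w, t)] is mapped by [Phi] to the conjugacy
   class of [w]. *)

(** * Irreducible polynomials and extensions of a finite field *)

Section IrreduciblePolynomials.
Variable F : fieldType.

Lemma irreducible_coprime_or_dvd (p r : {poly F}) :
  irreducible_poly p -> coprimep p r \/ p %| r.
Proof.
move=> [_ ip]; case: (boolP (coprimep p r)) => [|ncp]; [by left | right].
have e := ip _ ncp (dvdp_gcdl p r).
by rewrite -(eqp_dvdl _ e) dvdp_gcdr.
Qed.

Lemma irreducible_root_dvd (K : fieldType) (i : {rmorphism F -> K})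
    (p r : {poly F}) y : irreducible_poly p ->
  root (map_poly i p) y -> root (map_poly i r) y -> p %| r.
Proof.
move=> ip py ry; case: (irreducible_coprime_or_dvd r ip) => //.
rewrite -(coprimep_map i) => /coprimep_root/(_ py).
by rewrite (eqP ry) eqxx.
Qed.

Lemma irreducible_monic_dvd (p r : {poly F}) :
  p \is monic -> r \is monic -> irreducible_poly p -> irreducible_poly r ->
  p %| r -> p = r.
Proof.
move=> mp mr [p1 _] [_ ir] pr; apply/eqP; rewrite -eqp_monic //.
by apply: ir => //; rewrite neq_ltn p1 orbT.
Qed.

Lemma exists_irreducible_factor (p : {poly F}) : (1 < size p)%N ->
  exists r, [/\ r \is monic, irreducible_poly r & r %| p].
Proof.
have [n] := ubnP (size p); elim: n => // n IHn in p * => lbn p1.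
have p0 : p != 0 by rewrite -size_poly_gt0 ltnW.
have [ip|nip] := pselect (irreducible_poly p).
  exists ((lead_coef p)^-1 *: p); have l0 : (lead_coef p)^-1 != 0.
    by rewrite invr_eq0 lead_coef_eq0.
  split; first by rewrite monicE lead_coefZ mulVf // lead_coef_eq0.
    have [_ ip2] := ip; split=> [|s s1]; first by rewrite size_scale.
    rewrite dvdpZr // => sp; apply: (eqp_trans (ip2 s s1 sp)).
    by rewrite eqp_sym eqp_scale.
  by rewrite dvdpZl.
have [r [r1 rp nrp]] : exists r : {poly F}, [/\ size r != 1%N, r %| p & ~~ (r %= p)].
  apply: contrapT => nex; apply: nip; split=> // r r1 rp.
  by apply/negPn/negP => nrp; apply: nex; exists r.
have r0 : r != 0 by apply: dvdpN0 rp p0.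
have rs : (size r < size p)%N.
  by rewrite ltn_neqAle dvdp_leq // (dvdp_size_eqp rp) nrp.
have [||s [ms is_ sr]] := IHn r; first exact: leq_trans rs _.
  by rewrite ltn_neqAle eq_sym r1 size_poly_gt0.
by exists s; split=> //; apply: dvdp_trans rp.
Qed.
End IrreduciblePolynomials.

Section FiniteExtensions.
Variable F : finFieldType.
Local Notation q := #|F|.

Lemma card_extension (L : fieldExtType F) :
  #|FinFieldExtType L| = (q ^ \dim {:L})%N.
Proof.
have /= <- := card_vspacef (Vector.on (finvect_type L)).
exact: card_vspace.
Qed.

Lemma expr_card_pow (L : fieldExtType F) (y : L) : y ^+ (q ^ \dim {:L}) = y.
Proof. by rewrite -card_extension; exact: (expf_card (y : FinFieldExtType L)). Qed.

Lemma card_field_gt1 (L : finFieldType) : (1 < #|L|)%N.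
Proof. exact: finNzRing_gt1. Qed.

Lemma natr_card (L : lalgType F) N : (0 < N)%N -> (q ^ N)%:R = 0 :> L.
Proof.
move=> N0; have [p pr_p pF] := finPcharP F.
have [k qE] : exists k, q = (p ^ k)%N by eexists; apply: card_pprimeChar pF.
have k0 : (0 < k)%N by case: k qE (card_field_gt1 F) => // ->.
rewrite qE -(prednK N0) -(prednK k0) expnS expnS -mulnA natrM.
by have := pF; rewrite -(pchar_lalg L) => pL; rewrite (pcharf0 pL) mul0r.
Qed.

(** The splitting field of [X^(q^N) - X] consists of the roots of this
   polynomial, because they are the fixed points of a power of the Frobenius
   automorphism. *)
Lemma extension_of_degree N : (0 < N)%N ->
  exists (L : finFieldType) (i : {rmorphism F -> L}), #|L| = (q ^ N)%N.
Proof.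
move=> N0; pose p : {poly F} := 'X^(q ^ N) - 'X.
have q1 : (1 < q ^ N)%N by rewrite -(exp1n N) ltn_exp2r // card_field_gt1.
have szp (R : nzRingType) : size ('X^(q ^ N) - 'X : {poly R}) = (q ^ N).+1.
  by rewrite size_polyDl size_polyXn // size_polyN size_polyX.
have p0 : p != 0 by rewrite -size_poly_eq0 szp.
have [L [rs Dp genL]] := FinSplittingFieldFor p0.
pose fL := FinFieldExtType L.
have rsE r : r \in rs -> r ^+ (q ^ N) = r.
  move=> r_rs; have : root (map_poly (in_alg L) p) r.
    by rewrite (eqp_root Dp) root_prod_XsubC.
  rewrite rmorphB /= map_polyXn map_polyX rootE !hornerE subr_eq0.
  by move/eqP.
have [al _ alE] := finField_galois_generator (sub1v {:L}%AS).
have alNE y : (al ^+ N)%g y = y ^+ (q ^ N).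
  elim: N {N0 q1 p szp p0 Dp rsE} => [|N IH]; first by rewrite gal_id expr1.
  by rewrite expgSr galM ?memvf // IH alE ?memvf // dimv1 expn1 expnSr exprM.
have fixL (y : L) : y ^+ (q ^ N) = y.
  have /subvP/(_ y) : ({:L} <= fixedField [set (al ^+ N)%g])%VS.
    rewrite -genL; apply/Fadjoin_seqP; split; first exact: sub1v.
    move=> r /rsE rE; apply/fixedFieldP; rewrite ?memvf // => x /set1P ->.
    by rewrite alNE.
  by move/(_ (memvf _))/fixedFieldP => /(_ (memvf _))/(_ _ (set11 _)); rewrite alNE.
exists fL, (in_alg L : {rmorphism F -> L}); apply/eqP; rewrite eqn_leq; apply/andP; split.
  rewrite -ltnS -(szp fL) cardE; apply: max_poly_roots.
  - by rewrite -size_poly_eq0 szp.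
  - by apply/allP => y _; rewrite rootE !hornerE subr_eq0; apply/eqP/fixL.
  - exact: enum_uniq.
have urs : uniq rs.
  rewrite -separable_prod_XsubC -(eqp_separable Dp) separable_map.
  rewrite separable_poly.unlock derivB derivXn derivX -mulr_natl -polyC_natr.
  by rewrite (natr_card F^o N0) mul0r sub0r -scaleN1r coprimepZr ?oppr_eq0 ?oner_eq0 ?coprimep1.
have szrs : size rs = (q ^ N)%N.
  apply/eqP; rewrite -eqSS -(size_prod_XsubC rs id) -(eqp_size Dp).
  by rewrite size_map_poly szp.
rewrite -szrs cardE; apply: (@uniq_leq_size fL) => // r _.
by rewrite mem_enum.
Qed.
End FiniteExtensions.

(** * Frobenius conjugates *)

(** The embedding [i] only records the field [F] whose Frobenius map this is. *)
Definition frob (F L : finFieldType) (i : {rmorphism F -> L}) (y : L) : L :=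
  y ^+ #|F|.

Section FrobeniusMorphism.
Variables (F L : finFieldType) (i : {rmorphism F -> L}).

Lemma frob_zmod : zmod_morphism (frob i).
Proof.
have [p pr_p pF] := finPcharP F; rewrite /frob (card_pprimeChar pF) => x y.
have pL : p \in [pchar L].
  by rewrite inE pr_p -(rmorph_nat i) (pcharf0 pF) rmorph0 /=.
elim: (logn _ _) => // n IHn; rewrite expnSr !exprM {}IHn.
by rewrite -(pFrobenius_autE pL) rmorphB.
Qed.

Lemma frob_monoid : monoid_morphism (frob i).
Proof. by rewrite /frob; split=> [|x y]; rewrite ?exprMn ?expr1n. Qed.

HB.instance Definition _ := GRing.isZmodMorphism.Build _ _ (frob i) frob_zmod.
HB.instance Definition _ := GRing.isMonoidMorphism.Build _ _ (frob i) frob_monoid.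

Lemma frob_fixed (a : F) : frob i (i a) = i a.
Proof. by rewrite /frob -rmorphXn expf_card. Qed.

(** The elements of [F] already exhaust the roots of [X^q - X] in [L]. *)
Lemma frob_fixedP (y : L) : frob i y = y -> exists a, y = i a.
Proof.
move=> fy; pose p : {poly L} := 'X^#|F| - 'X.
have : root p y by rewrite rootE !hornerE subr_eq0; apply/eqP.
have -> : p = \prod_(b : F) ('X - (i b)%:P).
  transitivity (map_poly i ('X^#|F| - 'X)).
    by rewrite rmorphB /= map_polyXn map_polyX.
  rewrite finField_genPoly rmorph_prod; apply: eq_bigr => b _.
  by rewrite /= map_polyXsubC.
rewrite /root horner_prod prodf_seq_eq0 => /hasP[b _].
by rewrite !hornerE subr_eq0 => /eqP; exists b.
Qed.

Lemma frob_poly_fixed (p : {poly F}) :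
  map_poly (frob i) (map_poly i p) = map_poly i p.
Proof. by rewrite -map_poly_comp; apply: eq_map_poly => a; apply: frob_fixed. Qed.

Lemma frob_poly_fixedP (p : {poly L}) : map_poly (frob i) p = p ->
  exists p0 : {poly F}, p = map_poly i p0.
Proof.
move=> fp; have pre k : exists a, p`_k == i a.
  by have [|a /eqP] := @frob_fixedP p`_k; [rewrite -coef_map fp | exists a].
exists (\poly_(k < size p) xchoose (pre k)); apply/polyP => k.
rewrite coef_map coef_poly; case: ltnP => [_|le_k].
  exact/eqP/(xchooseP (pre k)).
by rewrite raddf0 nth_default.
Qed.

Lemma root_frob (p : {poly F}) y k :
  root (map_poly i p) y -> root (map_poly i p) (y ^+ (#|F| ^ k)).
Proof.
move=> py; elim: k => [|k IH]; first by rewrite expr1.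
rewrite expnSr exprM -/(frob i _) rootE -(frob_poly_fixed p) horner_map.
by rewrite (eqP IH) rmorph0.
Qed.

Definition conj_prod d (y : L) : {poly L} :=
  \prod_(k < d) ('X - (y ^+ (#|F| ^ k))%:P).

Lemma conj_prodE d y :
  conj_prod d y = \prod_(z <- [seq y ^+ (#|F| ^ k) | k <- iota 0 d]) ('X - z%:P).
Proof. by rewrite /conj_prod big_map -(big_mkord xpredT (fun k => 'X - (y ^+ (#|F| ^ k))%:P)) /index_iota subn0. Qed.

Lemma conj_prod_descent d y : y ^+ (#|F| ^ d) = y ->
  exists p : {poly F}, map_poly i p = conj_prod d y.
Proof.
move=> yd; have [|p ->] := @frob_poly_fixedP (conj_prod d y); last by exists p.
case: d yd => [|d] yd; first by rewrite /conj_prod big_ord0 rmorph1.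
have fE k : map_poly (frob i) ('X - (y ^+ (#|F| ^ k))%:P) = 'X - (y ^+ (#|F| ^ k.+1))%:P.
  by rewrite map_polyXsubC /= /frob -exprM -expnSr.
rewrite /conj_prod rmorph_prod /=.
under eq_bigr => k _ do rewrite fE.
by rewrite big_ord_recr /= yd mulrC [in RHS]big_ord_recl /= expr1.
Qed.

(** The orbit of [y] under Frobenius being exactly its [d] conjugates, their
   product has no proper factor over [F]: the roots of a factor are stable under
   Frobenius. *)
Lemma conj_prod_irreducible d y (p : {poly F}) : (0 < d)%N ->
  y ^+ (#|F| ^ d) = y -> uniq [seq y ^+ (#|F| ^ k) | k <- iota 0 d] ->
  map_poly i p = conj_prod d y -> [/\ p \is monic, irreducible_poly p & size p = d.+1].
Proof.
move=> d0 yd yu pE.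
have szp : size p = d.+1.
  by rewrite -(size_map_poly i) pE conj_prodE size_prod_XsubC size_map size_iota.
have mp : p \is monic.
  by rewrite -(map_monic i) pE conj_prodE monic_prod_XsubC.
split=> //; split=> [|r sr rp]; first by rewrite szp ltnS.
rewrite -(eqp_map i) /eqp (dvdp_map i) rp /= pE conj_prodE.
apply: uniq_roots_dvdp; last by rewrite uniq_rootsE.
have [z zr] : exists z, (z \in [seq y ^+ (#|F| ^ k) | k <- iota 0 d]) /\ root (map_poly i r) z.
  move: rp; rewrite -(dvdp_map i) pE conj_prodE => /dvdp_prod_XsubC[m rE].
  have : size (map_poly i r) != 1 by rewrite size_map_poly.
  rewrite (eqp_size rE); set s := mask _ _; rewrite size_prod_XsubC.
  case Es: s => [|z s'] //= _; exists z; split.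
    by apply: (@mem_mask _ z m); rewrite -/s Es mem_head.
  by rewrite (eqp_root rE) root_prod_XsubC -/s Es mem_head.
case: zr => zin rz; have [j] := mapP zin; rewrite mem_iota add0n => /= jd zE.
rewrite {}zE in rz.
apply/allP => _ /mapP[k kd ->].
have := root_frob (d - j + k) rz; rewrite -exprM -expnD.
by rewrite addnA subnKC ?(ltnW jd) // expnD exprM yd.
Qed.

Lemma conj_order (y : L) : exists d, [/\ (0 < d)%N, y ^+ (#|F| ^ d) = y &
  uniq [seq y ^+ (#|F| ^ k) | k <- iota 0 d]].
Proof.
have inj_frob : injective (frob i) by apply: fmorph_inj.
have iterE k z : iter k (frob i) z = z ^+ (#|F| ^ k).
  by elim: k z => [|k IH] z; rewrite ?expr1 // iterS IH /frob -exprM expnSr.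
exists (fingraph.order (frob i) y); split; first exact: fingraph.order_gt0.
  by rewrite -iterE iter_order.
rewrite (@eq_map _ _ _ (fun k => iter k (frob i) y)); last first.
  by move=> k /=; rewrite iterE.
suff -> : [seq iter k (frob i) y | k <- iota 0 (fingraph.order (frob i) y)]
  = fingraph.orbit (frob i) y by apply: orbit_uniq.
apply: (@eq_from_nth _ y) => [|k]; rewrite size_map size_iota ?size_orbit // => kd.
by rewrite (nth_map 0) ?size_iota // nth_iota // /fingraph.orbit nth_traject.
Qed.

(** The product of the Frobenius conjugates of [y] is irreducible over [F] and
   shares the root [y] with [p]. *)
Lemma irreducible_conj_prod (p : {poly F}) y :
  p \is monic -> irreducible_poly p -> root (map_poly i p) y ->
  [/\ y ^+ (#|F| ^ (size p).-1) = y,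
      uniq [seq y ^+ (#|F| ^ k) | k <- iota 0 (size p).-1] &
      map_poly i p = conj_prod (size p).-1 y].
Proof.
move=> mp ip py; have [d [d0 yd yu]] := conj_order y.
have [r rE] := conj_prod_descent yd.
have [mr ir sr] := conj_prod_irreducible d0 yd yu rE.
suff pr : p = r by subst r; rewrite sr /=.
apply: irreducible_monic_dvd => //; apply: irreducible_root_dvd ip py _.
rewrite rE conj_prodE root_prod_XsubC; apply/mapP; exists 0; last by rewrite expr1.
by rewrite mem_iota.
Qed.
End FrobeniusMorphism.

(** * Reciprocal polynomials *)

Section GenericPoint.
Variable F : fieldType.

(** An identity between polynomials can be checked at the generic point [X],
   which is invertible in the field of rational functions; this is how the
   substitution of [1/z] for [z] is handled below. *)
Definition to_ratfun : {rmorphism F -> {fraction {poly F}}} :=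
  (@tofrac {poly F} : {rmorphism _ -> _}) \o (polyC : {rmorphism _ -> _}).

Lemma generic_point (p : {poly F}) :
  (map_poly to_ratfun p).[tofrac 'X] = tofrac p.
Proof.
rewrite /to_ratfun map_poly_comp /= horner_map /=; congr tofrac.
exact: comp_polyXr.
Qed.

Lemma generic_point_inj (p r : {poly F}) :
  (map_poly to_ratfun p).[tofrac 'X] = (map_poly to_ratfun r).[tofrac 'X] -> p = r.
Proof. by rewrite !generic_point => /eqP; rewrite tofrac_eq => /eqP. Qed.

Lemma generic_point_neq0 : tofrac ('X : {poly F}) != 0.
Proof. by rewrite tofrac_eq0 polyX_eq0. Qed.
End GenericPoint.

Section Reciprocal.
Variable F : fieldType.
Implicit Types p r : {poly F}.

Lemma horner_bar (K : fieldType) (i : {rmorphism F -> K}) p y : y != 0 ->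
  (map_poly i (poly_bar p)).[y] =
  (i p.[0])^-1 * (y ^+ (size p).-1 * (map_poly i p).[y^-1]).
Proof.
move=> y0; rewrite /poly_bar linearZ /= hornerZ fmorphV; congr (_ * _).
rewrite (@horner_coef_wide _ (size p)); last by rewrite size_map_poly size_poly.
rewrite (@horner_coef_wide _ (size p) (map_poly i p)) ?size_map_poly //.
rewrite big_distrr /= (reindex_inj rev_ord_inj); apply: eq_bigr => k _ /=.
rewrite !coef_map coef_poly /=; case: (size p) k => [[]//|d] k /=.
rewrite subSS ltnS leq_subr subKn; last by rewrite -ltnS.
rewrite mulrCA exprVn -exprB ?unitfE // -ltnS //.
Qed.

Lemma bar_scaled_rev p : poly_bar p = p.[0]^-1 *: Poly (rev p).
Proof.
congr (_ *: _); apply/polyP => k; rewrite coef_poly coef_Poly.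
case: ltnP => [lk|le]; last by rewrite nth_default // size_rev.
by rewrite nth_rev //; congr (_ `_ _); case: (size p) lk => // d; rewrite subSS.
Qed.

Lemma size_bar p : p.[0] != 0 -> size (poly_bar p) = size p.
Proof.
move=> p0; rewrite bar_scaled_rev size_scale ?invr_eq0 // (@PolyK _ 0) ?size_rev //.
have s0 : (0 < size p)%N.
  by rewrite size_poly_gt0; apply: contraNneq p0 => ->; rewrite horner0.
rewrite (last_nth 0) size_rev -(prednK s0) /=.
by rewrite nth_rev ?prednK // subnn -horner_coef0.
Qed.

Lemma bar_monic p : p.[0] != 0 -> poly_bar p \is monic.
Proof.
move=> p0; rewrite monicE /lead_coef size_bar // coefZ coef_poly.
case: (posnP (size p)) => [s0|s0]; last by rewrite prednK // leqnn subnn -horner_coef0 mulVf.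
by move: p0; rewrite horner_coef0 nth_default ?eqxx // s0.
Qed.

Lemma bar_horner0 p : p \is monic -> p.[0] != 0 -> (poly_bar p).[0] = p.[0]^-1.
Proof.
move=> mp p0; rewrite horner_coef0 coefZ coef_poly subn0 -/(lead_coef p).
by rewrite (monicP mp) lt0n size_poly_eq0 monic_neq0 // mulr1.
Qed.

Lemma bar_horner0_neq0 p : p \is monic -> p.[0] != 0 -> (poly_bar p).[0] != 0.
Proof. by move=> mp p0; rewrite bar_horner0 // invr_eq0. Qed.

Lemma map_bar (K : fieldType) (i : {rmorphism F -> K}) p :
  map_poly i (poly_bar p) = poly_bar (map_poly i p).
Proof.
rewrite /poly_bar linearZ /= fmorphV -horner_map rmorph0; congr (_ *: _).
apply/polyP => k; rewrite size_map_poly coef_map [in LHS]coef_poly [in RHS]coef_poly.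
by rewrite coef_map; case: ifP => // _; rewrite raddf0.
Qed.

Lemma bar1 : poly_bar (1 : {poly F}) = 1.
Proof.
rewrite bar_scaled_rev -(polyC1 F) hornerC polyseqC oner_eq0 invr1 scale1r.
by apply/polyP => k; rewrite coef_Poly coefC; case: k => // k; rewrite nth_default.
Qed.

Lemma barM p r : p.[0] != 0 -> r.[0] != 0 ->
  poly_bar (p * r) = poly_bar p * poly_bar r.
Proof.
move=> p0 r0; apply: generic_point_inj.
have nz (s : {poly F}) : s.[0] != 0 -> s != 0.
  by apply: contraNneq => ->; rewrite horner0.
rewrite [in RHS]rmorphM /= hornerM !horner_bar ?generic_point_neq0 //.
rewrite [X in _ * (_ * X.[_]) = _]rmorphM !hornerM [X in X^-1 * _ = _]rmorphM.
have -> : (size (p * r)).-1 = ((size p).-1 + (size r).-1)%N.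
  rewrite (size_mul (nz _ p0) (nz _ r0)).
  have := nz _ p0; have := nz _ r0; rewrite -!size_poly_gt0.
  by move: (size p) (size r) => [|a] [|b] //= _ _; rewrite addnS.
by rewrite exprD invfM [RHS]mulrACA [X in _ * X = _]mulrACA.
Qed.
End Reciprocal.

Section ReciprocalRoots.
Variable F : fieldType.
Implicit Types p r : {poly F}.

Lemma bar_XsubC (a : F) : a != 0 -> poly_bar ('X - a%:P) = 'X - (a^-1)%:P.
Proof.
move=> a0; have sz : size ('X - a%:P) = 2 by rewrite size_XsubC.
have n0 : ('X - a%:P).[0] != 0 by rewrite !hornerE oppr_eq0.
apply/polyP => k; rewrite /poly_bar coefZ coef_poly sz !hornerE.
case: k => [|[|k]] //=; rewrite !coefB !coefX !coefC /=.
- by rewrite subr0 mulr1 sub0r invrN.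
- by rewrite sub0r subr0 invrN mulrNN mulVf.
- by rewrite mulr0 subr0.
Qed.

Lemma bar_prod_XsubC (I : Type) (s : seq I) (f : I -> F) :
  (forall x, f x != 0) ->
  poly_bar (\prod_(x <- s) ('X - (f x)%:P)) = \prod_(x <- s) ('X - (f x)^-1%:P).
Proof.
move=> f0; have nz s' : (\prod_(x <- s') ('X - (f x)%:P)).[0] != 0.
  rewrite horner_prod; elim/big_rec: _ => [|x y _ ny]; first exact: oner_neq0.
  by rewrite mulf_neq0 // !hornerE oppr_eq0.
elim: s => [|x s IH]; first by rewrite !big_nil bar1.
rewrite !big_cons barM ?IH ?bar_XsubC //; first by rewrite !hornerE oppr_eq0.
Qed.

Lemma barK p : p \is monic -> p.[0] != 0 -> poly_bar (poly_bar p) = p.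
Proof.
move=> mp p0; have b0 := bar_horner0_neq0 mp p0.
apply: generic_point_inj; have x0 := generic_point_neq0 F.
rewrite !horner_bar ?invr_eq0 // bar_horner0 // size_bar // invrK fmorphV invrK.
have aux (K : fieldType) (a u v : K) : a != 0 -> u != 0 ->
  a * (u * (a^-1 * (u^-1 * v))) = v by move=> ? ?; field; apply/andP.
by rewrite exprVn aux ?fmorph_eq0 ?expf_neq0.
Qed.

Lemma root_bar (K : fieldType) (i : {rmorphism F -> K}) p y :
  p.[0] != 0 -> y != 0 ->
  root (map_poly i (poly_bar p)) y = root (map_poly i p) y^-1.
Proof.
move=> p0 y0; rewrite !rootE horner_bar // !mulf_eq0 invr_eq0 fmorph_eq0.
by rewrite (negPf p0) /= expf_eq0 (negPf y0) andbF.
Qed.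

Lemma dvdp_horner0 p r : r %| p -> p.[0] != 0 -> r.[0] != 0.
Proof.
by case/dvdpP => s ->; rewrite hornerM mulf_eq0 negb_or => /andP[].
Qed.

Lemma dvdp_bar p r : p.[0] != 0 -> r %| p -> poly_bar r %| poly_bar p.
Proof.
move=> p0 rp; have r0 := dvdp_horner0 rp p0; case/dvdpP: rp => s pE.
move: p0; rewrite pE hornerM mulf_eq0 negb_or => /andP[s0 _].
by rewrite barM // dvdp_mull.
Qed.

Lemma bar_irreducible p : p \is monic -> p.[0] != 0 ->
  irreducible_poly p -> irreducible_poly (poly_bar p).
Proof.
move=> mp p0 [p1 ip]; have b0 := bar_horner0_neq0 mp p0.
split=> [|r r1 rp]; first by rewrite size_bar.
have r0 := dvdp_horner0 rp b0; rewrite -dvdp_size_eqp // size_bar //.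
have := dvdp_bar b0 rp; rewrite barK // => /(ip _).
by rewrite size_bar // => /(_ r1) /eqp_size <-; rewrite size_bar.
Qed.

Lemma char_poly_conj m m' (A : 'M[F]_m) (g : 'M[F]_(m', m)) (h : 'M[F]_(m, m')) :
  g *m h = 1%:M -> h *m g = 1%:M -> char_poly (g *m A *m h) = char_poly A.
Proof.
move=> gh hg; have em : m = m'.
  by apply/eqP; rewrite eqn_leq (mulmx1_min hg) (mulmx1_min gh).
subst m'; rewrite /char_poly; pose lift := map_mx (@polyC F).
have -> : char_poly_mx (g *m A *m h) = lift _ _ g *m char_poly_mx A *m lift _ _ h.
  rewrite /char_poly_mx mulmxBr mulmxBl !map_mxM; congr (_ - _).
  by rewrite scalar_mxC -mulmxA -map_mxM gh map_mx1 mulmx1.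
rewrite !det_mulmx mulrAC -det_mulmx -map_mxM gh map_mx1 det1 mul1r //.
Qed.

(** At the generic point [x] one has
   [x - A^-1 = - x (x^-1 - A) A^-1]; take determinants. *)
Lemma char_poly_inv m (A : 'M[F]_m) : A \in unitmx ->
  char_poly (invmx A) = poly_bar (char_poly A).
Proof.
move=> uA; have dA : \det A != 0 by rewrite -unitfE -unitmxE.
apply: generic_point_inj; have x0 := generic_point_neq0 F.
set x := tofrac 'X in x0 *; set j := to_ratfun F.
have ev (B : 'M[F]_m) y :
    (map_poly j (char_poly B)).[y] = \det (y%:M - map_mx j B).
  rewrite map_char_poly /char_poly -[LHS]/(horner_eval y _) -det_map_mx.
  congr (\det _); apply/matrixP => k l; rewrite !mxE.
  by rewrite /= /horner_eval hornerD hornerN hornerC hornerMn hornerX.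
rewrite horner_bar // size_char_poly /= !ev horner_coef0 char_poly_det.
have -> : x%:M - map_mx j (invmx A) =
    - (x *: (x^-1%:M - map_mx j A)) *m map_mx j (invmx A).
  rewrite scalerBr scale_scalar_mx divff // opprB mulmxBl mul1mx.
  by rewrite -scalemxAl -map_mxM mulmxV // map_mx1 scalemx1.
rewrite det_mulmx -scaleN1r !detZ !det_map_mx det_inv -[tofrac _%:P]/(j _) (rmorphM j) (rmorphXn j) (rmorphN1 j).
rewrite fmorphV invfM -exprVn invrN1.
exact: mulrAC.
Qed.


Lemma char_poly_tr m (A : 'M[F]_m) : char_poly A^T = char_poly A.
Proof.
rewrite /char_poly -det_tr; congr (\det _).
by apply/matrixP => i j; rewrite !mxE eq_sym.
Qed.
End ReciprocalRoots.

(** * Matrices with irreducible characteristic polynomial *)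

Section Intertwiners.
Variable F : fieldType.

Lemma intertwine_horner a b (X : 'M[F]_a.+1) (Y : 'M[F]_b.+1)
    (P : 'M[F]_(a.+1, b.+1)) p :
  P *m Y = X *m P -> P *m horner_mx Y p = horner_mx X p *m P.
Proof.
move=> PY; elim/poly_ind: p => [|p c IH]; first by rewrite !rmorph0 mulmx0 mul0mx.
rewrite !rmorphD !rmorphM /= !horner_mx_X !horner_mx_C -!mulmxE.
by rewrite mulmxDr mulmxDl mulmxA IH -!mulmxA PY scalar_mxC.
Qed.

Lemma horner_mx_tr a (X : 'M[F]_a.+1) p : horner_mx X^T p = (horner_mx X p)^T.
Proof.
elim/poly_ind: p => [|p c IH]; first by rewrite !rmorph0 trmx0.
rewrite !rmorphD !rmorphM /= !horner_mx_X !horner_mx_C -!mulmxE.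
rewrite linearD /= trmx_mul tr_scalar_mx IH; congr (_ + _).
by rewrite -!IH; apply: comm_horner_mx; apply: comm_mx_refl.
Qed.

(* As a module over [F[z]], with [z] acting as [C], the space of row vectors is a
   copy of the field [F[z]/phi]. *)
Variables (d : nat) (C : 'M[F]_d.+1).
Hypothesis irrC : irreducible_poly (char_poly C).
Local Notation phi := (char_poly C).

Lemma horner_irr_unit p : ~~ (phi %| p) -> horner_mx C p \in unitmx.
Proof.
move=> np; case: (irreducible_coprime_or_dvd p irrC) => [|dvd]; last by rewrite dvd in np.
case/Bezout_eq1_coprimepP => [[u v] /= e].
have := congr1 (horner_mx C) e.
rewrite rmorphD !rmorphM /= Cayley_Hamilton mulr0 add0r rmorph1 -!mulmxE => uv.
by case: (mulmx1_unit uv).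
Qed.

Lemma horner_irr_eq0 p : (horner_mx C p == 0) = (phi %| p).
Proof.
apply/eqP/idP => [p0|/dvdpP[r ->]]; last by rewrite rmorphM /= Cayley_Hamilton mulr0.
apply: contraT => /horner_irr_unit; rewrite p0 unitmxE det0.
by rewrite unitr0.
Qed.

Lemma horner_irr_fix (u : 'rV[F]_d.+1) p :
  u != 0 -> u *m horner_mx C p = 0 -> phi %| p.
Proof.
move=> u0 up; apply: contraT => /horner_irr_unit Up.
by move: u0; rewrite -(mulmxK Up u) up mul0mx eqxx.
Qed.

Definition krylov m (x : 'M[F]_m.+1) (v : 'rV[F]_m.+1) : 'M[F]_(d.+1, m.+1) :=
  \matrix_(i < d.+1) (v *m x ^+ i).

Lemma mul_krylov m (x : 'M[F]_m.+1) v (a : 'rV[F]_d.+1) :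
  a *m krylov x v = v *m horner_mx x (rVpoly a).
Proof.
rewrite mulmx_sum_row /rVpoly poly_def rmorph_sum /= mulmx_sumr.
apply: eq_bigr => k _; rewrite rowK linearZ /= -scalemxAr rmorphXn /= horner_mx_X.
by rewrite insubT // => ltk; rewrite /= (_ : Sub _ _ = k) //; apply: val_inj.
Qed.

Lemma krylov_unit (u : 'rV[F]_d.+1) : u != 0 -> krylov C u \in unitmx.
Proof.
move=> u0; rewrite -row_free_unit; apply: inj_row_free => a.
rewrite mul_krylov => /(horner_irr_fix u0) da.
rewrite -(rVpolyK a); suff -> : rVpoly a = 0 by rewrite linear0.
apply: contraTeq da => a0; apply/negP => /(dvdp_leq a0).
by rewrite size_char_poly ltnNge size_poly.
Qed.

Lemma cyclic_vector (u : 'rV[F]_d.+1) : u != 0 ->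
  forall u', exists p, u' = u *m horner_mx C p.
Proof.
move=> u0 u'; exists (rVpoly (u' *m invmx (krylov C u))).
by rewrite -mul_krylov mulmxKV // krylov_unit.
Qed.

(** Schur's lemma: the kernel of an intertwiner is stable under [C], and every
   nonzero vector is cyclic for [C]. *)
Lemma intertwiner_row_free k (y : 'M[F]_k) (P : 'M[F]_(d.+1, k)) :
  P *m y = C *m P -> P != 0 -> row_free P.
Proof.
case: k y P => [|k] y P Py; first by rewrite thinmx0 eqxx.
move=> P0; apply: inj_row_free => u uP; apply: contraNeq P0 => u0.
apply/eqP/row_matrixP => i; rewrite row0 rowE.
have [p ->] := cyclic_vector u0 (delta_mx 0 i).
by rewrite -mulmxA -(intertwine_horner p Py) mulmxA uP mul0mx.
Qed.

Lemma intertwiner_unit (y P : 'M[F]_d.+1) :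
  P *m y = C *m P -> P != 0 -> P \in unitmx.
Proof. by move=> Py P0; rewrite -row_free_unit; apply: intertwiner_row_free Py P0. Qed.

(** A vector annihilated by [phi(x)] spans under [x] a copy of the module
   [F[z]/phi]. *)
Lemma intertwiner_of_vector m (x : 'M[F]_m.+1) v : v *m horner_mx x phi = 0 ->
  exists P : 'M[F]_(d.+1, m.+1), P *m x = C *m P /\ exists u : 'rV[F]_d.+1, u *m P = v.
Proof.
move=> vphi; pose e : 'rV[F]_d.+1 := delta_mx 0 0.
have e0 : e != 0.
  by apply/eqP => /rowP/(_ 0); rewrite !mxE !eqxx => /eqP; rewrite oner_eq0.
have UK := krylov_unit e0; set K := krylov C e in UK.
(* [M] is the matrix of multiplication by [z] in the basis of the powers of [z],
   both for [C] and for the cyclic module generated by [v] *)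
have killed p : phi %| p -> v *m horner_mx x p = 0.
  case/dvdpP => r ->; rewrite mulrC rmorphM /= -mulmxE mulmxA vphi mul0mx //.
exists (invmx K *m krylov x v); split; last first.
  exists (row 0 K); rewrite mulmxA -row_mul mulmxV // -row_mul mul1mx rowK.
  by rewrite expr0 mulmx1.
pose M := K *m C *m invmx K.
suff MK : krylov x v *m x = M *m krylov x v.
  by rewrite -mulmxA MK /M !mulmxA mulVmx // mul1mx.
apply/row_matrixP => i; rewrite [LHS]row_mul [RHS]row_mul.
set a := row i M; have aE : a *m K = e *m horner_mx C ('X^(i.+1)).
  rewrite /a /M row_mul mulmxKV // row_mul rowK rmorphXn /= horner_mx_X.
  by rewrite exprSr -mulmxE mulmxA.
rewrite mul_krylov rowK; apply/eqP; rewrite eq_sym -subr_eq0; apply/eqP.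
have -> : v *m horner_mx x (rVpoly a) - v *m x ^+ i *m x =
    v *m horner_mx x (rVpoly a - 'X^(i.+1)).
  by rewrite rmorphB /= mulmxBr rmorphXn /= horner_mx_X exprSr -mulmxE mulmxA.
apply: killed.
apply: (horner_irr_fix e0); rewrite rmorphB /= mulmxBr -mul_krylov -/K aE.
by rewrite subrr.
Qed.

(** A matrix commuting with [C] is determined by the image of a cyclic vector. *)
Lemma commutant_horner (A : 'M[F]_d.+1) : A *m C = C *m A ->
  exists p, A = horner_mx C p.
Proof.
move=> AC; pose e : 'rV[F]_d.+1 := delta_mx 0 0.
have e0 : e != 0.
  by apply/eqP => /rowP/(_ 0); rewrite !mxE !eqxx => /eqP; rewrite oner_eq0.
have [p pE] := cyclic_vector e0 (e *m A); exists p.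
apply/row_matrixP => i; rewrite !rowE.
have [r ->] := cyclic_vector e0 (delta_mx 0 i).
rewrite -mulmxA -(intertwine_horner r AC) mulmxA pE -!mulmxA.
by congr (_ *m _); apply: comm_horner_mx2.
Qed.

End Intertwiners.

(** * Norms in finite fields *)

Section CyclicUnits.
Variable L : finFieldType.

Lemma unit_generator : exists g : L, [/\ g != 0,
  (forall y, y != 0 -> exists k, y = g ^+ k) &
  (forall k, (g ^+ k == 1) = (#|L|.-1 %| k)%N)].
Proof.
have /cyclicP[g gE] := field_unit_group_cyclic [set: {unit L}]%G.
have gX k : val (g ^+ k)%g = val g ^+ k by rewrite FinRing.val_unitX.
exists (val g); split=> [|y y0|k].
- by have := valP g; rewrite unitfE.
- have : finField_unit y0 \in <[g]>%g by rewrite -gE inE.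
  by case/cycleP => k /(congr1 val) /= yE; exists k; rewrite -gX; exact: yE.
- rewrite -card_finField_unit gE -orderE order_dvdn -gX -FinRing.val_unit1.
  by rewrite val_eqE.
Qed.

(** An element fixed by [y -> y^Q] is a norm [a^(Q+1)], because the group of
   units is cyclic of order [(Q-1)(Q+1)]. *)
Lemma norm_surjective Q c : #|L| = (Q ^ 2)%N -> (1 < Q)%N -> c != 0 :> L ->
  c ^+ Q = c -> exists a, c = a * a ^+ Q.
Proof.
move=> cL Q1 c0 cQ; have [g [g0 gen ordg]] := unit_generator.
have [e cE] := gen _ c0.
have : c ^+ Q.-1 = 1.
  by apply: (mulfI c0); rewrite -exprS prednK ?(ltnW Q1) // mulr1.
rewrite cE -exprM => /eqP; rewrite ordg cL.
have -> : (Q ^ 2).-1 = (Q.+1 * Q.-1)%N.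
  by rewrite -mulnn; case: (Q) Q1 => [|Q0] //= _; lia.
rewrite dvdn_pmul2r; last by rewrite -ltnS prednK // ltnW.
case/dvdnP => k ->; exists (g ^+ k).
by rewrite -exprM -exprD; congr (_ ^+ _); rewrite mulnS.
Qed.
End CyclicUnits.

Section NormLemma.
Variable F : finFieldType.
Local Notation q := #|F|.

Lemma irreducible_root_extension (p : {poly F}) : irreducible_poly p ->
  exists (L : finFieldType) (i : {rmorphism F -> L}) (y : L),
    #|L| = (q ^ (size p).-1)%N /\ root (map_poly i p) y.
Proof.
case/irredp_FAdjoin => L dL [y py _].
exists (FinFieldExtType L), (in_alg L : {rmorphism F -> L}), y; split=> //.
by rewrite card_extension dL.
Qed.

(** The polynomials of degree less than that of [p] take distinct values at [y],
   and there are as many of them as elements of [L]. *)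
Lemma root_generates (p : {poly F}) (L : finFieldType) (i : {rmorphism F -> L}) y :
  irreducible_poly p -> root (map_poly i p) y -> #|L| = (q ^ (size p).-1)%N ->
  forall z, exists r, z = (map_poly i r).[y].
Proof.
move=> ip py cL z; have [p1 _] := ip.
pose f (u : 'rV[F]_(size p).-1) := (map_poly i (rVpoly u)).[y].
have injf : injective f.
  move=> u v /eqP; rewrite -subr_eq0 /f -hornerN -hornerD -rmorphN -rmorphD.
  move/(irreducible_root_dvd ip py); rewrite -linearN -linearD /= => dv.
  apply/eqP; rewrite -subr_eq0 -(rVpolyK (u - v)).
  suff -> : rVpoly (u - v) = 0 by rewrite linear0.
  apply: contraTeq dv => a0; apply/negP => /(dvdp_leq a0).
  by rewrite leqNgt (leq_ltn_trans (size_poly _ _)) // prednK // ltnW.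
have := inj_card_onto injf; rewrite card_mx mul1n cL => /(_ (leqnn _) z).
by case/codomP => u ->; exists (rVpoly u).
Qed.

(** Let [y] be a root of [p] and [L] the field generated by [y]. Since [1/y] is
   again a root, it is [y^(q^j)] for some [j], and [2j] is the degree of [p]
   because [y^2 <> 1]. So the substitution of [t], the inverse of [z] modulo
   [p], is [a |-> a^Q] on [L] with [Q = q^j] and [Q^2] the order of [L]; the value
   of [c] is fixed by it, hence is a norm. *)
Lemma self_dual_norm (p t c : {poly F}) :
  p \is monic -> irreducible_poly p -> p.[0] != 0 -> poly_bar p = p ->
  p.[1] != 0 -> p.[-1] != 0 -> p %| 'X * t - 1 ->
  ~~ (p %| c) -> p %| c - (c \Po t) -> exists a, p %| c - a * (a \Po t).
Proof.
move=> mp ip p0 bp p1 pN1 pt npc pc.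
have [L [i [y [cL py]]]] := irreducible_root_extension ip.
have ev r : p %| r -> (map_poly i r).[y] = 0.
  by case/dvdpP => s ->; rewrite rmorphM /= hornerM (eqP py) mulr0.
have y0 : y != 0.
  apply: contraNneq p0 => y0; move: py; rewrite y0 rootE -(rmorph0 i) horner_map.
  by rewrite (inj_eq (fmorph_inj i)).
have ty : (map_poly i t).[y] = y^-1.
  have /eqP := ev _ pt; rewrite rmorphB rmorphM rmorph1 /= map_polyX !hornerE subr_eq0.
  by move/eqP => /(congr1 (fun z => y^-1 * z)); rewrite mulKf // mulr1.
have comp r : (map_poly i (r \Po t)).[y] = (map_poly i r).[y^-1].
  by rewrite map_comp_poly horner_comp ty.
have pV : root (map_poly i p) y^-1 by rewrite -root_bar // bp.
have [yd yu pE] := irreducible_conj_prod mp ip py.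
set d := (size p).-1 in cL yd yu pE.
have d0 : (0 < d)%N by case: ip; rewrite /d; case: (size p) => [|[]].
have [j jd yV] : exists2 j, (j < d)%N & y^-1 = y ^+ (q ^ j).
  move: pV; rewrite pE conj_prodE root_prod_XsubC => /mapP[j].
  by rewrite mem_iota add0n => /= jd ->; exists j.
have frob_root r : (map_poly i r).[y^-1] = (map_poly i r).[y] ^+ (q ^ j).
  rewrite yV; elim: j {jd yV} => [|j IH]; first by rewrite expr1.
  rewrite expnSr !exprM -IH -/(frob i _) -/(frob i (_.[_])).
  by rewrite -horner_map /= frob_poly_fixed.
have nth_inj k l : (k < d)%N -> (l < d)%N -> y ^+ (q ^ k) = y ^+ (q ^ l) -> k = l.
  move=> kd ld e; have := yu => /(nth_uniq 0 (i := k) (j := l)).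
  rewrite size_map size_iota => /(_ kd ld).
  by rewrite !(nth_map 0%N) ?size_iota // !nth_iota // !add0n e eqxx => /esym/eqP.
have y2 : y ^+ (q ^ (j + j)) = y.
  by rewrite expnD exprM -yV exprVn -yV invrK.
have j0 : j != 0%N.
  apply/eqP => j0; move: yV; rewrite j0 expr1 => /(congr1 (fun z => y * z)).
  rewrite mulfV // => /esym/eqP; rewrite -expr2 sqrf_eq1 => /orP[] /eqP yE.
    by move: py; rewrite yE rootE -(rmorph1 i) horner_map fmorph_eq0 (negPf p1).
  by move: py; rewrite yE rootE -(rmorphN1 i) horner_map fmorph_eq0 (negPf pN1).
have dE : d = (j + j)%N.
  case: (ltngtP (j + j)%N d) => // [lt|gt].
    have : (j + j)%N = 0%N by apply: nth_inj => //; rewrite y2 expr1.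
    by lia.
  have : ((j + j) - d)%N = 0%N.
    apply: nth_inj => //; first by lia.
    rewrite expr1 -{2}y2 -[in RHS](subnK (ltnW gt)) addnC expnD exprM yd //.
  by lia.
have q1 : (1 < q)%N := card_field_gt1 F.
have cy0 : (map_poly i c).[y] != 0.
  by apply: contra npc => cy; apply: irreducible_root_dvd ip py cy.
have cyQ : (map_poly i c).[y] ^+ (q ^ j) = (map_poly i c).[y].
  rewrite -frob_root -comp; apply/esym/eqP; rewrite -subr_eq0; apply/eqP.
  by have := ev _ pc; rewrite rmorphB hornerD hornerN.
have [||b bE] := @norm_surjective L (q ^ j) _ _ _ cy0 cyQ.
- by rewrite cL dE expnD mulnn.
- by rewrite -(expn0 q) ltn_exp2l // lt0n.
have [a aE] := root_generates ip py cL b.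
exists a; apply: (irreducible_root_dvd ip py).
rewrite rootE rmorphB rmorphM /= hornerD hornerN hornerM comp frob_root -aE.
by rewrite bE subrr.
Qed.
End NormLemma.

(** * Symplectic pairs and orthogonal splittings *)

Section SymplecticPairs.
Variable F : finFieldType.
Local Notation q := #|F|.

(** [J] is the Gram matrix of an invariant form on row vectors; in odd
   characteristic an antisymmetric form is alternating. *)
Definition symplectic_pair m (x J : 'M[F]_m) : Prop :=
  [/\ J^T = - J, J \in unitmx & x *m J *m x^T = J].

(** This is semisimplicity, since [X^(q^N) - X] is separable and every finite
   extension consists of roots of such a polynomial. In this form it passes to
   orthogonal summands. *)
Definition frobenius_periodic m (x : 'M[F]_m) : Prop :=
  exists2 N, (0 < N)%N & x ^+ (q ^ N) = x.

(** With [g] and [h] rectangular, [m = m'] is a consequence and decompositions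
   of the space need no casts. *)
Definition congruent m m' (x J : 'M[F]_m) (x' J' : 'M[F]_m') : Prop :=
  exists (g : 'M[F]_(m', m)) (h : 'M[F]_(m, m')),
    [/\ g *m h = 1%:M, h *m g = 1%:M, g *m x = x' *m g & g *m J *m g^T = J'].

Lemma congruent_sym m m' (x J : 'M[F]_m) (x' J' : 'M[F]_m') :
  congruent x J x' J' -> congruent x' J' x J.
Proof.
case=> g [h [gh hg gx gJ]]; exists h, g; split=> //.
  have -> : h *m x' = h *m (x' *m g) *m h by rewrite -!mulmxA gh mulmx1.
  by rewrite -gx !mulmxA hg mul1mx.
rewrite -gJ !mulmxA hg mul1mx -mulmxA -trmx_mul hg trmx1 mulmx1 //.
Qed.

Lemma congruent_trans m1 m2 m3 (x1 J1 : 'M[F]_m1) (x2 J2 : 'M[F]_m2)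
    (x3 J3 : 'M[F]_m3) :
  congruent x1 J1 x2 J2 -> congruent x2 J2 x3 J3 -> congruent x1 J1 x3 J3.
Proof.
case=> g [h [gh hg gx gJ]] [g' [h' [gh' hg' gx' gJ']]].
exists (g' *m g), (h *m h'); split.
- by rewrite -mulmxA (mulmxA g) gh mul1mx.
- by rewrite -mulmxA (mulmxA h') hg' mul1mx.
- by rewrite -mulmxA gx mulmxA gx' mulmxA.
- by rewrite trmx_mul -gJ' -gJ !mulmxA.
Qed.

Lemma congruent_char_poly m m' (x J : 'M[F]_m) (x' J' : 'M[F]_m') :
  congruent x J x' J' -> char_poly x = char_poly x'.
Proof.
case=> g [h [gh hg gx _]]; rewrite -(char_poly_conj x gh hg) gx -mulmxA gh.
by rewrite mulmx1.
Qed.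

Lemma congruent_symplectic m m' (x J : 'M[F]_m) (x' J' : 'M[F]_m') :
  congruent x J x' J' -> symplectic_pair x J -> symplectic_pair x' J'.
Proof.
case=> g [h [gh hg gx gJ]] [JT Ju xJ].
have em : m = m'.
  by apply/eqP; rewrite eqn_leq (mulmx1_min hg) (mulmx1_min gh).
subst m'; have [gu _] := mulmx1_unit gh.
split.
- by rewrite -gJ !trmx_mul trmxK JT mulNmx mulmxN mulmxA.
- by rewrite -gJ !unitmx_mul unitmx_tr gu Ju.
- rewrite -gJ !mulmxA -gx -!mulmxA -trmx_mul -gx trmx_mul !mulmxA.
  by rewrite -[g *m x *m J]mulmxA -[g *m _ *m _]mulmxA xJ.
Qed.

Lemma mxpow_intertwine m m' (x : 'M[F]_m) (x' : 'M[F]_m') (g : 'M[F]_(m', m)) k :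
  g *m x = x' *m g -> g *m x ^+ k = x' ^+ k *m g.
Proof.
move=> gx; elim: k => [|k IH]; first by rewrite !expr0 mulmx1 mul1mx.
by rewrite !exprSr -!mulmxE mulmxA IH -!mulmxA gx.
Qed.

Lemma congruent_periodic m m' (x J : 'M[F]_m) (x' J' : 'M[F]_m') :
  congruent x J x' J' -> frobenius_periodic x -> frobenius_periodic x'.
Proof.
case=> g [h [gh hg gx gJ]] [N N0 xN]; exists N => //.
have /(congr1 (mulmx^~ h)) := mxpow_intertwine (q ^ N) gx.
by rewrite xN gx -!mulmxA gh !mulmx1.
Qed.

Definition sum_mx m1 m2 (A : 'M[F]_m1) (B : 'M[F]_m2) := block_mx A 0 0 B.

Lemma mul_sum_mx m1 m2 (A A' : 'M[F]_m1) (B B' : 'M[F]_m2) :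
  sum_mx A B *m sum_mx A' B' = sum_mx (A *m A') (B *m B').
Proof. by rewrite /sum_mx mulmx_block !mulmx0 !mul0mx !addr0 add0r. Qed.

Lemma tr_sum_mx m1 m2 (A : 'M[F]_m1) (B : 'M[F]_m2) :
  (sum_mx A B)^T = sum_mx A^T B^T.
Proof. by rewrite /sum_mx tr_block_mx !trmx0. Qed.

Lemma sum_mx_inj m1 m2 (A A' : 'M[F]_m1) (B B' : 'M[F]_m2) :
  sum_mx A B = sum_mx A' B' -> A = A' /\ B = B'.
Proof. by case/eq_block_mx. Qed.

Lemma sum_mxX m1 m2 (A : 'M[F]_m1) (B : 'M[F]_m2) k :
  sum_mx A B ^+ k = sum_mx (A ^+ k) (B ^+ k).
Proof.
elim: k => [|k IH]; first by rewrite !expr0 /sum_mx -scalar_mx_block.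
by rewrite !exprS IH -!mulmxE mul_sum_mx.
Qed.

Lemma sum_mx_unit m1 m2 (A : 'M[F]_m1) (B : 'M[F]_m2) :
  (sum_mx A B \in unitmx) = (A \in unitmx) && (B \in unitmx).
Proof. by rewrite !unitmxE det_ublock unitrM. Qed.

Lemma char_poly_sum m1 m2 (A : 'M[F]_m1) (B : 'M[F]_m2) :
  char_poly (sum_mx A B) = char_poly A * char_poly B.
Proof. by rewrite /sum_mx /char_poly char_block_diag_mx det_ublock. Qed.

Lemma symplectic_sum m1 m2 (x1 J1 : 'M[F]_m1) (x2 J2 : 'M[F]_m2) :
  symplectic_pair (sum_mx x1 x2) (sum_mx J1 J2) <->
  symplectic_pair x1 J1 /\ symplectic_pair x2 J2.
Proof.
rewrite /symplectic_pair !tr_sum_mx sum_mx_unit !mul_sum_mx.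
have -> : - sum_mx J1 J2 = sum_mx (- J1) (- J2).
  by rewrite /sum_mx opp_block_mx !oppr0.
split=> [[/sum_mx_inj[? ?] /andP[? ?] /sum_mx_inj[? ?]]|].
  by split.
by case=> [[-> -> ->] [-> -> ->]].
Qed.

Lemma periodic_sum m1 m2 (x1 : 'M[F]_m1) (x2 : 'M[F]_m2) :
  frobenius_periodic (sum_mx x1 x2) <->
  frobenius_periodic x1 /\ frobenius_periodic x2.
Proof.
have iter m (x : 'M[F]_m) N k : x ^+ (q ^ N) = x -> x ^+ (q ^ (N * k)) = x.
  move=> xN; elim: k => [|k IH]; first by rewrite muln0 expr1.
  by rewrite mulnS expnD exprM xN.
split=> [[N N0]|[[N N0 e1] [M M0 e2]]].
  by rewrite sum_mxX => /sum_mx_inj[e1 e2]; split; exists N.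
exists (N * M)%N; first by rewrite muln_gt0 N0.
by rewrite sum_mxX iter // mulnC iter.
Qed.

Lemma congruent_sum m1 m2 m1' m2' (x1 J1 : 'M[F]_m1) (x2 J2 : 'M[F]_m2)
    (x1' J1' : 'M[F]_m1') (x2' J2' : 'M[F]_m2') :
  congruent x1 J1 x1' J1' -> congruent x2 J2 x2' J2' ->
  congruent (sum_mx x1 x2) (sum_mx J1 J2) (sum_mx x1' x2') (sum_mx J1' J2').
Proof.
case=> g [h [gh hg gx gJ]] [g' [h' [gh' hg' gx' gJ']]].
exists (block_mx g 0 0 g'), (block_mx h 0 0 h').
rewrite /sum_mx tr_block_mx !mulmx_block !trmx0 !(mulmx0, mul0mx, addr0, add0r).
by rewrite gh gh' hg hg' gx gx' gJ gJ' -!scalar_mx_block.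
Qed.

(** The orthogonal complement of a nondegenerate [x]-stable subspace is again
   [x]-stable and nondegenerate. *)
Lemma split_off k m (X G : 'M[F]_k) (x J : 'M[F]_m) (P : 'M[F]_(k, m)) :
  symplectic_pair x J -> X \in unitmx -> G \in unitmx ->
  P *m x = X *m P -> P *m J *m P^T = G ->
  exists m2 (x2 J2 : 'M[F]_m2), congruent x J (sum_mx X x2) (sum_mx G J2).
Proof.
move=> [JT Ju xJ] Xu Gu Px PJ.
have xu : x \in unitmx.
  by move: Ju; rewrite -xJ !unitmx_mul => /andP[/andP[]].
pose K := kermx (J *m P^T).
have [Q [QK Qfree]] : exists Q : 'M[F]_(\rank K, m), (Q :=: K)%MS /\ row_free Q.
  by exists (row_base K); split; [apply: eq_row_base | apply: row_base_free].
have QJ : Q *m J *m P^T = 0.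
  by rewrite -mulmxA; apply/sub_kermxP; rewrite QK.
have PJQ : P *m J *m Q^T = 0.
  apply: trmx_inj; rewrite !trmx_mul trmxK JT mulNmx mulmxN mulmxA QJ.
  by rewrite oppr0 trmx0.
have [x2 Qx] : exists x2, Q *m x = x2 *m Q.
  suff /submxP[x2 ->] : (Q *m x <= Q)%MS by exists x2.
  rewrite QK; apply/sub_kermxP.
  have e : x *m J *m P^T = J *m P^T *m invmx X^T.
    apply: (canRL (mulmxK _)); first by rewrite unitmx_tr.
    by rewrite -[LHS]mulmxA -trmx_mul -Px trmx_mul mulmxA xJ.
  by rewrite -mulmxA [x *m _]mulmxA e !mulmxA QJ mul0mx.
pose g := col_mx P Q.
have gfree : row_free g.
  apply: inj_row_free => a; rewrite -(hsubmxK a) mul_row_col => ag.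
  have : (lsubmx a *m P + rsubmx a *m Q) *m (J *m P^T) = 0 by rewrite ag mul0mx.
  rewrite mulmxDl -!mulmxA (mulmxA P) PJ (mulmxA Q) QJ mulmx0 addr0 => aG.
  have l0 : lsubmx a = 0 by rewrite -(mulmxK Gu (lsubmx a)) aG mul0mx.
  move: ag; rewrite l0 mul0mx add0r => bQ.
  suff -> : rsubmx a = 0 by rewrite row_mx0.
  by apply: (row_free_inj Qfree); rewrite bQ mul0mx.
have gfull : row_full g.
  rewrite /row_full (eqP gfree); apply/eqP.
  have rk : (k <= \rank (J *m P^T))%N.
    by rewrite -{1}(mxrank_unit Gu) -PJ -mulmxA mxrankM_maxr.
  rewrite /K mxrank_ker (_ : \rank (J *m P^T) = k).
    by rewrite subnKC // (leq_trans rk) // rank_leq_row.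
  by apply/eqP; rewrite eqn_leq rank_leq_col.
exists (\rank K), x2, (Q *m J *m Q^T), g, (pinvmx g); split.
- exact: mulmxVp.
- exact: mulVpmx.
- by rewrite /g mul_col_mx Px Qx /sum_mx mul_block_col !mul0mx addr0 add0r.
- by rewrite /g tr_col_mx mul_col_mx mul_col_row PJ QJ PJQ.
Qed.
End SymplecticPairs.

(** * Hyperbolic and self-dual pieces *)

Section Pieces.
Variable F : finFieldType.
Hypothesis odd_char : 2%:R != 0 :> F.
Local Notation q := #|F|.

Lemma antisym_eq0 m (S : 'M[F]_m) : S^T = - S -> S^T = S -> S = 0.
Proof.
move=> -> e; apply/matrixP => i j; rewrite !mxE.
have /matrixP/(_ i j) := e; rewrite !mxE => /eqP; rewrite eq_sym -subr_eq0 opprK.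
by rewrite -mulr2n -mulr_natl mulf_eq0 (negPf odd_char) => /eqP.
Qed.

(** Over a field with a root [y] of [p], the determinant of [p(x)] vanishes on an
   eigenvector of [x] for [y]; determinants do not see the extension. *)
Lemma exists_root_vector m (x : 'M[F]_m.+1) p :
  irreducible_poly p -> p %| char_poly x ->
  exists2 v : 'rV[F]_m.+1, v != 0 & v *m horner_mx x p = 0.
Proof.
move=> ip px; have [L [i [y [_ py]]]] := irreducible_root_extension ip.
have : \det (horner_mx x p) = 0.
  apply/eqP; rewrite -(fmorph_eq0 i) -det_map_mx map_horner_mx.
  have /eigenvalueP[u uy u0] : eigenvalue (map_mx i x) y.
    rewrite eigenvalue_root_char -map_char_poly.
    by case/dvdpP: px => r ->; rewrite rmorphM /= rootM py orbT.
  apply: contraT => dn0; have U : horner_mx (map_mx i x) (map_poly i p) \in unitmx.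
    by rewrite unitmxE unitfE.
  move: u0; rewrite -(mulmxK U u).
  suff -> : u *m horner_mx (map_mx i x) (map_poly i p) = 0 by rewrite mul0mx eqxx.
  have -> : u *m horner_mx (map_mx i x) (map_poly i p) = (map_poly i p).[y] *: u.
    elim/poly_ind: (map_poly i p) => [|r c IH].
      by rewrite rmorph0 mulmx0 horner0 scale0r.
    rewrite rmorphD rmorphM /= horner_mx_X horner_mx_C hornerMXaddC -mulmxE.
    rewrite mulmxDr mulmxA IH -scalemxAl uy scalerA scalerDl.
    by rewrite mul_mx_scalar.
  by rewrite (eqP py) scale0r.
move/eqP/det0P => [v v0 vp]; exists v => //.
Qed.

Lemma frobenius_pow_separable N : (0 < N)%N ->
  separable_poly ('X^(q ^ N) - 'X : {poly F}).
Proof.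
move=> N0; rewrite separable_poly.unlock derivB derivXn derivX -mulr_natl -polyC_natr.
rewrite (natr_card F^o N0) mul0r sub0r -[- 1]scaleN1r coprimepZr ?oppr_eq0 ?oner_eq0 //.
exact: coprimep1.
Qed.

Lemma symplectic_unit m (x J : 'M[F]_m) : symplectic_pair x J -> x \in unitmx.
Proof. by case=> _ Ju xJ; move: Ju; rewrite -xJ !unitmx_mul => /andP[/andP[]]. Qed.

(** The inverse of [x] is its adjoint for the form [J]. *)
Lemma symplectic_adjoint m (x J : 'M[F]_m.+1) p : symplectic_pair x J ->
  horner_mx (invmx x) p *m J = J *m (horner_mx x p)^T.
Proof.
move=> xJ; have xu := symplectic_unit xJ; case: xJ => _ _ xJ.
rewrite -horner_mx_tr; apply/esym; apply: intertwine_horner.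
by rewrite -{2}xJ !mulmxA mulVmx // mul1mx.
Qed.

Section OnePiece.
Variables (d : nat) (C : 'M[F]_d.+1).
Local Notation phi := (char_poly C).
Hypotheses (irrC : irreducible_poly phi) (phi0 : phi.[0] != 0).

Lemma piece_unit : C \in unitmx.
Proof.
rewrite unitmxE unitfE; apply: contraNneq phi0 => d0.
by rewrite horner_coef0 char_poly_det d0 mulr0.
Qed.

Lemma bar_irr : irreducible_poly (poly_bar phi).
Proof. exact: bar_irreducible (char_poly_monic C) phi0 irrC. Qed.

Lemma piece_inverse_poly : exists t,
  [/\ phi %| 'X * t - 1, horner_mx C t = invmx C &
      forall p, horner_mx (invmx C) p = horner_mx C (p \Po t)].
Proof.
have /Bezout_eq1_coprimepP[[u t] /= e] : coprimep phi 'X.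
  by rewrite coprimepX rootE.
have xt : 'X * t - 1 = - u * phi by rewrite -e; ring.
exists t; have tC : horner_mx C t = invmx C.
  rewrite -[RHS]mulmx1; apply: (canRL (mulKmx piece_unit)); rewrite mulmxE -{1}(horner_mx_X C) -rmorphM /=.
  by rewrite -[_ * t](subrK 1) xt rmorphD rmorphM /= Cayley_Hamilton mulr0 add0r rmorph1.
split=> // [|p]; first by rewrite xt dvdp_mull.
elim/poly_ind: p => [|p c IH]; first by rewrite comp_poly0 !rmorph0.
rewrite comp_polyD comp_polyM comp_polyX comp_polyC !rmorphD !rmorphM /=.
by rewrite IH tC horner_mx_X !horner_mx_C.
Qed.

(** Such an [S] intertwines [X^T] with [X^-1], whose characteristic polynomials
   are coprime. *)
Lemma isotropic (X S : 'M[F]_d.+1) : irreducible_poly (char_poly X) ->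
  X \in unitmx -> poly_bar (char_poly X) != char_poly X ->
  (char_poly X).[0] != 0 -> X *m S *m X^T = S -> S = 0.
Proof.
move=> iX uX nb X0 XS; set psi := char_poly X in iX nb X0.
have SX : S *m X^T = invmx X *m S by rewrite -{2}XS !mulmxA mulVmx // mul1mx.
have := intertwine_horner psi SX; rewrite horner_mx_tr Cayley_Hamilton trmx0 mulmx0.
have U : horner_mx (invmx X) psi \in unitmx.
  apply: horner_irr_unit; rewrite char_poly_inv //; first exact: bar_irreducible (char_poly_monic X) X0 iX.
  apply: contra nb => db; apply/eqP; apply: irreducible_monic_dvd db => //.
  - exact: bar_monic.
  - exact: char_poly_monic.
  - exact: bar_irreducible (char_poly_monic X) X0 iX.
by move/esym => e; rewrite -(mulKmx U S) e mulmx0.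
Qed.

(** Let [e(x)] be the idempotent projecting onto the [phi]-primary part. A vector
   pairing nontrivially with the image of [P1] still does so after applying the
   adjoint [e(x^-1)] of the projection, and is then annihilated by [phi(x^-1)].
   The module that it generates is in duality with the one given by [P1]. *)
Lemma dual_intertwiner m (x J : 'M[F]_m.+1) (P1 : 'M[F]_(d.+1, m.+1)) :
  symplectic_pair x J -> frobenius_periodic x -> P1 != 0 -> P1 *m x = C *m P1 ->
  exists P2 : 'M[F]_(d.+1, m.+1),
    P2 *m x = (invmx C)^T *m P2 /\ P2 *m J *m P1^T = 1%:M.
Proof.
move=> xJ [N N0 xN] P0 Px; have xu := symplectic_unit xJ.
have [JT Ju xJx] := xJ; have Cu := piece_unit.
pose p : {poly F} := 'X^(q ^ N) - 'X.
have px : horner_mx x p = 0.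
  by rewrite rmorphB /= rmorphXn /= !horner_mx_X xN subrr.
have [psi pE] : exists psi, p = psi * phi.
  apply/dvdpP; rewrite -horner_irr_eq0 //; apply: contraNT P0 => pC.
  have pCu : horner_mx C p \in unitmx.
    by apply: (horner_irr_unit irrC); rewrite -(horner_irr_eq0 irrC).
  by rewrite -(mulKmx pCu P1) -(intertwine_horner p Px) px mulmx0 mulmx0.
have /Bezout_eq1_coprimepP[[u w] /= uw] : coprimep phi psi.
  have := frobenius_pow_separable N0; rewrite -/p pE mulrC separable_mul.
  by case/and3P.
pose e := w * psi.
have eE : e = 1 - u * phi by rewrite /e -uw; ring.
have P1e : P1 *m horner_mx x e = P1.
  rewrite (intertwine_horner e Px) eE rmorphB rmorphM /= Cayley_Hamilton mulr0.
  by rewrite subr0 rmorph1 mul1mx.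
have ephi : horner_mx (invmx x) (e * phi) = 0.
  have : horner_mx x (e * phi) = 0.
    by rewrite /e -mulrA -pE rmorphM /= px mulr0.
  move=> e0; have := symplectic_adjoint (e * phi) xJ; rewrite e0 trmx0 mulmx0 => e1.
  by rewrite -(mulmxK Ju (horner_mx _ _)) e1 mul0mx.
have [w0 w0E] : exists w0 : 'rV[F]_m.+1, w0 *m (J *m P1^T) != 0.
  have : J *m P1^T != 0.
    apply: contraNneq P0 => e1; rewrite -(trmxK P1) -(mulKmx Ju P1^T) e1.
    by rewrite mulmx0 trmx0.
  by case/rowV0Pn => v /submxP[w0 ->]; exists w0.
pose v := w0 *m horner_mx (invmx x) e.
have vphi : v *m horner_mx (invmx x) phi = 0.
  by rewrite /v -mulmxA mulmxE -rmorphM /= ephi mulmx0.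
have [P2' [P2x [z zv]]] := intertwiner_of_vector irrC vphi.
pose H := P2' *m J *m P1^T.
have P2x' : P2' *m x = invmx C *m P2'.
  by rewrite -[LHS](mulKmx Cu) [C *m _]mulmxA -P2x mulmxKV.
have HC : H *m C^T = C *m H.
  rewrite /H -!mulmxA -trmx_mul -Px trmx_mul.
  rewrite -[in LHS](mulKVmx Cu P2') -!mulmxA; congr (_ *m _).
  by rewrite [invmx C *m _]mulmxA -P2x' -!mulmxA [x *m (J *m _)]mulmxA [x *m J *m _]mulmxA xJx.
have H0 : H != 0.
  apply: contraNneq w0E => H0; have : z *m H = 0 by rewrite H0 mulmx0.
  rewrite /H !mulmxA zv /v -[w0 *m _ *m J]mulmxA (symplectic_adjoint e xJ).
  by rewrite -!mulmxA -trmx_mul P1e => ->.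
have Hu : H \in unitmx := intertwiner_unit irrC HC H0.
exists (invmx H *m P2'); split; last by rewrite -!mulmxA mulmxA -mulmxA [P2' *m _]mulmxA mulVmx.
have HC' : invmx H *m C = C^T *m invmx H.
  by rewrite -[LHS](mulmxK Hu) -[invmx H *m C *m H]mulmxA -HC mulKmx.
have HV : invmx H *m invmx C = (invmx C)^T *m invmx H.
  rewrite trmx_inv; apply: (canLR (mulmxK Cu)) => /=.
  by rewrite -mulmxA HC' mulKmx // unitmx_tr.
by rewrite -mulmxA P2x' !mulmxA HV.
Qed.
End OnePiece.
End Pieces.

Section TwoKinds.
Variable F : finFieldType.
Hypothesis odd_char : 2%:R != 0 :> F.
Local Notation q := #|F|.
Variables (d : nat) (C : 'M[F]_d.+1).
Local Notation phi := (char_poly C).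
Hypotheses (irrC : irreducible_poly phi) (phi0 : phi.[0] != 0).

Let Cu : C \in unitmx := piece_unit phi0.

(** The sum of [F[z]/phi] and its dual, with the natural pairing. *)
Definition hyp_x : 'M[F]_(d.+1 + d.+1) := sum_mx C (invmx C)^T.
Definition hyp_form : 'M[F]_(d.+1 + d.+1) := symplectic_form F d.+1.

Lemma symplectic_form_antisym n :
  (symplectic_form F n)^T = - symplectic_form F n.
Proof.
rewrite /symplectic_form tr_block_mx !trmx0 linearN /= !trmx1.
by rewrite opp_block_mx !oppr0 opprK.
Qed.

Lemma symplectic_form_unit n : symplectic_form F n \in unitmx.
Proof.
suff : symplectic_form F n *m - symplectic_form F n = 1%:M by case/mulmx1_unit.
rewrite /symplectic_form opp_block_mx !oppr0 opprK mulmx_block.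
by rewrite !(mulmx0, mul0mx, mulmx1, mul1mx, mulmxN, mulNmx, opprK, addr0, add0r) -scalar_mx_block.
Qed.

Lemma hyp_symplectic : symplectic_pair hyp_x hyp_form.
Proof.
split; [exact: symplectic_form_antisym | exact: symplectic_form_unit |].
rewrite /hyp_x /hyp_form tr_sum_mx trmxK /sum_mx /symplectic_form !mulmx_block.
rewrite !(mulmx0, mul0mx, mulmx1, mul1mx, mulmxN, mulNmx, addr0, add0r).
by rewrite mulmxV // -trmx_mul mulmxV // trmx1.
Qed.

Lemma char_poly_hyp : char_poly hyp_x = phi * poly_bar phi.
Proof. by rewrite char_poly_sum char_poly_tr char_poly_inv. Qed.

Lemma piece_periodic : frobenius_periodic C.
Proof.
exists d.+1 => //; apply/eqP; rewrite -subr_eq0.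
have -> : C ^+ (q ^ d.+1) - C = horner_mx C ('X^(q ^ d.+1) - 'X).
  by rewrite rmorphB /= rmorphXn /= horner_mx_X.
rewrite (horner_irr_eq0 irrC).
have [L [i [y [cL py]]]] := irreducible_root_extension irrC.
apply: (irreducible_root_dvd irrC py); rewrite rmorphB /= map_polyXn map_polyX.
by rewrite rootE !hornerE subr_eq0 -[X in y ^+ (q ^ X)]/(d.+2.-1) -{1}(size_char_poly C) -cL expf_card.
Qed.

Lemma hyp_periodic : frobenius_periodic hyp_x.
Proof.
have [N N0 CN] := piece_periodic.
apply/periodic_sum; split; exists N => //; move: (q ^ N)%N CN => k CN.
have trX (A : 'M[F]_d.+1) l : A^T ^+ l = (A ^+ l)^T.
  elim: l => [|l IH]; first by rewrite !expr0 trmx1.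
  by rewrite exprS exprSr -!mulmxE IH trmx_mul.
rewrite trX; congr trmx; rewrite -{2}CN; apply: exprVn.
Qed.

Lemma antisym_isotropic (S : 'M[F]_d.+1) : (d = 0)%N -> S^T = - S -> S = 0.
Proof.
move=> d0 ST; apply: (antisym_eq0 odd_char ST).
by apply/matrixP => i j; rewrite mxE; congr (S _ _); apply/val_inj => /=; move: (ltn_ord i) (ltn_ord j); lia.
Qed.

(** A copy of [F[z]/phi] in the space is isotropic, either because [phi] is not
   self-dual or because it has dimension one; together with a dual copy it is
   hyperbolic. *)
Lemma hyp_split m (x J : 'M[F]_m) :
  poly_bar phi != phi \/ d = 0%N ->
  symplectic_pair x J -> frobenius_periodic x -> phi %| char_poly x ->
  exists P : 'M[F]_(d.+1 + d.+1, m),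
    P *m x = hyp_x *m P /\ P *m J *m P^T = hyp_form.
Proof.
move=> kind; case: m x J => [|m] x J xJ xN phix.
  have := dvdp_leq (monic_neq0 (char_poly_monic x)) phix.
  by rewrite !size_char_poly.
have iso (X : 'M[F]_d.+1) (P : 'M[F]_(d.+1, m.+1)) : irreducible_poly (char_poly X) ->
    X \in unitmx -> (char_poly X = phi \/ char_poly X = poly_bar phi) ->
    P *m x = X *m P -> P *m J *m P^T = 0.
  have [JT Ju xJx] := xJ; have mphi := char_poly_monic C.
  move=> iX Xu cX Px; case: kind => [nb|d0]; last first.
    by apply: antisym_isotropic => //; rewrite !trmx_mul trmxK JT mulNmx mulmxN mulmxA.
  apply: (isotropic iX Xu).
  - by case: cX => -> //; rewrite barK // eq_sym.
  - by case: cX => -> //; apply: bar_horner0_neq0.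
  - by rewrite !mulmxA -Px -!mulmxA -trmx_mul -Px trmx_mul !mulmxA -[P *m x *m J]mulmxA -[P *m _ *m _]mulmxA xJx.
have [v v0 vphi] := exists_root_vector irrC phix.
have [P1 [P1x [u uP1]]] := intertwiner_of_vector irrC vphi.
have P10 : P1 != 0 by apply: contraNneq v0 => P10; rewrite -uP1 P10 mulmx0.
have [P2 [P2x P2J]] := dual_intertwiner irrC phi0 xJ xN P10 P1x.
have iB := bar_irr irrC phi0.
have P1P1 : P1 *m J *m P1^T = 0 by apply: (iso C) => //; left.
have P2P2 : P2 *m J *m P2^T = 0.
  apply: (iso (invmx C)^T) => //; rewrite ?unitmx_tr ?unitmx_inv //.
    by rewrite char_poly_tr char_poly_inv.
  by right; rewrite char_poly_tr char_poly_inv.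
have P1P2 : P1 *m J *m P2^T = - 1%:M.
  have [JT _ _] := xJ; apply: trmx_inj; rewrite !trmx_mul trmxK JT mulNmx mulmxN.
  by rewrite mulmxA P2J linearN /= trmx1.
exists (col_mx P1 (- P2)); split.
  by rewrite mul_col_mx /hyp_x mul_block_col !mul0mx addr0 add0r P1x mulNmx P2x mulmxN.
rewrite tr_col_mx mul_col_mx mul_col_row linearN /= !(mulNmx, mulmxN).
by rewrite P1P1 P1P2 P2J P2P2 !opprK.
Qed.

Section SelfDual.
Hypotheses (self_dual : poly_bar phi = phi) (phi1 : phi.[1] != 0)
  (phiN1 : phi.[-1] != 0).

(** Invariant forms are the intertwiners between [C] and [C^-T]. *)
Lemma invariant_form_comm (S : 'M[F]_d.+1) :
  C *m S *m C^T = S <-> S *m (invmx C)^T = C *m S.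
Proof.
rewrite trmx_inv; split=> [CS|SC]; last by rewrite -SC mulmxKV // unitmx_tr.
by rewrite -{1}CS mulmxK // unitmx_tr.
Qed.

Lemma invariant_form_unit (S : 'M[F]_d.+1) :
  C *m S *m C^T = S -> S != 0 -> S \in unitmx.
Proof. by move/invariant_form_comm => SC; apply: (intertwiner_unit irrC SC). Qed.

(** If [C] were its own inverse, [phi] would divide [(X - 1)(X + 1)]. *)
Lemma sub_inv_unit : C - invmx C \in unitmx.
Proof.
have [t [pt tC _]] := piece_inverse_poly phi0.
rewrite -tC -{1}(horner_mx_X C) -rmorphB; apply: (horner_irr_unit irrC).
apply/negP => dvd.
have : phi %| ('X - 1) * ('X + 1).
  have -> : ('X - 1) * ('X + 1) = 'X * ('X - t) + ('X * t - 1) :> {poly F} by ring.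
  by rewrite dvdp_add // dvdp_mull.
have [L [i [y [_ py]]]] := irreducible_root_extension irrC.
case/dvdpP => r /(congr1 (map_poly i)) e.
have : root (map_poly i (('X - 1) * ('X + 1))) y by rewrite e rmorphM rootM py orbT.
rewrite rmorphM rootM rmorphB rmorphD /= map_polyX rmorph1 /root !hornerE subr_eq0.
case/orP => [/eqP yE|]; last rewrite addr_eq0 => /eqP yE.
  by move: py; rewrite yE rootE -(rmorph1 i) horner_map fmorph_eq0 (negPf phi1).
by move: py; rewrite yE rootE -(rmorphN1 i) horner_map fmorph_eq0 (negPf phiN1).
Qed.

(** If [S] is an invariant form then [S - S^T] is an invariant alternating one,
   unless [S] is symmetric; in that case [(C - C^-1) S] is alternating. *)
Lemma alternate_form (S : 'M[F]_d.+1) : C *m S *m C^T = S -> S != 0 ->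
  S - S^T != 0 \/ S^T = S /\ (invmx C - C) *m S != 0.
Proof.
move=> CS S0; have [|e] := eqVneq (S - S^T) 0; last by left.
move/subr0_eq => e; right; split=> //; apply: contraNneq S0 => /eqP.
rewrite -opprB mulNmx oppr_eq0 => /eqP e1.
by rewrite -(mulKmx sub_inv_unit S) e1 mulmx0.
Qed.

(** For self-dual [phi] the matrices [C] and [C^-T] have the same irreducible
   characteristic polynomial, so a nonzero intertwiner exists. *)
Lemma self_form_exists : exists S G : 'M[F]_d.+1,
  [/\ C *m S *m C^T = S, S != 0 & symplectic_pair C G].
Proof.
have charE : char_poly (invmx C)^T = phi by rewrite char_poly_tr char_poly_inv.
pose v : 'rV[F]_d.+1 := delta_mx 0 0.
have vphi : v *m horner_mx (invmx C)^T phi = 0.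
  by rewrite -charE Cayley_Hamilton mulmx0.
have [S [SC [u uS]]] := intertwiner_of_vector irrC vphi.
have S0 : S != 0.
  apply/eqP => S0; move: uS; rewrite S0 mulmx0 => /rowP/(_ 0).
  by rewrite !mxE !eqxx => /eqP; rewrite eq_sym oner_eq0.
have CS : C *m S *m C^T = S by apply/invariant_form_comm.
have CST : C *m S^T *m C^T = S^T by rewrite -{2}CS !trmx_mul trmxK mulmxA.
have form G : C *m G *m C^T = G -> G^T = - G -> G != 0 -> symplectic_pair C G.
  by move=> CG GT G0; split=> //; apply: invariant_form_unit.
exists S; case: (alternate_form CS S0) => [D0|[ST D0]].
  exists (S - S^T); split=> //; apply: form => //.
    by rewrite mulmxBr mulmxBl CS CST.
  by rewrite linearB /= trmxK opprB.
exists ((invmx C - C) *m S); split=> //; apply: form => //.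
  rewrite mulmxA mulmxBr mulmxV // -(mulVmx Cu) -mulmxBl -!mulmxA; congr (_ *m _).
  by rewrite mulmxA CS.
rewrite trmx_mul ST linearB /= mulmxBr mulmxBl (proj1 (invariant_form_comm S)) //.
rewrite opprB; congr (_ - _).
by rewrite -[in RHS]CS -!mulmxA mulKmx.
Qed.
End SelfDual.
End TwoKinds.

Section SelfDualSplit.
Variable F : finFieldType.
Variables (d : nat) (C : 'M[F]_d.+1).
Local Notation phi := (char_poly C).
Hypotheses (irrC : irreducible_poly phi) (phi0 : phi.[0] != 0).
Hypotheses (self_dual : poly_bar phi = phi) (phi1 : phi.[1] != 0)
  (phiN1 : phi.[-1] != 0).
Let Cu : C \in unitmx := piece_unit phi0.

(** Two alternating invariant forms differ by a factor fixed by [z |-> 1/z]. Such a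
   factor is a norm, and rescaling the generator of [F[z]/phi] changes the form by
   a norm. *)
Lemma rescale_form (G G0 : 'M[F]_d.+1) :
  symplectic_pair C G -> symplectic_pair C G0 ->
  exists A : 'M[F]_d.+1, [/\ A \in unitmx, A *m C = C *m A & A *m G *m A^T = G0].
Proof.
move=> [GT Gu CG] [G0T G0u CG0].
have GC : G *m (invmx C)^T = C *m G by apply/invariant_form_comm.
have G0C : G0 *m (invmx C)^T = C *m G0 by apply/invariant_form_comm.
have [t [pt tC comp]] := piece_inverse_poly phi0.
have G0V : invmx G *m C = (invmx C)^T *m invmx G.
  by rewrite -[LHS](mulmxK Gu) -[invmx G *m C *m G]mulmxA -GC mulKmx.
have adj p : G *m (horner_mx C p)^T = horner_mx (invmx C) p *m G.
  by rewrite (symplectic_adjoint p (And3 GT Gu CG)).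
have [c cE] : exists c, G0 *m invmx G = horner_mx C c.
  by apply: commutant_horner => //; rewrite -mulmxA G0V !mulmxA G0C.
have G0E : G0 = horner_mx C c *m G by rewrite -cE mulmxKV.
have npc : ~~ (phi %| c).
  rewrite -(horner_irr_eq0 irrC); apply: contraTneq G0u => c0.
  by rewrite G0E c0 mul0mx unitmxE det0 unitr0.
have csym : phi %| c - (c \Po t).
  rewrite -(horner_irr_eq0 irrC) rmorphB subr_eq0 /= -comp.
  apply/eqP/(can_inj (mulmxK Gu)); rewrite /= -adj -G0E.
  have := G0T; rewrite {1}G0E trmx_mul GT mulNmx => /eqP.
  by rewrite eqr_opp => /eqP.
have [a aE] := self_dual_norm (char_poly_monic C) irrC phi0 self_dual phi1 phiN1 pt npc csym.
move: aE; rewrite -(horner_irr_eq0 irrC) rmorphB subr_eq0 rmorphM /= -comp => /eqP aE.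
exists (horner_mx C a); split.
- rewrite (horner_irr_unit irrC) //; apply: contra npc => pa.
  rewrite -(horner_irr_eq0 irrC) aE; move: pa.
  by rewrite -(horner_irr_eq0 irrC) => /eqP ->; rewrite mul0r.
- by apply: comm_horner_mx; apply: comm_mx_refl.
- by rewrite -mulmxA adj mulmxA G0E aE -mulmxE.
Qed.

(** Some copy of [F[z]/phi] in the space is not isotropic; its form is then
   rescaled to [G]. *)
Lemma self_split m (x J : 'M[F]_m) (G : 'M[F]_d.+1) :
  symplectic_pair C G ->
  symplectic_pair x J -> frobenius_periodic x -> phi %| char_poly x ->
  exists P : 'M[F]_(d.+1, m), P *m x = C *m P /\ P *m J *m P^T = G.
Proof.
move=> CG; case: m x J => [|m] x J xJ xN phix.
  have := dvdp_leq (monic_neq0 (char_poly_monic x)) phix.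
  by rewrite !size_char_poly.
have [JT Ju xJx] := xJ.
have [v v0 vphi] := exists_root_vector irrC phix.
have [P1 [P1x [u uP1]]] := intertwiner_of_vector irrC vphi.
have P10 : P1 != 0 by apply: contraNneq v0 => P10; rewrite -uP1 P10 mulmx0.
have [P2 [P2x P2J]] := dual_intertwiner irrC phi0 xJ xN P10 P1x.
have [S [_ [CS S0 _]]] := self_form_exists irrC phi0 self_dual phi1 phiN1.
have SC : S *m (invmx C)^T = C *m S by apply/invariant_form_comm.
have [P3 P3E] : exists P3, P3 = S *m P2 by eexists.
have P3x : P3 *m x = C *m P3 by rewrite P3E -mulmxA P2x !mulmxA SC.
have invar (P Q : 'M[F]_(d.+1, m.+1)) : P *m x = C *m P -> Q *m x = C *m Q ->
    C *m (P *m J *m Q^T) *m C^T = P *m J *m Q^T.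
  move=> Px Qx; rewrite !mulmxA -Px -!mulmxA -trmx_mul -Qx trmx_mul.
  by rewrite [x *m (J *m _)]mulmxA [x *m J *m _]mulmxA xJx.
have anti (P : 'M[F]_(d.+1, m.+1)) : (P *m J *m P^T)^T = - (P *m J *m P^T).
  by rewrite !trmx_mul trmxK JT mulNmx mulmxN mulmxA.
(* a nonisotropic copy of the module exists by polarization of the pairing
   between P1 and P3 *)
have [P [Px PJ]] : exists P : 'M[F]_(d.+1, m.+1),
    P *m x = C *m P /\ P *m J *m P^T != 0.
  have [P1P1|] := eqVneq (P1 *m J *m P1^T) 0; last by exists P1.
  have [P3P3|] := eqVneq (P3 *m J *m P3^T) 0; last by exists P3.
  have TE : P3 *m J *m P1^T = S by rewrite P3E -!mulmxA [P2 *m _]mulmxA P2J mulmx1.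
  have TT : P1 *m J *m P3^T = - S^T.
    by rewrite -TE !trmx_mul trmxK JT mulNmx mulmxN mulmxA opprK.
  case: (alternate_form irrC phi0 phi1 phiN1 CS S0) => [D|[ST D]].
    exists (P1 + P3); split; first by rewrite mulmxDl mulmxDr P1x P3x.
    rewrite linearD /= mulmxDl mulmxDl !mulmxDr P1P1 P3P3 TE TT addr0 add0r.
    by rewrite addrC.
  exists (P1 + C *m P3); split.
    by rewrite mulmxDl mulmxDr P1x -mulmxA P3x.
  have -> : (P1 + C *m P3) *m J *m (P1 + C *m P3)^T = - ((invmx C - C) *m S).
    rewrite linearD /= trmx_mul mulmxDl mulmxDl !mulmxDr -!mulmxA.
    rewrite [P1 *m (J *m _)]mulmxA P1P1 add0r.
    rewrite [P3 *m (J *m P1^T)]mulmxA TE [J *m (P3^T *m _)]mulmxA.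
    rewrite [P1 *m (J *m P3^T *m _)]mulmxA [P1 *m (J *m _)]mulmxA TT.
    rewrite [P3 *m (J *m P3^T *m _)]mulmxA [P3 *m (J *m _)]mulmxA P3P3 mul0mx mulmx0 addr0.
    rewrite ST mulNmx mulmxBl opprB addrC; congr (_ - _).
    by rewrite -[in RHS]CS -!mulmxA mulKmx.
  by rewrite oppr_eq0.
have PG : symplectic_pair C (P *m J *m P^T).
  split; [exact: anti | | exact: invar].
  by apply: (invariant_form_unit irrC phi0) => //; apply: invar.
have [A [Au AC AG]] := rescale_form PG CG.
exists (A *m P); split; first by rewrite -mulmxA Px !mulmxA AC.
by rewrite trmx_mul -AG !mulmxA.
Qed.
End SelfDualSplit.

(** * Classification by the characteristic polynomial *)

Section Classification.
Variable F : finFieldType.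
Hypothesis odd_char : 2%:R != 0 :> F.
Local Notation q := #|F|.

Lemma exists_companion (p : {poly F}) : p \is monic -> irreducible_poly p ->
  exists d (C : 'M[F]_d.+1), char_poly C = p.
Proof.
move=> mp [p1 _]; have [C CE] : exists C : 'M[F]_((size p).-1), char_poly C = p.
  by exists (companionmx p); rewrite companionmxK.
by move: C CE; case: (size p) p1 => [|[|d]] //= _ C CE; exists d, C.
Qed.

Lemma irreducible_no_root (p : {poly F}) a :
  irreducible_poly p -> size p != 2 -> p.[a] != 0.
Proof.
move=> [p1 ip] p2; apply/negP => /eqP pa.
have := ip ('X - a%:P); rewrite size_XsubC dvdp_XsubCl rootE pa eqxx.
by move=> /(_ isT isT) /eqp_size; rewrite size_XsubC => e; rewrite -e in p2.
Qed.

(** Evaluate [p(z) = z^d p(1/z) / p(0)] at the fixed points of [z |-> 1/z]. *)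
Lemma self_dual_values (p : {poly F}) : p.[0] != 0 -> poly_bar p = p ->
  p.[1] != 0 -> p.[-1] != 0 -> p.[0] = 1 /\ (-1) ^+ (size p).-1 = 1 :> F.
Proof.
move=> p0 bp p1 pN1.
have idE (r : {poly F}) : map_poly idfun r = r by apply: map_poly_id.
have p0E : p.[0] = 1.
  have := @horner_bar F F idfun p 1 (oner_neq0 _); rewrite !idE bp invr1 expr1n mul1r /=.
  move/(congr1 (fun z => z / p.[1])); rewrite mulfK // divff // => /esym/eqP.
  by rewrite invr_eq1 => /eqP.
split=> //; have := @horner_bar F F idfun p (-1); rewrite oppr_eq0 oner_eq0 => /(_ isT).
rewrite !idE bp /= p0E invr1 mul1r invrN1.
by move/(congr1 (fun z => z / p.[-1])); rewrite mulfK // divff.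
Qed.

(** The summand [(X, G)] split off is the same for all symplectic pairs whose
   characteristic polynomial is divisible by [p]; this is what makes the
   characteristic polynomial a complete invariant. *)
Lemma common_piece (p : {poly F}) : p \is monic -> irreducible_poly p -> p.[0] != 0 ->
  exists k (X G : 'M[F]_k), [/\ (0 < k)%N, X \in unitmx, \det X = 1 &
    forall m (x J : 'M[F]_m), symplectic_pair x J -> frobenius_periodic x ->
      p %| char_poly x ->
      exists m2 (x2 J2 : 'M[F]_m2), congruent x J (sum_mx X x2) (sum_mx G J2)].
Proof.
move=> mp ip p0; have [d [C CE]] := exists_companion mp ip.
have sp : size p = d.+2 by rewrite -CE size_char_poly.
rewrite -CE in ip p0 *; have Cu := piece_unit p0.
have [kind|nkind] := pselect (poly_bar (char_poly C) != char_poly C \/ d = 0%N).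
  exists (d.+1 + d.+1)%N, (hyp_x C), (hyp_form F d); have [_ Hu _] := hyp_symplectic p0.
  have Xu : hyp_x C \in unitmx by rewrite sum_mx_unit Cu unitmx_tr unitmx_inv.
  split=> // [|m x J xJ xN px].
    by rewrite /hyp_x /sum_mx det_ublock det_tr det_inv divff // -unitfE -unitmxE.
  have [P [Px PJ]] := hyp_split odd_char ip p0 kind xJ xN px.
  exact: split_off xJ Xu Hu Px PJ.
have self : poly_bar (char_poly C) = char_poly C.
  by apply: contra_notP nkind => /eqP; left.
have s2 : size (char_poly C) != 2%N.
  by rewrite size_char_poly; apply: contra_notN nkind => /eqP[]; right.
have c1 := irreducible_no_root 1 ip s2; have cN1 := irreducible_no_root (-1) ip s2.
have [S [G [_ _ CG]]] := self_form_exists ip p0 self c1 cN1.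
have [_ Gu _] := CG; exists d.+1, C, G; split=> // [|m x J xJ xN px].
  have [e0] := self_dual_values p0 self c1 cN1; rewrite size_char_poly /= => e1.
  by move: e0; rewrite horner_coef0 char_poly_det e1 mul1r.
have [P [Px PJ]] := self_split ip p0 self c1 cN1 CG xJ xN px.
exact: split_off xJ Cu Gu Px PJ.
Qed.

Lemma char_poly_factor m (x J : 'M[F]_m) : symplectic_pair x J -> (0 < m)%N ->
  exists p, [/\ p \is monic, irreducible_poly p, p.[0] != 0 & p %| char_poly x].
Proof.
move=> xJ m0; have [|p [mp ip px]] := @exists_irreducible_factor F (char_poly x).
  by rewrite size_char_poly ltnS.
exists p; split=> //; apply: dvdp_horner0 px _.
rewrite horner_coef0 char_poly_det mulf_neq0 ?expf_neq0 ?oppr_eq0 ?oner_eq0 //.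
by rewrite -unitfE -unitmxE (symplectic_unit xJ).
Qed.

Lemma congruent_dim m m' (x J : 'M[F]_m) (x' J' : 'M[F]_m') :
  congruent x J x' J' -> m = m'.
Proof.
by case=> g [h [gh hg _ _]]; apply/eqP; rewrite eqn_leq (mulmx1_min hg) (mulmx1_min gh).
Qed.

(** Split the same piece off from both, and compare the complements. *)
Theorem congruent_of_char_poly m m' (x J : 'M[F]_m) (x' J' : 'M[F]_m') :
  symplectic_pair x J -> symplectic_pair x' J' ->
  frobenius_periodic x -> frobenius_periodic x' ->
  char_poly x = char_poly x' -> congruent x J x' J'.
Proof.
have [n] := ubnP m; elim: n => // n IHn in m m' x J x' J' *.
move=> lbn xJ xJ' xN xN' cE.
have em : m' = m.
  by apply: succn_inj; rewrite -(size_char_poly x') -cE size_char_poly.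
subst m'; case: (posnP m) => [m0|m0].
  subst m; exists 0, 0; split; rewrite ?flatmx0 //; apply/matrixP => i; by case: i.
have [p [mp ip p0 px]] := char_poly_factor xJ m0.
have [k [X [G [k0 Xu _ sp]]]] := common_piece mp ip p0.
have [m2 [x2 [J2 c1]]] := sp _ _ _ xJ xN px.
have [|m2' [x2' [J2' c2]]] := sp _ _ _ xJ' xN'; first by rewrite -cE.
have [_ s1] := proj1 (symplectic_sum _ _ _ _) (congruent_symplectic c1 xJ).
have [_ s2] := proj1 (symplectic_sum _ _ _ _) (congruent_symplectic c2 xJ').
have [_ n1] := proj1 (periodic_sum _ _) (congruent_periodic c1 xN).
have [_ n2] := proj1 (periodic_sum _ _) (congruent_periodic c2 xN').
apply: (congruent_trans c1); apply: congruent_sym.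
apply: (congruent_trans c2); apply: congruent_sum.
  by exists 1%:M, 1%:M; split; rewrite ?mulmx1 ?mul1mx ?trmx1 ?mulmx1.
apply: congruent_sym; apply: IHn => //.
  by have := congruent_dim c1; lia.
have := cE; rewrite (congruent_char_poly c1) (congruent_char_poly c2) !char_poly_sum.
by apply: mulfI; rewrite monic_neq0 // char_poly_monic.
Qed.

Lemma symplectic_det m (x J : 'M[F]_m) :
  symplectic_pair x J -> frobenius_periodic x -> \det x = 1.
Proof.
have [n] := ubnP m; elim: n => // n IHn in m x J * => lbn xJ xN.
case: (posnP m) => [m0|m0]; first by subst m; rewrite det_mx00.
have [p [mp ip p0 px]] := char_poly_factor xJ m0.
have [k [X [G [k0 Xu dX sp]]]] := common_piece mp ip p0.
have [m2 [x2 [J2 c1]]] := sp _ _ _ xJ xN px.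
have [_ s1] := proj1 (symplectic_sum _ _ _ _) (congruent_symplectic c1 xJ).
have [_ n1] := proj1 (periodic_sum _ _) (congruent_periodic c1 xN).
have d2 : \det x2 = 1 by apply: IHn s1 n1; have := congruent_dim c1; lia.
have em := congruent_dim c1; subst m; case: c1 => g [h [gh _ gx _]].
have : \det (g *m x) = \det (sum_mx X x2 *m g) by rewrite gx.
have [gu _] := mulmx1_unit gh.
rewrite !det_mulmx [RHS]mulrC /sum_mx det_ublock dX d2 mulr1.
by move/mulfI; apply; rewrite -unitfE -unitmxE.
Qed.

(** Invariance of [J] makes [x^-1] similar to the transpose of [x]. *)
Lemma symplectic_bar m (x J : 'M[F]_m) :
  symplectic_pair x J -> poly_bar (char_poly x) = char_poly x.
Proof.
move=> xJ; have xu := symplectic_unit xJ; have [_ Ju xJx] := xJ.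
rewrite -char_poly_inv //.
have -> : invmx x = J *m x^T *m invmx J.
  by rewrite -[J *m x^T](mulKmx xu) [x *m _]mulmxA xJx mulmxK.
by rewrite (char_poly_conj _ (mulmxV Ju) (mulVmx Ju)) char_poly_tr.
Qed.
End Classification.

(** * Semisimple classes of the symplectic group *)

Section SemisimpleClasses.
Variable F : finFieldType.
Hypothesis odd_char : 2%:R != 0 :> F.
Local Notation q := #|F|.

Lemma semisimple_periodicP m (x : 'M[F]_m.+1) :
  semisimple_mx x <-> frobenius_periodic x.
Proof.
have minE N : (x ^+ (q ^ N) = x) <-> mxminpoly x %| 'X^(q ^ N) - 'X.
  rewrite dvd_mxminpoly rmorphB /= rmorphXn /= !horner_mx_X subr_eq0.
  by split=> [->|/eqP].
split=> [[L /diagonalizableP[rs urs]]|[N N0 /minE xN]].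
  rewrite mxminpoly_map => xrs.
  have N0 : (0 < \dim {:L})%N by exact: adim_gt0.
  exists (\dim {:L}) => //; apply/minE.
  rewrite -(dvdp_map (in_alg L)); apply: (dvdp_trans xrs).
  apply: uniq_roots_dvdp; last by rewrite uniq_rootsE.
  apply/allP => r _; rewrite rmorphB /= map_polyXn map_polyX rootE !hornerE.
  by rewrite expr_card_pow subrr.
have p0 : ('X^(q ^ N) - 'X : {poly F}) != 0.
  have := frobenius_pow_separable F N0; apply: contraTneq => ->.
  by rewrite separable_poly.unlock derivC coprimep0 -size_poly_eq1 size_poly0.
have [L [rs Dp _]] := FinSplittingFieldFor p0.
exists L; apply/diagonalizableP; exists rs.
  rewrite -separable_prod_XsubC -(eqp_separable Dp) separable_map.
  exact: frobenius_pow_separable.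
by rewrite mxminpoly_map -(eqp_dvdr _ Dp) dvdp_map.
Qed.

Lemma SpP n (x : 'M[F]_(n + n)) :
  reflect (symplectic_pair x (symplectic_form F n)) (x \in Sp F n).
Proof.
rewrite inE; apply: (iffP eqP) => [e|[]//].
by split=> //; [exact: symplectic_form_antisym | exact: symplectic_form_unit].
Qed.

Lemma Sp_unit n (x : 'M[F]_(n + n)) : x \in Sp F n -> x \in unitmx.
Proof. by move/SpP/symplectic_unit. Qed.

Lemma SpM n (x y : 'M[F]_(n + n)) : x \in Sp F n -> y \in Sp F n -> x *m y \in Sp F n.
Proof.
rewrite !inE => /eqP ex /eqP ey; rewrite trmx_mul -!mulmxA.
by rewrite (mulmxA y) (mulmxA (y *m _)) ey mulmxA ex.
Qed.

Lemma SpV n (x : 'M[F]_(n + n)) : x \in Sp F n -> invmx x \in Sp F n.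
Proof.
move=> xS; have xu := Sp_unit xS; move: xS; rewrite !inE => /eqP ex.
rewrite -{1}ex !mulmxA mulVmx // mul1mx -mulmxA -trmx_mul mulVmx //.
by rewrite trmx1 mulmx1.
Qed.

Lemma Sp1 n : 1%:M \in Sp F n.
Proof. by rewrite inE trmx1 mul1mx mulmx1. Qed.

Lemma Sp_class_refl n (x : 'M[F]_(n + n)) : x \in Sp_class x.
Proof. by apply/imsetP; exists 1%:M; rewrite ?Sp1 // invmx1 mul1mx mulmx1. Qed.

Lemma invmx_mul n (a b : 'M[F]_n) : a \in unitmx -> b \in unitmx ->
  invmx (a *m b) = invmx b *m invmx a.
Proof.
move=> au bu; have abu : a *m b \in unitmx by rewrite unitmx_mul au.
by rewrite -[RHS]mulmx1 -(mulmxV abu) !mulmxA mulmxKV // mulVmx // mul1mx.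
Qed.

Lemma Sp_classP n (x y : 'M[F]_(n + n)) : y \in Sp_class x -> Sp_class y = Sp_class x.
Proof.
case/imsetP => h hS yE; have hu := Sp_unit hS; apply/setP => z.
apply/imsetP/imsetP => [[g gS ->]|[g gS ->]].
  exists (g *m h); first exact: SpM.
  by rewrite yE invmx_mul ?(Sp_unit gS) // !mulmxA.
exists (g *m invmx h); first by rewrite SpM ?SpV.
rewrite yE invmx_mul ?unitmx_inv ?(Sp_unit gS) // invmxK !mulmxA.
by rewrite !(mulmxKV hu).
Qed.

Lemma Sp_class_char_poly n (x y : 'M[F]_(n + n)) :
  y \in Sp_class x -> char_poly y = char_poly x.
Proof.
case/imsetP => h /Sp_unit hu ->.
by apply: char_poly_conj; [apply: mulmxV | apply: mulVmx].
Qed.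

Lemma Sp_class_eq n (x y : 'M[F]_(n.+1 + n.+1)) :
  x \in Sp F n.+1 -> y \in Sp F n.+1 -> semisimple_mx x -> semisimple_mx y ->
  char_poly x = char_poly y -> Sp_class x = Sp_class y.
Proof.
move=> /SpP xS /SpP yS /semisimple_periodicP xN /semisimple_periodicP yN cE.
have [g [h [gh hg gx gJ]]] := congruent_of_char_poly odd_char yS xS yN xN (esym cE).
have [gu _] := mulmx1_unit gh.
apply: Sp_classP; apply/imsetP; exists g; first by rewrite inE gJ.
by rewrite gx mulmxK.
Qed.

Lemma Sp_char_poly n (x : 'M[F]_(n.+1 + n.+1)) : x \in Sp F n.+1 -> semisimple_mx x ->
  [/\ char_poly x \is monic, size (char_poly x) = (n.+1.*2).+1, (char_poly x).[0] = 1
    & poly_bar (char_poly x) = char_poly x].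
Proof.
move=> /SpP xS /semisimple_periodicP xN; split.
- exact: char_poly_monic.
- by rewrite size_char_poly addnn.
- rewrite horner_coef0 char_poly_det (symplectic_det odd_char xS xN) mulr1.
  by rewrite addnn -muln2 mulnC exprM expr2 mulrNN mulr1 expr1n.
- exact: symplectic_bar xS.
Qed.

(** The forms occurring in a direct sum of pieces are all congruent to the
   standard one, as is seen by applying the classification to the identity. *)
Lemma darboux n m (J : 'M[F]_m) : J^T = - J -> J \in unitmx -> m = (n + n)%N ->
  exists (g : 'M[F]_(n + n, m)) (h : 'M[F]_(m, n + n)),
    [/\ g *m h = 1%:M, h *m g = 1%:M & g *m J *m g^T = symplectic_form F n].
Proof.
move=> JT Ju em.
have per k : frobenius_periodic (1%:M : 'M[F]_k).
  by exists 1%N => //; elim: (q ^ 1)%N => [|l IH]; rewrite ?expr0 // exprS IH -mulmxE mulmx1.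
have s1 : symplectic_pair 1%:M J by split; rewrite ?trmx1 ?mulmx1 ?mul1mx.
have /SpP s2 := Sp1 n.
have cE : char_poly (1%:M : 'M[F]_m) = char_poly (1%:M : 'M[F]_(n + n)) by rewrite em.
have [g [h [gh hg _ gJ]]] := congruent_of_char_poly odd_char s1 s2 (per m) (per _) cE.
by exists g, h.
Qed.

Definition irreducible_at0 (p : {poly F}) :=
  [/\ p \is monic, irreducible_poly p & p.[0] != 0].

Lemma realize_pieces (P S : seq {poly F}) :
  (forall p, p \in P -> irreducible_at0 p) ->
  (forall p, p \in S -> [/\ irreducible_at0 p, poly_bar p = p, p.[1] != 0 & p.[-1] != 0]) ->
  exists m (x J : 'M[F]_m), [/\ symplectic_pair x J, frobenius_periodic x &
    char_poly x = \prod_(p <- P) (p * poly_bar p) * \prod_(p <- S) p].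
Proof.
have base : exists m (x J : 'M[F]_m), [/\ symplectic_pair x J, frobenius_periodic x & char_poly x = 1].
  exists 0%N, 1%:M, 0; split; last by rewrite /char_poly det_mx00.
    by split; rewrite ?unitmxE ?det_mx00 ?unitr1 //; apply/matrixP => i; case: i.
  by exists 1%N => //; apply/matrixP => i; case: i.
have add k (X G : 'M[F]_k) f :
    symplectic_pair X G -> frobenius_periodic X ->
    (exists m (x J : 'M[F]_m), [/\ symplectic_pair x J, frobenius_periodic x & char_poly x = f]) ->
    exists m (x J : 'M[F]_m), [/\ symplectic_pair x J, frobenius_periodic x & char_poly x = char_poly X * f].
  move=> XG XN [m [x [J [xJ xN <-]]]]; exists (k + m)%N, (sum_mx X x), (sum_mx G J).
  split; [exact/symplectic_sum | exact/periodic_sum | exact: char_poly_sum].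
elim: P => [_|p P IH HP HS]; last first.
  have [mp ip p0] := HP p (mem_head _ _); have [d [C CE]] := exists_companion mp ip.
  rewrite -CE in ip p0; rewrite big_cons -mulrA -CE -char_poly_hyp //.
  apply: (add _ _ (hyp_form F d)); [exact: hyp_symplectic | exact: hyp_periodic |].
  by apply: IH => // r rP; apply: HP; rewrite inE rP orbT.
elim: S => [_|p S IH HS]; first by rewrite !big_nil mulr1.
have [[mp ip p0] bp p1 pN1] := HS p (mem_head _ _).
have [d [C CE]] := exists_companion mp ip; rewrite -CE in ip p0 bp p1 pN1.
have [T [G [_ _ CG]]] := self_form_exists ip p0 bp p1 pN1.
rewrite big_cons mulrCA -CE; apply: (add _ _ G) => //; first exact: piece_periodic.
by apply: IH => r rS; apply: HS; rewrite inE rS orbT.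
Qed.

Lemma realize_char_poly n (P S : seq {poly F}) :
  (forall p, p \in P -> irreducible_at0 p) ->
  (forall p, p \in S -> [/\ irreducible_at0 p, poly_bar p = p, p.[1] != 0 & p.[-1] != 0]) ->
  size (\prod_(p <- P) (p * poly_bar p) * \prod_(p <- S) p) = (n.+1.*2).+1 ->
  exists x : 'M[F]_(n.+1 + n.+1), [/\ x \in Sp F n.+1, semisimple_mx x &
    char_poly x = \prod_(p <- P) (p * poly_bar p) * \prod_(p <- S) p].
Proof.
move=> HP HS sz; have [m [x [J [xJ xN xE]]]] := realize_pieces HP HS.
have em : m = (n.+1 + n.+1)%N.
  by move: sz; rewrite -xE size_char_poly addnn => -[].
have [JT Ju xJx] := xJ; have [g [h [gh hg gJ]]] := darboux JT Ju em.
have c : congruent x J (g *m x *m h) (symplectic_form F n.+1).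
  by exists g, h; split=> //; rewrite -[RHS]mulmxA hg mulmx1.
exists (g *m x *m h); split.
- exact/SpP/(congruent_symplectic c xJ).
- exact/semisimple_periodicP/(congruent_periodic c xN).
- by rewrite -(congruent_char_poly c).
Qed.
End SemisimpleClasses.

(** * Cycles of signed permutations *)

Section SignedCycles.
Variable n : nat.
Implicit Types (w : {perm (pmset n)}) (x y : pmset n) (i j : 'I_n).

Lemma pmoppK : involutive (@pmopp n).
Proof. by case=> i b; rewrite /pmopp /= negbK. Qed.

Lemma pmopp_neq x : pmopp x != x.
Proof. by case: x => i b; rewrite /pmopp xpair_eqE /= eqxx; case: b. Qed.

Definition flip (e : bool) x : pmset n := (x.1, e (+) x.2).

Lemma flip_true x : flip true x = pmopp x. Proof. by []. Qed.
Lemma flip_false x : flip false x = x. Proof. by case: x. Qed.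
Lemma flipD e e' x : flip e (flip e' x) = flip (e (+) e') x.
Proof. by rewrite /flip /= addbA. Qed.
Lemma flip_inj e : injective (flip e).
Proof. by move=> x y /(congr1 (flip e)); rewrite !flipD addbb !flip_false. Qed.

Lemma weylCP w : reflect (forall x, w (pmopp x) = pmopp (w x)) (w \in weylC n).
Proof. by rewrite inE; apply: (iffP forallP) => H x; apply/eqP/H. Qed.

Lemma weylC_flip w e x : w \in weylC n -> w (flip e x) = flip e (w x).
Proof. by move/weylCP => H; case: e; rewrite ?flip_false // !flip_true H. Qed.

Lemma weylC_expg w k : w \in weylC n -> (w ^+ k)%g \in weylC n.
Proof. exact: groupX. Qed.

Lemma abs_spermE w x : w \in weylC n -> (w x).1 = abs_sperm w x.1.
Proof.
by case: x => i b /(weylC_flip b (i, false)); rewrite /flip /= addbF /abs_sperm => ->.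
Qed.

Lemma abs_sperm_inj w : w \in weylC n -> injective (abs_sperm w).
Proof.
move=> wW i j; rewrite /abs_sperm => e.
have [e2|e2] := eqVneq (w (i, false)).2 (w (j, false)).2.
  have : w (i, false) = w (j, false).
    by move: e e2; case: (w (i, false)) (w (j, false)) => a b [c d] /= -> ->.
  by move/perm_inj => -[].
have : w (i, false) = w (pmopp (j, false)).
  rewrite (weylCP _ wW) /pmopp.
  by move: e e2; case: (w (i, false)) (w (j, false)) => a [] [c []] //= -> _.
by move/perm_inj => -[].
Qed.

Lemma abs_iter w k x : w \in weylC n -> ((w ^+ k)%g x).1 = iter k (abs_sperm w) x.1.
Proof.
move=> wW; elim: k => [|k IH]; first by rewrite expg0 perm1.
by rewrite expgSr permM abs_spermE // IH.
Qed.

Definition negative w x : bool := pmopp x \in porbit w x.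

Lemma porbit_flip w e x : w \in weylC n ->
  porbit w (flip e x) = flip e @: porbit w x.
Proof.
move=> wW; apply/setP => y; apply/porbitP/imsetP => [[k ->]|[_ /porbitP[k ->] ->]].
  by exists ((w ^+ k)%g x); rewrite ?mem_porbit // weylC_flip ?weylC_expg.
by exists k; rewrite weylC_flip ?weylC_expg.
Qed.

Lemma mem_cycle_porbit w x y : w \in weylC n ->
  fconnect (abs_sperm w) x.1 y.1 = (y \in porbit w x) || (pmopp y \in porbit w x).
Proof.
move=> wW; apply/idP/orP => [/iter_findex e|].
  move: e; rewrite -abs_iter //; set z := (w ^+ _)%g x => e.
  have zx : z \in porbit w x by apply: mem_porbit.
  case: y z e zx => a [] [c []] /= ->; rewrite /pmopp /=; by [left|right].
have aux z : z \in porbit w x -> fconnect (abs_sperm w) x.1 z.1.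
  by case/porbitP => k ->; rewrite abs_iter // fconnect_iter.
by case=> [/aux|/aux].
Qed.

Lemma perm_expX w k l x : (w ^+ k)%g ((w ^+ l)%g x) = (w ^+ (l + k))%g x.
Proof. by rewrite expgD permM. Qed.

Lemma expg_fixE w k x : ((w ^+ k)%g x == x) = (#|porbit w x| %| k)%N.
Proof.
set D := #|porbit w x|; have D0 : (0 < D)%N by apply/card_gt0P; exists x; apply: porbit_id.
have wD : (w ^+ D)%g x = x by rewrite permX iter_porbit.
have wm a : (w ^+ (a * D))%g x = x.
  by elim: a => [|a IH]; rewrite ?mul0n ?expg0 ?perm1 // mulSn -perm_expX wD.
apply/eqP/idP => [wk|/dvdnP[a ->]]; last exact: wm.
rewrite /dvdn; apply: contraTT isT => r0.
have wr : (w ^+ (k %% D))%g x = x.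
  by move: wk; rewrite {1}(divn_eq k D) -perm_expX wm.
have /(nth_uniq x (i := k %% D) (j := 0)) := uniq_traject_porbit w x.
rewrite size_traject -/D ltn_mod D0 => /(_ isT isT).
rewrite !nth_traject ?ltn_mod //= -permX wr eqxx => /esym/eqP e.
by rewrite e eqxx in r0.
Qed.

(** If the orbit of [x] contains [-x], negation acts on it as the half turn. So
   the action of [w] and of negation on the orbit is known from its length and
   from whether it is stable under negation. *)
Lemma expg_flipE w k e x : w \in weylC n ->
  ((w ^+ k)%g x == flip e x) =
  if e then [&& negative w x, ~~ (#|porbit w x| %| k)%N & (#|porbit w x| %| k.*2)%N]
  else (#|porbit w x| %| k)%N.
Proof.
move=> wW; case: e; last by rewrite flip_false expg_fixE.
rewrite flip_true; set D := #|porbit w x|.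
have opp2 m : (w ^+ m)%g x = pmopp x -> ~~ (D %| m)%N /\ (D %| m.*2)%N.
  move=> wm; rewrite -!expg_fixE wm pmopp_neq; split=> //.
  rewrite -addnn -perm_expX wm -flip_true weylC_flip ?weylC_expg // wm.
  by rewrite flip_true pmoppK.
apply/eqP/and3P => [wk|[/porbitP[m /esym wm] nk k2]].
  by have [? ?] := opp2 _ wk; split=> //; rewrite /negative -wk mem_porbit.
have [nm m2] := opp2 _ wm.
have D0 : (0 < D)%N by apply/card_gt0P; exists x; apply: porbit_id.
have half l : ~~ (D %| l)%N -> (D %| l.*2)%N -> (l %% D).*2 = D.
  rewrite /dvdn -lt0n => l0 l2; have := ltn_pmod l D0; set r := (l %% D)%N in l0 *.
  have : (D %| r.*2)%N.
    by rewrite -(dvdn_addr _ (dvdn_mull (l %/ D).*2 (dvdnn D))) -doubleMl -doubleD -divn_eq.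
  case/dvdnP => [[|[|a]]] rE rD; rewrite ?mul1n // in rE.
    by rewrite mul0n in rE; lia.
  by move: rE; rewrite !mulSn; lia.
have e : k = m %[mod D].
  by apply: double_inj; rewrite !half.
rewrite -wm (divn_eq k D) (divn_eq m D) e -!perm_expX.
by congr ((w ^+ _)%g _); transitivity x; [|apply/esym]; apply/eqP; rewrite expg_fixE dvdn_mull.
Qed.
End SignedCycles.

Section CycleTypes.
Variable n : nat.
Implicit Types (w : {perm (pmset n)}) (x y : pmset n) (i j : 'I_n).

Definition sperm_cycle w i : {set 'I_n} := [set j | fconnect (abs_sperm w) i j]%SET.

(** One turn around the cycle multiplies the sign of an index by the product of
   the signs along the cycle. *)
Lemma cycle_signE w i : w \in weylC n ->
  cycle_sign w (sperm_cycle w i) = (-1) ^+ negative w (i, false).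
Proof.
move=> wW; have inj := abs_sperm_inj wW; set l := fingraph.order (abs_sperm w) i.
pose s k : int := \prod_(j < k) pmsgn (w (iter j (abs_sperm w) i, false)).
have sE k : pmsgn ((w ^+ k)%g (i, false)) = s k.
  elim: k => [|k IH]; first by rewrite expg0 perm1 /s big_ord0.
  rewrite expgSr permM /s big_ord_recr /= -/(s k) -IH.
  have -> : iter k (abs_sperm w) i = ((w ^+ k)%g (i, false)).1 by rewrite abs_iter.
  case: ((w ^+ k)%g (i, false)) => a b /=.
  have -> : (a, b) = flip b (a, false) by rewrite /flip /= addbF.
  by rewrite weylC_flip // /pmsgn /= addbF signr_addb.
have csE : cycle_sign w (sperm_cycle w i) = s l.
  rewrite /cycle_sign (eq_bigl (fun j => j \in fingraph.orbit (abs_sperm w) i)); last first.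
    by move=> j; rewrite inE fconnect_orbit.
  rewrite -big_uniq ?orbit_uniq //= /fingraph.orbit.
  by rewrite (big_nth i) size_traject big_mkord; apply: eq_bigr => k _; rewrite nth_traject.
rewrite csE -sE /pmsgn.
have l1 : ((w ^+ l)%g (i, false)).1 = i by rewrite abs_iter // iter_order.
have lE : (w ^+ l)%g (i, false) = (i, ((w ^+ l)%g (i, false)).2).
  by rewrite -{2}l1; case: (_ (i, false)).
case: (boolP (negative w (i, false))) => ng; move: lE; set b := (_ (i, false)).2.
  case: b => // lE; exfalso.
  case/porbitP: ng => k ek.
  have : iter k (abs_sperm w) i = i by rewrite -[i in LHS]/((i, false).1) -abs_iter // -ek.
  move=> ki; have lk : (l %| k)%N.
    have il a : iter (a * l) (abs_sperm w) i = i.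
      by elim: a => // a IH; rewrite mulSn iterD IH iter_order.
    have := ltn_pmod k (fingraph.order_gt0 (abs_sperm w) i); rewrite -/l => rl.
    have := findex_iter rl; rewrite /dvdn; move: ki.
    by rewrite {1}(divn_eq k l) addnC iterD il => ->; rewrite findex0 => <-.
  move: ek; case/dvdnP: lk => a ->.
  have -> : (w ^+ (a * l))%g (i, false) = (i, false).
    by elim: a => [|a IH]; rewrite ?mul0n ?expg0 ?perm1 // mulSn -perm_expX lE.
  by move/eqP; rewrite (negPf (pmopp_neq _)).
case: b => // lE; case/negP: ng.
by rewrite /negative -[pmopp _]/(i, true) -lE mem_porbit.
Qed.

Lemma mem_flip_imset e (A : {set pmset n}) y : (y \in flip e @: A) = (flip e y \in A).
Proof.
by rewrite -{1}[y](flip_false) -(addbb e) -flipD mem_imset //; apply: flip_inj.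
Qed.

(** The signed indices above a cycle form the orbit of [x] and that of [-x],
   which are equal or disjoint. *)
Lemma card_sperm_cycle w i : w \in weylC n ->
  #|porbit w (i, false)| =
  if negative w (i, false) then #|sperm_cycle w i|.*2 else #|sperm_cycle w i|.
Proof.
move=> wW; set x : pmset n := (i, false).
have e : setX (sperm_cycle w i) [set: bool] = porbit w x :|: flip true @: porbit w x.
  apply/setP => y; rewrite !inE andbT (@mem_cycle_porbit _ w x y) //.
  by rewrite mem_flip_imset.
have ce : #|setX (sperm_cycle w i) [set: bool]| = (#|sperm_cycle w i|).*2.
  by rewrite cardsX cardsT card_bool muln2.
case: ifP => ng; first rewrite -ce e.
  suff -> : flip true @: porbit w x = porbit w x by rewrite setUid.
  by rewrite -porbit_flip //; apply/eqP; rewrite eq_porbit_mem flip_true.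
have := cardsUI (porbit w x) (flip true @: porbit w x).
rewrite card_imset; last exact: flip_inj.
have -> : porbit w x :&: flip true @: porbit w x = set0.
  apply/setP => y; rewrite inE mem_flip_imset in_set0; apply/negP => /andP[yx yx'].
  rewrite /negative in ng; case/porbitP: yx => k yE; move: yx'.
  rewrite yE -weylC_flip ?weylC_expg // flip_true porbit_sym.
  have -> : porbit w ((w ^+ k)%g (pmopp x)) = porbit w (pmopp x) by rewrite porbit_perm.
  by rewrite porbit_sym ng.
by rewrite cards0 addn0 -e ce addnn => /double_inj ->.
Qed.
End CycleTypes.

(** The objects of each type are matched in the order of their enumerations. *)
Lemma type_matching (T : finType) (K : eqType) (A B : {set T}) (f g : T -> K) :
  (forall k, #|[set x in A | f x == k]%SET| = #|[set x in B | g x == k]%SET|) ->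
  exists h : T -> T, {in A, forall x, h x \in B /\ g (h x) = f x} /\
    {in A &, injective h}.
Proof.
move=> card; pose a k := enum [set x in A | f x == k]%SET.
pose b k := enum [set x in B | g x == k]%SET.
have sz k : size (a k) = size (b k) by rewrite -!cardE card.
have inA x : x \in A -> x \in a (f x) by move=> xA; rewrite mem_enum inE xA eqxx.
pose h x := nth x (b (f x)) (index x (a (f x))).
have hb x : x \in A -> h x \in b (f x).
  by move=> xA; rewrite mem_nth // -sz index_mem inA.
have hP x : x \in A -> h x \in B /\ g (h x) = f x.
  by move/hb; rewrite mem_enum inE => /andP[? /eqP].
exists h; split=> // x y xA yA e.
have fe : f x = f y by rewrite -(proj2 (hP x xA)) e (proj2 (hP y yA)).
have ix : (index x (a (f x)) < size (b (f x)))%N by rewrite -sz index_mem inA.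
have iy : (index y (a (f x)) < size (b (f x)))%N by rewrite -sz index_mem fe inA.
move: e; rewrite /h -fe (set_nth_default y x ix) => /eqP.
rewrite nth_uniq ?enum_uniq // => /eqP ie.
by rewrite -(nth_index x (inA x xA)) ie nth_index // fe inA.
Qed.

Section CycleBases.
Variable n : nat.
Implicit Types (w : {perm (pmset n)}) (x y : pmset n) (i j : 'I_n).

Definition cycle_bases w : {set 'I_n} := [set j | froots (abs_sperm w) j]%SET.
Definition cycle_base w i : 'I_n := froot (abs_sperm w) i.

Lemma cycle_base_in w i : w \in weylC n -> cycle_base w i \in cycle_bases w.
Proof. by move=> wW; rewrite inE roots_root //; apply/fconnect_sym/abs_sperm_inj. Qed.

Lemma cycle_base_eq w i j : w \in weylC n ->
  (cycle_base w i == cycle_base w j) = fconnect (abs_sperm w) i j.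
Proof. by move=> wW; rewrite root_connect //; apply/fconnect_sym/abs_sperm_inj. Qed.

Lemma cycle_base_id w j : j \in cycle_bases w -> cycle_base w j = j.
Proof. by rewrite inE => /eqP. Qed.

Definition bases_of_type w (t : bool * nat) : {set 'I_n} :=
  [set j in cycle_bases w |
     (negative w (j, false), #|porbit w (j, false)|) == t]%SET.

Lemma card_cycles_of_type w (e : bool) (l : nat) : w \in weylC n ->
  #|[set c in sperm_cycles w | (#|c| == l) && (cycle_sign w c == (-1) ^+ e)]%SET| =
  #|bases_of_type w (e, if e then l.*2 else l)|.
Proof.
move=> wW; have sym := fconnect_sym (abs_sperm_inj wW).
rewrite -(card_in_imset (f := sperm_cycle w)); last first.
  move=> j k; rewrite !inE => /andP[/eqP rj _] /andP[/eqP rk _] /setP/(_ k).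
  rewrite !inE connect0 => jk; rewrite -rj -rk; apply/eqP; rewrite root_connect //.
have sgE (a b : bool) : ((-1) ^+ a == (-1) ^+ b :> int) = (a == b) by case: a b => [] [].
have typeE j : (#|sperm_cycle w j| == l) && (cycle_sign w (sperm_cycle w j) == (-1) ^+ e)
    = ((negative w (j, false), #|porbit w (j, false)|) == (e, if e then l.*2 else l)).
  rewrite cycle_signE // card_sperm_cycle // sgE xpair_eqE andbC.
  case: eqP => //= ->; case: e {sgE} => //.
  by rewrite -!muln2 eqn_pmul2r.
congr #|pred_of_set _|; apply/setP => c; rewrite inE; apply/andP/imsetP.
  case=> /imsetP[j _ ->] cj; exists (cycle_base w j).
    rewrite inE cycle_base_in //= -typeE.
    suff <- : sperm_cycle w j = sperm_cycle w (cycle_base w j) by [].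
    by apply/setP => k; rewrite !inE; apply: (same_connect sym (connect_root _ _)).
  by apply/setP => k; rewrite !inE; apply: (same_connect sym (connect_root _ _)).
case=> j; rewrite inE -typeE => /andP[_ cj] ->; split=> //.
by apply/imsetP; exists j.
Qed.

Lemma npos_cyclesE w (i : nat) : w \in weylC n -> npos_cycles w i = #|bases_of_type w (false, i)|.
Proof. by move=> wW; rewrite -(card_cycles_of_type false). Qed.

Lemma nneg_cyclesE w (i : nat) : w \in weylC n -> nneg_cycles w i = #|bases_of_type w (true, i.*2)|.
Proof. by move=> wW; rewrite -(card_cycles_of_type true). Qed.

Lemma porbit_neg_even w x : w \in weylC n -> negative w x -> ~~ odd #|porbit w x|.
Proof.
move=> wW ng; have : flip true x \in porbit w x by [].
case/porbitP => k /esym/eqP; rewrite expg_flipE // => /and3P[_ nk k2].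
apply: contra nk => od; move: k2; rewrite -muln2 Gauss_dvdl //.
by rewrite coprimen2.
Qed.

Lemma porbit_gt0 w x : (0 < #|porbit w x|)%N.
Proof. by apply/card_gt0P; exists x; apply: porbit_id. Qed.

Lemma bases_of_type_eq w w' : w \in weylC n -> w' \in weylC n ->
  (forall i : nat, (0 < i)%N -> npos_cycles w i = npos_cycles w' i /\
     nneg_cycles w i = nneg_cycles w' i) ->
  forall t, #|bases_of_type w t| = #|bases_of_type w' t|.
Proof.
move=> wW wW' same [e i].
have empty (v : {perm (pmset n)}) : v \in weylC n -> (i == 0%N) || (e && odd i) ->
    #|bases_of_type v (e, i)| = 0%N.
  move=> vW ei; apply: eq_card0 => j; rewrite inE xpair_eqE; apply/negP => /and3P[_ /eqP ng /eqP io].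
  case/orP: ei => [/eqP i0|/andP[e1 oi]].
    by have := porbit_gt0 v (j, false); rewrite io i0.
  by have := porbit_neg_even vW (x := (j, false)); rewrite ng io oi => /(_ e1).
case: (boolP ((i == 0%N) || (e && odd i))) => [ei|]; first by rewrite !empty.
rewrite negb_or negb_and => /andP[i0]; case: e {empty} => /= oi; last first.
  by rewrite -!npos_cyclesE //; case: (same i); rewrite ?lt0n.
have iE : i = (i./2).*2 by rewrite -{1}(odd_double_half i) (negPf oi).
rewrite iE -!nneg_cyclesE //; case: (same i./2) => //.
by rewrite -double_gt0 -iE lt0n.
Qed.
End CycleBases.

(** * Conjugacy of signed permutations *)

Section SignedConjugacy.
Variable n : nat.
Implicit Types (w : {perm (pmset n)}) (x y : pmset n) (i j : 'I_n).

Definition cycle_type w x := (negative w x, #|porbit w x|).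

Lemma flip_expg_eq w w' b b' k e k' e' : w \in weylC n -> w' \in weylC n ->
  cycle_type w b = cycle_type w' b' ->
  (flip e ((w ^+ k)%g b) == flip e' ((w ^+ k')%g b)) =
  (flip e ((w' ^+ k)%g b') == flip e' ((w' ^+ k')%g b')).
Proof.
move=> wW wW' [ng cd].
wlog le : k k' e e' / (k' <= k)%N.
  move=> IH; case: (leqP k' k) => [|/ltnW] le; first exact: IH.
  by rewrite eq_sym [RHS]eq_sym IH.
have step v c : v \in weylC n ->
    (flip e ((v ^+ k)%g c) == flip e' ((v ^+ k')%g c)) =
    ((v ^+ (k - k'))%g c == flip (e (+) e') c).
  move=> vW; rewrite -[in LHS](subnK le) -perm_expX.
  have vkW := weylC_expg k' vW.
  rewrite -(weylC_flip e _ vkW) -(weylC_flip e' _ vkW) (inj_eq perm_inj).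
  by rewrite -[RHS](inj_eq (@flip_inj n e)) flipD addKb.
by rewrite !step // !expg_flipE // ng cd.
Qed.

Lemma cycle_base_exp w x : w \in weylC n ->
  exists p : nat * bool, x = flip p.2 ((w ^+ p.1)%g (cycle_base w x.1, false)).
Proof.
move=> wW; have sym := fconnect_sym (abs_sperm_inj wW).
have : fconnect (abs_sperm w) (cycle_base w x.1, false).1 x.1.
  by rewrite /= sym connect_root.
rewrite mem_cycle_porbit // => /orP[/porbitP[k e]|/porbitP[k e]].
  by exists (k, false); rewrite flip_false.
by exists (k, true); rewrite -e flip_true pmoppK.
Qed.

Lemma cycle_base_flip w e k j : w \in weylC n -> j \in cycle_bases w ->
  cycle_base w (flip e ((w ^+ k)%g (j, false))).1 = j.
Proof.
move=> wW jb; rewrite -[RHS](cycle_base_id jb) /= abs_iter //=.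
by apply/eqP; rewrite cycle_base_eq // (fconnect_sym (abs_sperm_inj wW)) fconnect_iter.
Qed.

(** Match the cycles by length and sign, and carry a base point of each cycle
   along it. *)
Lemma weylC_conjugate w w' : w \in weylC n -> w' \in weylC n ->
  (forall i : nat, (0 < i)%N -> npos_cycles w i = npos_cycles w' i /\
     nneg_cycles w i = nneg_cycles w' i) ->
  w' \in (w ^: weylC n)%g.
Proof.
move=> wW wW' same; have := bases_of_type_eq wW wW' same.
case/type_matching => beta [bP binj].
have bT j : j \in cycle_bases w -> cycle_type w (j, false) = cycle_type w' (beta j, false).
  by case/bP => _ /esym.
have [kk kkP] := choice (fun x => cycle_base_exp x wW).
pose h x := flip (kk x).2 ((w' ^+ (kk x).1)%g (beta (cycle_base w x.1), false)).
have hE j k e : j \in cycle_bases w ->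
    h (flip e ((w ^+ k)%g (j, false))) = flip e ((w' ^+ k)%g (beta j, false)).
  move=> jb; rewrite /h; set x := flip e _.
  have := kkP x; rewrite cycle_base_flip // => xE; apply/eqP.
  by rewrite -(flip_expg_eq _ _ _ _ wW wW' (bT j jb)) -xE.
have xE x : x = flip (kk x).2 ((w ^+ (kk x).1)%g (cycle_base w x.1, false)) := kkP x.
have bin x : cycle_base w x.1 \in cycle_bases w by apply: cycle_base_in.
have hinj : injective h.
  move=> x y e; have eb : cycle_base w x.1 = cycle_base w y.1.
    apply: binj => //; have := congr1 (fun z : pmset n => cycle_base w' z.1) e.
    by rewrite !cycle_base_flip //; apply: (proj1 (bP _ _)).
  move/eqP: e; rewrite /h eb -(flip_expg_eq _ _ _ _ wW wW' (bT _ (bin y))) -xE -eb -xE.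
  by move/eqP.
have hop x : h (pmopp x) = pmopp (h x).
  by rewrite [in LHS](xE x) -flip_true flipD hE // [in RHS](xE x) hE // -flip_true flipD.
have hw x : h (w x) = w' (h x).
  rewrite [in LHS](xE x) weylC_flip // -permM -expgSr hE // [in RHS](xE x) hE //.
  by rewrite weylC_flip // -permM -expgSr.
apply/imsetP; exists (perm hinj).
  by apply/weylCP => x; rewrite !permE hop.
apply/permP => z; have [x ->] : exists x, z = perm hinj x.
  by exists ((perm hinj)^-1%g z); rewrite permKV.
by rewrite conjgE !permM permK !permE hw.
Qed.

Lemma cycle_typeJ w g x : w \in weylC n -> g \in weylC n ->
  cycle_type (w ^ g)%g (g x) = cycle_type w x.
Proof.
move=> wW gW; have eJ k z : ((w ^ g) ^+ k)%g (g z) = g ((w ^+ k)%g z).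
  by rewrite -conjXg conjgE !permM permK.
have pJ : porbit (w ^ g)%g (g x) = g @: porbit w x.
  apply/setP => y; apply/porbitP/imsetP => [[k ->]|[_ /porbitP[k ->] ->]].
    by exists ((w ^+ k)%g x); rewrite ?mem_porbit // eJ.
  by exists k; rewrite eJ.
rewrite /cycle_type /negative pJ card_imset; last exact: perm_inj.
by rewrite -(weylCP _ gW) mem_imset //; apply: perm_inj.
Qed.

Lemma cycle_type_connect w x y : w \in weylC n ->
  fconnect (abs_sperm w) x.1 y.1 -> cycle_type w x = cycle_type w y.
Proof.
move=> wW; rewrite mem_cycle_porbit // => xy.
have tf e z : cycle_type w (flip e z) = cycle_type w z.
  rewrite /cycle_type /negative porbit_flip // card_imset; last exact: flip_inj.
  by rewrite -flip_true flipD addbC -flipD mem_imset //; apply: flip_inj.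
have tp z z' : z' \in porbit w z -> cycle_type w z = cycle_type w z'.
  case/porbitP => k ->; rewrite -[in LHS](cycle_typeJ (g := (w ^+ k)%g)) ?weylC_expg //.
  by rewrite conjgE -expgS expgSr mulKg.
by case/orP: xy => /tp ->; rewrite // -flip_true tf.
Qed.

Lemma card_bases_of_typeJ w g t : w \in weylC n -> g \in weylC n ->
  #|bases_of_type (w ^ g)%g t| = #|bases_of_type w t|.
Proof.
have le v u s : v \in weylC n -> u \in weylC n ->
    (#|bases_of_type v s| <= #|bases_of_type (v ^ u)%g s|)%N.
  move=> vW uW; have vuW : (v ^ u)%g \in weylC n by rewrite groupJ.
  pose f j := cycle_base (v ^ u)%g (abs_sperm u j).
  have conn x y : fconnect (abs_sperm (v ^ u)%g) (u x).1 (u y).1 ->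
      fconnect (abs_sperm v) x.1 y.1.
    rewrite !mem_cycle_porbit // -(weylCP _ uW) => /orP[] /porbitP[k].
      by rewrite -conjXg conjgE !permM permK => /perm_inj ->; rewrite mem_porbit.
    by rewrite -conjXg conjgE !permM permK => /perm_inj ->; rewrite mem_porbit orbT.
  rewrite -(card_in_imset (f := f)); last first.
    move=> j k; rewrite !inE => /andP[jb _] /andP[kb _] /eqP.
    rewrite /f cycle_base_eq // => c.
    have /= := @conn (j, false) (k, false) c.
    by rewrite -cycle_base_eq // !cycle_base_id ?inE // => /eqP.
  apply/subset_leq_card/subsetP => _ /imsetP[j jt ->].
  rewrite inE cycle_base_in //=; move: jt; rewrite inE => /andP[_ /eqP <-].
  apply/eqP; rewrite -/(cycle_type _ _) -/(cycle_type v _) -(cycle_typeJ _ vW uW).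
  apply/esym/cycle_type_connect => //=.
  by rewrite abs_spermE //= connect_root.
move=> wW gW; apply/eqP; rewrite eqn_leq le // andbT.
by have := le (w ^ g)%g (g^-1)%g t; rewrite conjgK groupJ ?groupV // => /(_ isT gW).
Qed.

Lemma cycle_numbers_class w w' (i : nat) : w \in weylC n -> w' \in (w ^: weylC n)%g ->
  npos_cycles w' i = npos_cycles w i /\ nneg_cycles w' i = nneg_cycles w i.
Proof.
move=> wW /imsetP[g gW ->]; have wgW : (w ^ g)%g \in weylC n by rewrite groupJ.
rewrite (npos_cyclesE _ wW) (npos_cyclesE _ wgW) (nneg_cyclesE _ wW) (nneg_cyclesE _ wgW).
by split; apply: card_bases_of_typeJ.
Qed.
End SignedConjugacy.

(** * Positive roots *)

Section Roots.
Variable n : nat.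
Implicit Types (w : {perm (pmset n)}) (x y : pmset n) (i j : 'I_n) (v u : 'rV[int]_n).

(** The position of a signed index in the decreasing order
   [1, ..., n, -n, ..., -1]. *)
Definition rk x : nat := if x.2 then (n.*2.-1 - x.1)%N else x.1.

Lemma rk_lt x : (rk x < n.*2)%N.
Proof. by case: x => i b; rewrite /rk /=; have := ltn_ord i; case: b; lia. Qed.

Lemma rk_opp x : rk (pmopp x) = (n.*2.-1 - rk x)%N.
Proof. by case: x => i b; rewrite /rk /=; have := ltn_ord i; case: b => /=; lia. Qed.

Lemma rk_inj : injective rk.
Proof.
move=> [i b] [j c]; rewrite /rk /= => e.
have li := ltn_ord i; have lj := ltn_ord j.
have ij : i = j :> nat by move: e; case: b; case: c; lia.
have bc : b = c by move: e; rewrite ij; case: b; case: c; lia.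
by rewrite bc (val_inj ij).
Qed.

Definition signed_vec x : 'rV[int]_n := pmsgn x *: evec n x.1.+1.

Lemma signed_vec_false i : signed_vec (i, false) = evec n i.+1.
Proof. by rewrite /signed_vec /pmsgn expr0 scale1r. Qed.

Lemma signed_vec_true i : signed_vec (i, true) = - evec n i.+1.
Proof. by rewrite /signed_vec /pmsgn expr1 scaleN1r. Qed.

Lemma evecE i j : evec n i.+1 0 j = (j == i)%:R.
Proof. by rewrite mxE eqSS. Qed.

Lemma pairing_evec i v : pairing (evec n i.+1) v = v 0 i.
Proof.
rewrite /pairing (bigD1 i) //= evecE eqxx mul1r big1 ?addr0 // => j ji.
by rewrite evecE (negPf ji) mul0r.
Qed.

Lemma pairingD v u t : pairing (v + u) t = pairing v t + pairing u t.
Proof. by rewrite /pairing -big_split /=; apply: eq_bigr => j _; rewrite mxE mulrDl. Qed.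

Lemma pairingZ a v t : pairing (a *: v) t = a * pairing v t.
Proof. by rewrite /pairing big_distrr /=; apply: eq_bigr => j _; rewrite mxE mulrA. Qed.

Lemma pairingN v t : pairing (- v) t = - pairing v t.
Proof. by rewrite -scaleN1r pairingZ mulN1r. Qed.

Lemma sperm_actD w v u : sperm_act w (v + u) = sperm_act w v + sperm_act w u.
Proof. by rewrite /sperm_act -big_split /=; apply: eq_bigr => j _; rewrite mxE scalerDl. Qed.

Lemma sperm_actZ w a v : sperm_act w (a *: v) = a *: sperm_act w v.
Proof. by rewrite /sperm_act scaler_sumr; apply: eq_bigr => j _; rewrite mxE [RHS]scalerA. Qed.

Lemma sperm_act_evec w i : sperm_act w (evec n i.+1) = signed_vec (w (i, false)).
Proof.
rewrite /sperm_act (bigD1 i) //= evecE eqxx scale1r big1 ?addr0 // => j ji.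
by rewrite evecE (negPf ji) scale0r.
Qed.

(** A positive functional on the positive roots separates them from the negative
   ones. *)
Definition height v : int := \sum_(j < n) (n - j)%:R * v 0 j.

Lemma heightD v u : height (v + u) = height v + height u.
Proof. by rewrite /height -big_split /=; apply: eq_bigr => j _; rewrite mxE mulrDr. Qed.

Lemma heightZ a v : height (a *: v) = a * height v.
Proof. by rewrite /height big_distrr /=; apply: eq_bigr => j _; rewrite mxE mulrCA. Qed.

Lemma heightN v : height (- v) = - height v.
Proof. by rewrite -scaleN1r heightZ mulN1r. Qed.

Lemma height_evec i : height (evec n i.+1) = (n - i)%:R.
Proof.
rewrite /height (bigD1 i) //= evecE eqxx mulr1 big1 ?addr0 // => j ji.
by rewrite evecE (negPf ji) mulr0.
Qed.

Lemma positive_root_height v : positive_root v -> 0 < height v.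
Proof.
case/orP => [/existsP[i /existsP[j /andP[ij /orP[] /eqP ->]]]|/existsP[i /eqP ->]];
  rewrite ?heightD ?heightN ?heightZ !height_evec !natz;
  have := ltn_ord i; try have := ltn_ord j; try lia.
Qed.

Lemma positive_root_sub x y : x.1 != y.1 -> (rk x < rk y)%N ->
  positive_root (signed_vec x - signed_vec y).
Proof.
case: x y => i b [j c] /= ij; rewrite /rk /=.
have li := ltn_ord i; have lj := ltn_ord j; move: ij; rewrite -val_eqE /= => ij.
case: b; case: c; rewrite ?signed_vec_true ?signed_vec_false ?opprK => lt; apply/orP; left.
- apply/existsP; exists j; apply/existsP; exists i.
  by rewrite addrC eqxx orbT andbT; lia.
- by exfalso; lia.
- have [lij|lij|e] := ltngtP i j; last by rewrite e eqxx in ij.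
    by apply/existsP; exists i; apply/existsP; exists j; rewrite lij eqxx.
  by apply/existsP; exists j; apply/existsP; exists i; rewrite lij addrC eqxx.
- by apply/existsP; exists i; apply/existsP; exists j; rewrite lt eqxx orbT.
Qed.

Lemma negative_root_sub x y : x.1 != y.1 ->
  negative_root (signed_vec x - signed_vec y) = (rk y < rk x)%N.
Proof.
move=> xy; rewrite /negative_root opprB; apply/idP/idP => [neg|]; last first.
  by apply: positive_root_sub; rewrite eq_sym.
rewrite ltnNge leq_eqVlt negb_or; apply/andP; split.
  by apply: contra xy => /eqP/rk_inj ->.
apply/negP => /(positive_root_sub xy)/positive_root_height.
move: (positive_root_height neg); rewrite -[signed_vec y - _]opprB heightN oppr_gt0.
by move=> l1 l2; have := lt_trans l1 l2; rewrite ltxx.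
Qed.

Lemma negative_root_double x : negative_root (2 *: signed_vec x) = x.2.
Proof.
case: x => i b; rewrite /negative_root; case: b; rewrite ?signed_vec_true ?signed_vec_false.
  by rewrite scalerN opprK; apply/orP; right; apply/existsP; exists i.
apply/negP => /positive_root_height; rewrite heightN heightZ height_evec.
by have := ltn_ord i; lia.
Qed.

Lemma alpha_mid (k : nat) (k1 : (k.+1 < n)%N) (i : 'I_n.+1) : i = k.+1 :> nat ->
  alpha i = evec n k.+1 - evec n k.+2.
Proof. by move=> e; rewrite /alpha e /= ltn_eqF. Qed.

Lemma alpha_last (i : 'I_n.+1) : (0 < n)%N -> i = n :> nat -> alpha i = 2 *: evec n n.
Proof. by move=> n0 e; rewrite /alpha e eqxx gtn_eqF. Qed.
End Roots.

(** * Cellini coefficients as numbers of shuffles *)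

Section ShufflePairs.
Variables (n m : nat).
Local Notation point := {ffun 'I_n -> 'I_m.+1}.
Implicit Types (w : {perm (pmset n)}) (x y : pmset n) (t : point).

(** The odd extension of [t] to signed indices. *)
Definition digit t x : int := pmsgn x * (t x.1)%:Z.

Lemma digit_false t i : digit t (i, false) = t i.
Proof. by rewrite /digit /pmsgn expr0 mul1r. Qed.

Lemma digit_true t i : digit t (i, true) = - (t i)%:Z.
Proof. by rewrite /digit /pmsgn expr1 mulN1r. Qed.

Lemma digit_opp t x : digit t (pmopp x) = - digit t x.
Proof. by case: x => i []; rewrite /pmopp /= ?digit_true ?digit_false ?opprK. Qed.

Lemma digit_bound t x : - m%:Z <= digit t x <= m%:Z.
Proof. by case: x => i []; rewrite ?digit_true ?digit_false; have := ltn_ord (t i); lia. Qed.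

Definition lex_before w t x y : bool :=
  (digit t y < digit t x) || ((digit t x == digit t y) && (rk (w x) < rk (w y))%N).

Lemma lex_before_trans w t : transitive (lex_before w t).
Proof. by move=> y x z; rewrite /lex_before; lia. Qed.

Lemma lex_before_opp w t x y : w \in weylC n ->
  lex_before w t (pmopp y) (pmopp x) = lex_before w t x y.
Proof.
move=> /weylCP wW; rewrite /lex_before !digit_opp !wW !rk_opp.
by have := rk_lt (w x); have := rk_lt (w y); lia.
Qed.

(** [w] is the permutation sorting the word [digit t \o w^-1], equal letters being
   kept in order; the pairs [(w, t)] are the outcomes of the shuffle. *)
Definition shuffle_pair w t : bool :=
  [forall x, forall y, (rk x < rk y)%N ==> lex_before w t x y].

Lemma shuffle_pairP w t :
  reflect (forall x y, (rk x < rk y)%N -> lex_before w t x y) (shuffle_pair w t).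
Proof.
apply: (iffP forallP) => [H x y|H x]; last by apply/forallP => y; apply/implyP/H.
by have /forallP/(_ y)/implyP := H x.
Qed.

Definition point_vec t : 'rV[int]_n := \row_j (t j)%:Z.

Definition descents_strict w t : bool :=
  [forall i : 'I_n.+1, (i != ord0) ==>
     (0 <= pairing (alpha i) (point_vec t)) &&
     ((i \in Cdes w) ==> (pairing (alpha i) (point_vec t) != 0))].
End ShufflePairs.

Section CelliniCount.
Variables (n' m : nat).
Local Notation n := n'.+1.
Local Notation point := {ffun 'I_n -> 'I_m.+1}.
Local Notation q := (m.*2.+1).
Implicit Types (w : {perm (pmset n)}) (x y : pmset n) (t : point) (v : 'rV[int]_n).

Lemma pairing_mid v k (i : 'I_n.+1) : (k.+1 < n)%N -> i = k.+1 :> nat ->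
  pairing (alpha i) v = v 0 (inord k) - v 0 (inord k.+1).
Proof.
move=> kn e; rewrite (alpha_mid kn e) pairingD pairingN.
by rewrite -!pairing_evec !inordK // ltnW.
Qed.

Lemma pairing_last v (i : 'I_n.+1) : i = n :> nat ->
  pairing (alpha i) v = 2 * v 0 ord_max.
Proof. by move=> e; rewrite (alpha_last _ e) // pairingZ -[n in evec n n]/(ord_max : 'I_n).+1 pairing_evec. Qed.

Lemma pairing_highest v : pairing (highest_root n) v = 2 * v 0 ord0.
Proof. by rewrite /highest_root pairingZ -[1%N]/(ord0 : 'I_n).+1 pairing_evec. Qed.

Lemma Cdes_mid w k (i : 'I_n.+1) : w \in weylC n -> (k.+1 < n)%N -> i = k.+1 :> nat ->
  (i \in Cdes w) = (rk (w (inord k.+1, false)) < rk (w (inord k, false)))%N.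
Proof.
move=> wW kn e; rewrite inE (alpha_mid kn e) -scaleN1r sperm_actD sperm_actZ scaleN1r.
have -> : evec n k.+1 = evec n (inord k : 'I_n).+1 by rewrite inordK // ltnW.
have -> : evec n k.+2 = evec n (inord k.+1 : 'I_n).+1 by rewrite inordK.
rewrite !sperm_act_evec negative_root_sub // !abs_spermE //= (inj_eq (abs_sperm_inj wW)).
by rewrite -val_eqE /= !inordK //; lia.
Qed.

Lemma Cdes_last w (i : 'I_n.+1) : i = n :> nat ->
  (i \in Cdes w) = (w (ord_max, false)).2.
Proof.
move=> e; rewrite inE (alpha_last _ e) // sperm_actZ -[n in evec n n]/(ord_max : 'I_n).+1.
by rewrite sperm_act_evec negative_root_double.
Qed.

Definition unrk k : pmset n :=
  if (k < n)%N then (inord k, false) else (inord (n.*2.-1 - k)%N, true).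

Lemma unrkK k : (k < n.*2)%N -> rk (unrk k) = k.
Proof. by move=> kn; rewrite /unrk /rk; case: ltnP => kn' /=; rewrite inordK; lia. Qed.

Lemma rkK x : unrk (rk x) = x.
Proof. by apply: rk_inj; rewrite unrkK // rk_lt. Qed.

(** By transitivity only neighbours in the order given by [rk] matter. The pairs
   [k, k+1] correspond to the roots [e_k - e_(k+1)], the middle pair [n, -n] to
   [2 e_n], and the remaining ones are mirror images of the first. *)
Lemma descents_strictP w t : w \in weylC n ->
  descents_strict w t = shuffle_pair w t.
Proof.
move=> wW; pose xs k : pmset n := (inord k, false).
have mid k (i : 'I_n.+1) : (k.+1 < n)%N -> i = k.+1 :> nat ->
    (0 <= pairing (alpha i) (point_vec t)) &&
    ((i \in Cdes w) ==> (pairing (alpha i) (point_vec t) != 0)) =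
    lex_before w t (xs k) (xs k.+1).
  move=> kn e; rewrite (pairing_mid _ kn e) (Cdes_mid wW kn e) !mxE /lex_before !digit_false.
  have : rk (w (xs k)) != rk (w (xs k.+1)).
    rewrite (inj_eq (@rk_inj _)) (inj_eq perm_inj) xpair_eqE andbT -val_eqE /=.
    by rewrite !inordK //; lia.
  by rewrite /xs; lia.
have lst (i : 'I_n.+1) : i = n :> nat ->
    (0 <= pairing (alpha i) (point_vec t)) &&
    ((i \in Cdes w) ==> (pairing (alpha i) (point_vec t) != 0)) =
    lex_before w t (ord_max, false) (ord_max, true).
  move=> e; rewrite (pairing_last _ e) (Cdes_last _ e) !mxE /lex_before digit_false digit_true.
  have -> : w (ord_max, true) = pmopp (w (ord_max, false)) by rewrite -(weylCP _ wW).
  rewrite rk_opp /rk; case: (w _) => a b /=; have := ltn_ord a; case: b => /=; lia.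
apply/forallP/shuffle_pairP => [H|H i]; last first.
  apply/implyP => i0; have [e|ne] := eqVneq (i : nat) n.
    by rewrite lst //; apply: H; rewrite /rk /=; lia.
  case: i i0 ne => -[|k] ki //= _ ne; rewrite (mid k) //; last by lia.
  by apply: H; rewrite /rk /= !inordK //; lia.
have step k : (k.+1 < n.*2)%N -> lex_before w t (unrk k) (unrk k.+1).
  move=> kn; have [k1|k1|k1] := ltngtP k.+1 n.
  - have := H (inord k.+1); rewrite (mid k) ?inordK //; last by lia.
    have -> : inord k.+1 != ord0 :> 'I_n.+1 by rewrite -val_eqE /= inordK //; lia.
    by rewrite /unrk k1 ltnW.
  - have kE : (n.*2.-1 - k = (n.*2.-1 - k.+1).+1)%N by lia.
    have := H (inord (n.*2.-1 - k)%N); rewrite (mid (n.*2.-1 - k.+1)%N) ?inordK //; try lia.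
    have -> : inord (n.*2.-1 - k)%N != ord0 :> 'I_n.+1 by rewrite -val_eqE /= inordK //; lia.
    rewrite -(lex_before_opp _ _ _ wW) /xs /pmopp /= /unrk -kE.
    have -> : (k < n)%N = false by lia.
    by have -> : (k.+1 < n)%N = false by lia.
  - have := H ord_max; rewrite lst //= /unrk.
    have -> : (k < n)%N by lia.
    have -> : (k.+1 < n)%N = false by lia.
    have -> : inord k = ord_max :> 'I_n by apply/val_inj; rewrite /= inordK //; lia.
    by have -> : inord (n.*2.-1 - k.+1) = ord_max :> 'I_n
      by apply/val_inj; rewrite /= inordK //; lia.
move=> x y xy; rewrite -(rkK x) -(rkK y).
have homo := @homo_ltn_in _ [pred k | (k < n.*2)%N] unrk (lex_before w t).
apply: homo; rewrite ?inE ?rk_lt //.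
- exact: lex_before_trans.
- by move=> i j; rewrite !inE => li lj k kk; rewrite inE; lia.
- by move=> i; rewrite !inE => _; apply: step.
Qed.
End CelliniCount.

Section CelliniCoefficient.
Variables (n' m : nat).
Local Notation n := n'.+1.
Local Notation point := {ffun 'I_n -> 'I_m.+1}.
Local Notation q := (m.*2.+1).
Implicit Types (w : {perm (pmset n)}) (t : point) (v : 'rV[int]_n).

Lemma point_vec_inj : injective (@point_vec n m).
Proof.
move=> t u /rowP e; apply/ffunP => j; apply/val_inj.
by have := e j; rewrite !mxE => -[].
Qed.

Lemma cellini_point_vec I v : cellini_point q I v -> exists t : point, v = point_vec t.
Proof.
case=> mid top.
have ge (i : 'I_n.+1) : i != ord0 -> 0 <= pairing (alpha i) v.
  by move=> i0; have := mid i i0; case: ifP => _ => [->//|/ltW].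
have top' : v 0 ord0 <= m%:Z.
  by move: top; rewrite pairing_highest; case: ifP => _; lia.
have step k : (k.+1 < n)%N -> v 0 (inord k.+1) <= v 0 (inord k).
  move=> kn; have i0 : inord k.+1 != ord0 :> 'I_n.+1.
    by rewrite -val_eqE /= inordK //; lia.
  by have := ge _ i0; rewrite (pairing_mid _ kn) ?subr_ge0 // inordK //; lia.
have last0 : 0 <= v 0 ord_max.
  by have := ge ord_max; rewrite pairing_last // -val_eqE /= => /(_ isT); lia.
have up k : (k < n)%N -> v 0 (inord k) <= v 0 ord0.
  elim: k => [|k IH] kn.
    by have -> : inord 0 = ord0 :> 'I_n by apply/val_inj; rewrite /= inordK.
  exact: le_trans (step k kn) (IH (ltnW kn)).
have down k : (k < n)%N -> 0 <= v 0 (inord (n.-1 - k)%N).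
  elim: k => [|k IH] kn.
    by have -> : inord (n.-1 - 0) = ord_max :> 'I_n by apply/val_inj; rewrite /= inordK subn0.
  apply: le_trans (IH (ltnW kn)) _.
  have -> : (n.-1 - k = (n.-1 - k.+1).+1)%N by move: kn => /=; lia.
  by apply: step; move: kn => /=; lia.
have bd j : 0 <= v 0 j <= m%:Z.
  have e1 : inord j = j by apply/val_inj; rewrite /= inordK.
  have := down (n.-1 - j)%N; have := up j (ltn_ord j).
  rewrite e1 subKn; last by rewrite -ltnS; apply: ltn_ord.
  rewrite e1 => h1 h2; rewrite h2 /=; [exact: le_trans h1 top' | by have := ltn_ord j; lia].
exists [ffun j => inord (absz (v 0 j))]; apply/rowP => j; rewrite mxE ffunE.
by move: (v 0 j) (bd j) => z zb; rewrite inordK; lia.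
Qed.

Lemma cellini_a_card (I : {set 'I_n.+1}) :
  cellini_a q I = #|[set t : point | `[< cellini_point q I (point_vec t) >]]%SET|.
Proof.
rewrite /cellini_a; set A := [set t | _]%SET.
have -> : [set v | cellini_point q I v]%classic =
          [set` [fset @point_vec n m t | t in A]%fset]%classic.
  apply/seteqP; split=> v /=.
    move=> pv; have [t vE] := cellini_point_vec pv.
    by apply/imfsetP; exists t => //=; rewrite inE -vE; apply/asboolP.
  by case/imfsetP => t /=; rewrite inE => /asboolP h ->.
rewrite set_fsetK card_imfset /=; last exact: point_vec_inj.
by rewrite cardE.
Qed.

(** The set [I] is forced to consist of the simple roots vanishing at [t]. *)
Lemma cellini_point_unique w t :
  (\sum_(I : {set 'I_n.+1} | I \subset ~: Cdes w)
     `[< cellini_point q I (point_vec t) >] : nat)%N = descents_strict w t.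
Proof.
pose Z := [set i : 'I_n.+1 | (i != ord0) && (pairing (alpha i) (point_vec t) == 0)]%SET.
have nz : ord0 \notin Z by rewrite inE.
have pt I : cellini_point q I (point_vec t) <->
    I = Z /\ forall i : 'I_n.+1, i != ord0 -> 0 <= pairing (alpha i) (point_vec t).
  split=> [[mid top]|[-> ge]].
    split=> [|i i0]; last by have := mid i i0; case: ifP => _ => [->//|/ltW].
    apply/setP => i; rewrite inE; have [->|i0] /= := eqVneq i ord0.
      by apply/negP => o; move: top; rewrite o pairing_highest; lia.
    by have := mid i i0; case: ifP => _ => [->|/gt_eqF ->]; rewrite ?eqxx.
  split=> [i i0|]; first by rewrite inE i0 /=; have := ge i i0; case: eqP => // /eqP ne; rewrite lt_def ne.
  by rewrite (negPf nz) pairing_highest mxE; have := ltn_ord (t ord0); lia.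
case: (boolP (descents_strict w t)) => [/forallP ds|nds] /=.
  have ge (i : 'I_n.+1) : i != ord0 -> 0 <= pairing (alpha i) (point_vec t).
    by move=> i0; have := ds i; rewrite i0 => /andP[].
  have ZC : Z \subset ~: Cdes w.
    apply/fintype.subsetP => i; rewrite !inE => /andP[i0 e0]; apply/negP => iC.
    by have := ds i; rewrite i0 inE iC e0 andbF.
  rewrite (bigD1 Z) //= big1 ?addn0 => [|I /andP[_ /eqP ne]].
    by have /asboolP -> : cellini_point q Z (point_vec t) by apply/pt.
  by case: asboolP => // /pt[].
rewrite big1 // => I IC; case: asboolP => // /pt[IZ ge]; case/negP: nds.
apply/forallP => i; apply/implyP => i0; rewrite (ge i i0) /=; apply/implyP => iC.
apply/negP => e0; have : i \in I by rewrite IZ inE i0.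
by move/(fintype.subsetP IC); rewrite inE iC.
Qed.

(** For odd [q = 2m+1] no integer point has [2 t_1 = q], so the coefficient of
   [w] in Cellini's element counts the dominant points [t] in [[0,m]^n] that are
   strict at the descents of [w]. *)
Lemma cellini_coefE w : w \in weylC n ->
  cellini_coef q w = (q%:R ^+ n)^-1 * #|[set t : point | shuffle_pair w t]%SET|%:R.
Proof.
move=> wW; rewrite /cellini_coef; congr (_ * _).
under eq_bigr => I _ do rewrite cellini_a_card -sum1dep_card.
rewrite -natr_sum; congr (_%:R).
under eq_bigr => I _ do rewrite big_mkcond /=.
rewrite exchange_big /= -sum1dep_card [RHS]big_mkcond /=.
apply: eq_bigr => t _; transitivity (nat_of_bool (descents_strict w t)); last first.
  by rewrite descents_strictP //; case: ifP.
by rewrite -cellini_point_unique; apply: eq_bigr => I _; case: asboolP.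
Qed.
End CelliniCoefficient.

(** * Standardization of signed words *)

Section Standardization.
Variables (n' m : nat).
Local Notation n := n'.+1.
Local Notation point := {ffun 'I_n -> 'I_m.+1}.
Local Notation q := (m.*2.+1).
Implicit Types (w : {perm (pmset n)}) (t : point) (x y : pmset n).

Definition shuffle_pairs : {set {perm (pmset n)} * point} :=
  [set p | (p.1 \in weylC n) && shuffle_pair p.1 p.2]%SET.

Variable v : {ffun 'I_n -> 'I_q}.

Definition letter x : int := pmsgn x * ((v x.1)%:Z - m%:Z).

Lemma letter_opp x : letter (pmopp x) = - letter x.
Proof. by case: x => i []; rewrite /letter /pmsgn /pmopp /= ?expr0 ?expr1; ring. Qed.

Lemma letter_bound x : - m%:Z <= letter x <= m%:Z.
Proof.
case: x => i b; rewrite /letter /pmsgn /=; have := ltn_ord (v i).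
by case: b; rewrite ?expr0 ?expr1; lia.
Qed.

Definition before y x : bool :=
  (letter x < letter y) || ((letter x == letter y) && (rk y < rk x)%N).

Definition sort_rank x : nat := #|[set y | before y x]%SET|.

Lemma before_trans : transitive before.
Proof. by move=> y x z; rewrite /before; lia. Qed.

Lemma before_irr x : before x x = false.
Proof. by rewrite /before ltxx eqxx ltnn. Qed.

Lemma before_total x y : x != y -> before x y = ~~ before y x.
Proof. by rewrite -(inj_eq (@rk_inj n)) /before; lia. Qed.

Lemma before_opp x y : before (pmopp y) (pmopp x) = before x y.
Proof.
rewrite /before !letter_opp !rk_opp.
by have := rk_lt x; have := rk_lt y; lia.
Qed.

Lemma sort_rank_lt x y : before y x -> (sort_rank y < sort_rank x)%N.
Proof.
move=> yx; apply: proper_card; apply/properP; split.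
  by apply/fintype.subsetP => z; rewrite !inE => zy; apply: before_trans yx.
by exists y; rewrite inE ?before_irr.
Qed.

Lemma sort_rank_ltE x y : (sort_rank y < sort_rank x)%N = before y x.
Proof.
have [->|xy] := eqVneq x y; first by rewrite before_irr ltnn.
apply/idP/idP; last exact: sort_rank_lt.
apply: contraTT; rewrite eq_sym in xy; rewrite before_total // negbK => /sort_rank_lt.
by rewrite -leqNgt => /ltnW.
Qed.

Lemma sort_rank_inj : injective sort_rank.
Proof.
move=> x y e; apply/eqP; apply: contraT => xy.
by have := before_total xy; rewrite -!sort_rank_ltE e ltnn.
Qed.

(** Negation reverses the order of the letters. *)
Lemma sort_rank_sum x : (sort_rank x + sort_rank (pmopp x) = n.*2.-1)%N.
Proof.
have -> : sort_rank (pmopp x) = #|[set y | before x y]%SET|.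
  rewrite /sort_rank -(card_imset _ (can_inj (@pmoppK n))); apply: eq_card => y.
  by rewrite inE -[y in LHS]pmoppK mem_imset ?inE ?before_opp //; apply/can_inj/pmoppK.
have -> : n.*2.-1 = #|[set~ x]|.
  by rewrite cardsC1 card_prod card_ord card_bool muln2.
rewrite /sort_rank -cardsUI.
have -> : ([set y | before y x] :&: [set y | before x y] = finset.set0)%SET.
  apply/setP => y; rewrite !inE; have [->|yx] := eqVneq y x; first by rewrite before_irr.
  by rewrite (before_total yx) andNb.
rewrite cards0 addn0; apply: eq_card => y; rewrite !inE.
have [->|yx] := eqVneq y x; first by rewrite before_irr.
by rewrite (before_total yx) orNb.
Qed.

Lemma sort_rank_bound x : (sort_rank x < n.*2)%N.
Proof. by have := sort_rank_sum x; lia. Qed.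

(** Sorting the odd word [letter] decreasingly produces a shuffle pair, from which
   the word is recovered. *)
Lemma standardization : exists2 p, p \in shuffle_pairs &
  forall x, letter x = digit p.2 ((p.1)^-1%g x).
Proof.
pose u x := unrk n' (sort_rank x).
have rku x : rk (u x) = sort_rank x by rewrite unrkK // sort_rank_bound.
have uinj : injective u.
  by move=> x y e; apply: sort_rank_inj; rewrite -!rku e.
pose w := ((perm uinj)^-1)%g.
have rkw x : sort_rank (w x) = rk x.
  by rewrite -rku -[u _](permE uinj) permKV.
have wW : w \in weylC n.
  apply: groupVr; apply/weylCP => x; rewrite !permE; apply: rk_inj.
  rewrite rk_opp !rku; have := sort_rank_sum x; lia.
have ge0 i : 0 <= letter (w (i, false)).
  have : before (w (i, false)) (w (i, true)).
    by rewrite -sort_rank_ltE !rkw /rk /=; have := ltn_ord i; lia.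
  have -> : w (i, true) = pmopp (w (i, false)) by rewrite -(weylCP _ wW).
  by rewrite /before letter_opp; lia.
pose t : point := [ffun i => inord (absz (letter (w (i, false))))].
have tE x : digit t x = letter (w x).
  have tF i : digit t (i, false) = letter (w (i, false)).
    rewrite digit_false ffunE; have := ge0 i; have := letter_bound (w (i, false)).
    by move: (letter _) => z zb z0; rewrite inordK; lia.
  case: x => i []; last exact: tF.
  have -> : (i, true) = pmopp (i, false) by [].
  by rewrite digit_opp tF (weylCP _ wW) letter_opp.
exists (w, t); last by move=> x; rewrite /= tE permKV.
rewrite inE wW /=; apply/shuffle_pairP => x y xy.
by move: xy; rewrite -(rkw x) -(rkw y) sort_rank_ltE /lex_before !tE eq_sym.
Qed.
End Standardization.

Lemma card_shuffle_pairs n' m :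
  ((m.*2.+1) ^ n'.+1 <= #|shuffle_pairs n' m|)%N.
Proof.
have /choice[f fP] : forall v : {ffun 'I_n'.+1 -> 'I_(m.*2.+1)}, exists p,
    p \in shuffle_pairs n' m /\ forall x, letter v x = digit p.2 ((p.1)^-1%g x).
  by move=> v; have [p ? ?] := standardization v; exists p.
have finj : injective f.
  move=> v v' e; apply/ffunP => i; apply/val_inj => /=.
  have : letter v (i, false) = letter v' (i, false).
    by rewrite (proj2 (fP v)) (proj2 (fP v')) e.
  by rewrite /letter /pmsgn /=; lia.
have <- : #|{ffun 'I_n'.+1 -> 'I_(m.*2.+1)}| = (m.*2.+1 ^ n'.+1)%N.
  by rewrite card_ffun !card_ord.
rewrite -(card_imset _ finj); apply/subset_leq_card/fintype.subsetP => _ /imsetP[v _ ->].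
exact: proj1 (fP v).
Qed.

(** * Periodic expansions in base q *)

Section Expansions.
Variables (n' m : nat).
Local Notation n := n'.+1.
Local Notation point := {ffun 'I_n -> 'I_m.+1}.
Local Notation q := (m.*2.+1).
Implicit Types (w : {perm (pmset n)}) (t : point) (x y : pmset n).

(** The number whose [K] balanced digits in base [q] are read off [t] along the
   orbit of [x]. *)
Fixpoint expansion w t K x : int :=
  if K is K'.+1 then (q ^ K')%:Z * digit t x + expansion w t K' (w x) else 0.

Lemma expansion_opp w t K x : w \in weylC n ->
  expansion w t K (pmopp x) = - expansion w t K x.
Proof.
move=> wW; elim: K x => [|K IH] x /=; first by rewrite oppr0.
by rewrite digit_opp (weylCP _ wW) IH mulrN opprD.
Qed.

Lemma expansion_bound w t K x :
  - ((q ^ K)%:Z - 1) <= 2 * expansion w t K x <= (q ^ K)%:Z - 1.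
Proof.
elim: K x => [|K IH] x; first by rewrite /= expn0; lia.
have /andP[l1 l2] := IH (w x); have /andP[d1 d2] := digit_bound t x.
have Q0 : 0 <= (q ^ K)%:Z by [].
rewrite /= expnS PoszM; move: (expansion _ _ _ _) (digit t x) (q ^ K)%:Z l1 l2 d1 d2 Q0.
move=> e d Q l1 l2 d1 d2 Q0.
have h1 : Q * d <= Q * m%:Z by rewrite ler_wpM2l.
have h2 : Q * - m%:Z <= Q * d by rewrite ler_wpM2l.
by apply/andP; split; nia.
Qed.

Lemma expansion_recr w t K x :
  expansion w t K.+1 x = q%:Z * expansion w t K x + digit t ((w ^+ K)%g x).
Proof.
elim: K x => [|K IH] x; first by rewrite /= expg0 perm1 expn0 mul1r mulr0 addrC.
rewrite [LHS]/= -/(expansion w t K.+1 (w x)) IH /= expnS PoszM expgS permM.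
by rewrite mulrDr addrA mulrA.
Qed.

(** The expansions compare like the words of their digits, since a digit outweighs
   everything after it; and where the first digits agree [w] preserves the order. *)
Lemma expansion_mono w t K x y : shuffle_pair w t -> (rk x < rk y)%N ->
  expansion w t K y <= expansion w t K x.
Proof.
move/shuffle_pairP => wt; elim: K x y => [|K IH] x y xy //=.
have /orP[lt|/andP[/eqP -> lt]] := wt x y xy; last by rewrite lerD2l IH.
have := expansion_bound w t K (w x); have := expansion_bound w t K (w y).
move: (expansion _ _ _ _) (expansion _ _ _ _) => a b.
have Q0 : 0 <= (q ^ K)%:Z by [].
move: (q ^ K)%:Z Q0 => Q Q0 ha hb.
have : Q * 1 <= Q * (digit t x - digit t y) by rewrite ler_wpM2l //; lia.
by rewrite mulr1 mulrBr; lia.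
Qed.

Lemma expansion_head w t w' t' K x x' :
  expansion w t K.+1 x = expansion w' t' K.+1 x' -> digit t x = digit t' x'.
Proof.
move=> /= e; have := expansion_bound w t K (w x); have := expansion_bound w' t' K (w' x').
move: e; move: (expansion _ _ _ _) (expansion _ _ _ _) => a b.
have Q0 : 0 <= (q ^ K)%:Z by [].
move: (q ^ K)%:Z Q0 => Q Q0 e ha hb.
have [lt|lt|//] := ltgtP (digit t x) (digit t' x').
  have : Q * 1 <= Q * (digit t' x' - digit t x) by rewrite ler_wpM2l //; lia.
  by rewrite mulr1 mulrBr; lia.
have : Q * 1 <= Q * (digit t x - digit t' x') by rewrite ler_wpM2l //; lia.
by rewrite mulr1 mulrBr; lia.
Qed.

(** The common length of the expansions is a multiple of the length of every
   orbit, so that they are periodic. *)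
Definition period : nat := #|weylC n|.
(** The order of the group of units of a field with [q^period] elements. *)
Definition unit_order : int := (q ^ period)%:Z - 1.
Definition expo w t x : int := expansion w t period x.

Lemma period_gt0 : (0 < period)%N.
Proof. exact: cardG_gt0. Qed.

Lemma expg_period w : w \in weylC n -> (w ^+ period)%g = 1%g.
Proof. exact: expg_cardG. Qed.

Lemma expo_shift w t x : w \in weylC n ->
  expo w t (w x) = q%:Z * expo w t x - unit_order * digit t x.
Proof.
move=> wW; have := expansion_recr w t period x.
by rewrite expg_period // perm1 /= /expo /unit_order => e; nia.
Qed.

Lemma expo_opp w t x : w \in weylC n -> expo w t (pmopp x) = - expo w t x.
Proof. exact: expansion_opp. Qed.

Lemma expo_bound w t x : - unit_order <= 2 * expo w t x <= unit_order.
Proof. exact: expansion_bound. Qed.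

Lemma expo_digit w t w' t' x x' :
  expo w t x = expo w' t' x' -> digit t x = digit t' x'.
Proof. by rewrite /expo -(prednK period_gt0); apply: expansion_head. Qed.

Lemma expo_mono w t x y : shuffle_pair w t -> (rk x < rk y)%N ->
  expo w t y <= expo w t x.
Proof. exact: expansion_mono. Qed.

Section OnePair.
Variables (w : {perm (pmset n)}) (t : point).
Hypotheses (wW : w \in weylC n) (wt : shuffle_pair w t).

Lemma expo_eq_shift x y k : expo w t x = expo w t y ->
  expo w t ((w ^+ k)%g x) = expo w t ((w ^+ k)%g y).
Proof.
elim: k => [|k IH] e; first by rewrite expg0 !perm1.
by have {}IH := IH e; rewrite expgSr !permM !expo_shift // IH (expo_digit IH).
Qed.

(** Equal expansions begin with equal digits, so the order of the indices is that
   of their images under [w], whose expansions are equal again. *)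
Lemma expo_eq_order x y k : expo w t x = expo w t y -> (rk x < rk y)%N ->
  (rk ((w ^+ k)%g x) < rk ((w ^+ k)%g y))%N.
Proof.
move=> e xy; elim: k => [|k IH]; first by rewrite expg0 !perm1.
have := shuffle_pairP _ _ wt _ _ IH.
by rewrite /lex_before (expo_digit (expo_eq_shift k e)) ltxx eqxx /= expgSr !permM.
Qed.

(** Otherwise the iterates of [w^k] would move [x] always in the same direction,
   and never back to [x]. *)
Lemma expo_orbit_inj x k : expo w t ((w ^+ k)%g x) = expo w t x -> (w ^+ k)%g x = x.
Proof.
move=> e; apply: rk_inj; set u := (w ^+ k)%g in e *.
have uj j : expo w t ((u ^+ j)%g x) = expo w t x.
  elim: j => [|j IH]; first by rewrite expg0 perm1.
  by rewrite expgS permM -IH /u -expgM; apply: expo_eq_shift.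
have uN : (u ^+ period)%g x = x by rewrite /u expgAC expg_period // expg1n perm1.
have [lt|lt|//] := ltngtP (rk (u x)) (rk x).
  have : forall j, (rk ((u ^+ j.+1)%g x) < rk x)%N.
    elim=> [|j IH]; first by rewrite expg1.
    apply: ltn_trans IH; rewrite [in X in (X < _)%N]expgS permM /u -expgM.
    by apply: expo_eq_order.
  by move/(_ period.-1); rewrite prednK ?period_gt0 // uN ltnn.
have : forall j, (rk x < rk ((u ^+ j.+1)%g x))%N.
  elim=> [|j IH]; first by rewrite expg1.
  apply: ltn_trans IH _; rewrite [in X in (_ < X)%N]expgS permM /u -expgM.
  by apply: expo_eq_order.
by move/(_ period.-1); rewrite prednK ?period_gt0 // uN ltnn.
Qed.

(** The largest expansion has all its digits equal to [m]. *)
Lemma expo_max_shift x k : 0 < unit_order -> 2 * expo w t x = unit_order ->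
  2 * expo w t ((w ^+ k)%g x) = unit_order.
Proof.
clear wt; move=> t0 xt; elim: k => [|k IH]; first by rewrite expg0 perm1.
rewrite expgSr permM; set y := (w ^+ k)%g x in IH *.
have := expo_shift t y wW; have := expo_bound w t (w y); have := digit_bound t y.
move: (digit t y) (expo w t (w y)) => d e /andP[d1 d2] /andP[e1 e2] eE.
have e2E : 2 * e = unit_order * (q%:Z - 2 * d) by rewrite eE mulrBr mulrCA IH; ring.
have : unit_order * 1 <= unit_order * (q%:Z - 2 * d) by rewrite ler_pM2l //; lia.
by lia.
Qed.
End OnePair.

Lemma card_rk_lt k : (k <= n.*2)%N -> #|[set x : pmset n | (rk x < k)%N]%SET| = k.
Proof.
move=> kn; rewrite -[RHS](card_ord k).
pose f (i : 'I_k) := unrk n' i; have rkf i : rk (f i) = i.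
  by rewrite /f unrkK //; apply: leq_trans (ltn_ord i) kn.
have finj : injective f by move=> i j e; apply/val_inj; rewrite /= -!rkf e.
rewrite -cardsT -(card_imset _ finj); apply: eq_card => x; rewrite inE.
apply/idP/imsetP => [xk|[i _ ->]]; last by rewrite rkf ltn_ord.
by exists (Ordinal xk); rewrite // /f /= rkK.
Qed.

(** The inverse of [w] lists the signed indices by decreasing letter, and in the
   order of [rk] for equal letters. *)
Lemma letters_determine_perm w t w' t' :
  w \in weylC n -> w' \in weylC n -> shuffle_pair w t -> shuffle_pair w' t' ->
  (forall x, digit t (w^-1%g x) = digit t' (w'^-1%g x)) -> w = w' /\ t = t'.
Proof.
have cmp (v : {perm (pmset n)}) (s : point) : v \in weylC n -> shuffle_pair v s -> forall a b,
    (rk (v^-1%g a) < rk (v^-1%g b))%N =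
    (digit s (v^-1%g b) < digit s (v^-1%g a)) ||
    ((digit s (v^-1%g a) == digit s (v^-1%g b)) && (rk a < rk b)%N).
  move=> vW /shuffle_pairP vs a b; have [->|ab] := eqVneq a b; first by rewrite !ltnn ltxx andbF.
  have := vs (v^-1%g a) (v^-1%g b); have := vs (v^-1%g b) (v^-1%g a).
  rewrite /lex_before !permKV.
  have : rk (v^-1%g a) != rk (v^-1%g b) by rewrite (inj_eq (@rk_inj n)) (inj_eq perm_inj).
  have : rk a != rk b by rewrite (inj_eq (@rk_inj n)).
  by move=> h1 h2 i1 i2; apply/idP/idP; lia.
have rkE (f : {perm (pmset n)}) b : rk (f b) = #|[set a | (rk (f a) < rk (f b))%N]%SET|.
  rewrite -[LHS]card_rk_lt; last by apply: ltnW; apply: rk_lt.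
  rewrite -[RHS](card_imset _ (@perm_inj _ f)); apply: eq_card => x; rewrite inE.
  apply/idP/imsetP => [xb|[a + ->]]; last by rewrite inE.
  by exists (f^-1%g x); rewrite ?inE permKV.
move=> wW wW' ws ws' e.
have ww : (w^-1 = w'^-1)%g.
  apply/permP => b; apply: rk_inj; rewrite rkE [RHS]rkE; apply: eq_card => a.
  by rewrite !inE (cmp w t) // (cmp w' t') // !e.
have {}ww : w = w' by apply: invg_inj.
split=> //; apply/ffunP => i; apply/val_inj.
by have := e (w (i, false)); rewrite -ww permK !digit_false => -[].
Qed.
End Expansions.

(** * Powers of a primitive element *)

Section FibreCounts.
Variables (T : finType) (K : eqType).
Implicit Types f h : T -> K.

Lemma count_image f (P : pred K) :
  count P [seq f x | x <- index_enum T] = #|[set x | P (f x)]%SET|.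
Proof. by rewrite count_map -sum1_count sum1dep_card. Qed.

Lemma fibre_perm_eq f h :
  (forall a, #|[set x | f x == a]%SET| = #|[set x | h x == a]%SET|) ->
  perm_eq [seq f x | x <- index_enum T] [seq h x | x <- index_enum T].
Proof. by move=> e; apply/allP => a _ /=; rewrite !count_image /= e. Qed.

Lemma perm_eq_card f h (P : pred K) :
  perm_eq [seq f x | x <- index_enum T] [seq h x | x <- index_enum T] ->
  #|[set x | P (f x)]%SET| = #|[set x | P (h x)]%SET|.
Proof. by move/seq.permP/(_ P); rewrite !count_image. Qed.
End FibreCounts.

Section Values.
Variables (n' m : nat) (F L : finFieldType) (i : {rmorphism F -> L}) (g : L).
Local Notation n := n'.+1.
Local Notation point := {ffun 'I_n -> 'I_m.+1}.
Local Notation q := (m.*2.+1).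
Local Notation unit_order := (unit_order n' m).
Hypotheses (m0 : (0 < m)%N) (cF : #|F| = q) (cL : #|L| = (q ^ period n')%N).
Hypotheses (g0 : g != 0) (gord : forall k, (g ^+ k == 1) = (#|L|.-1 %| k)%N).
Implicit Types (w : {perm (pmset n)}) (t : point) (x y : pmset n).

Definition value w t x : L := g ^ (expo w t x).

Lemma unit_orderE : unit_order = (#|L|.-1)%:Z.
Proof.
rewrite /unit_order cL; have : (0 < q ^ period n')%N by rewrite expn_gt0.
by move: (q ^ _)%N => Q; lia.
Qed.

Lemma unit_order_gt0 : 0 < unit_order.
Proof.
rewrite /unit_order; have : (q ^ 1 <= q ^ period n')%N by rewrite leq_exp2l ?period_gt0 //; lia.
by rewrite expn1; move: (q ^ _)%N => Q; lia.
Qed.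

Lemma expz_eq1 (z : int) : (g ^ z == 1) = (unit_order %| z)%Z.
Proof.
rewrite unit_orderE dvdzE /=; case: z => k; first exact: gord.
by rewrite NegzE -invr_expz invr_eq1 -exprnP gord abszN.
Qed.

Lemma value_neq0 w t x : value w t x != 0.
Proof. by rewrite expfz_neq0. Qed.

Lemma value_shift w t x : w \in weylC n -> value w t (w x) = value w t x ^+ #|F|.
Proof.
move=> wW; rewrite /value expo_shift // expfzDr // cF.
have -> : g ^ (- (unit_order * digit t x)) = 1.
  by apply/eqP; rewrite expz_eq1 rpredN dvdz_mulr.
by rewrite mulr1 exprnP exprz_exp mulrC.
Qed.

Lemma value_iter w t x k : w \in weylC n ->
  value w t ((w ^+ k)%g x) = value w t x ^+ (#|F| ^ k).
Proof.
move=> wW; elim: k => [|k IH]; first by rewrite expg0 perm1 expr1.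
by rewrite expgSr permM value_shift // IH -exprM -expnSr.
Qed.

Lemma value_opp w t x : w \in weylC n -> value w t (pmopp x) = (value w t x)^-1.
Proof. by move=> wW; rewrite /value expo_opp // invr_expz. Qed.

(** Distinct exponents in the balanced range give distinct powers of the
   generator, except that both endpoints give [-1]. *)
Lemma expz_eq (a b : int) : - unit_order <= 2 * a <= unit_order -> - unit_order <= 2 * b <= unit_order ->
  (g ^ a == g ^ b) =
  [|| a == b, (2 * a == unit_order) && (2 * b == - unit_order) | (2 * a == - unit_order) && (2 * b == unit_order)].
Proof.
move=> ha hb; have t0 := unit_order_gt0.
have -> : (g ^ a == g ^ b) = (unit_order %| a - b)%Z.
  rewrite -expz_eq1 expfzDr // -invr_expz.
  by rewrite -[RHS](inj_eq (mulIf (expfz_neq0 b g0))) mul1r mulfVK ?expfz_neq0.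
apply/idP/idP => [/dvdzP[k kE]|]; last first.
  case/or3P => [/eqP ->|/andP[/eqP a1 /eqP b1]|/andP[/eqP a1 /eqP b1]].
  - by rewrite subrr dvdz0.
  - by apply/dvdzP; exists 1; lia.
  - by apply/dvdzP; exists (-1); lia.
have k1 : -1 <= k <= 1.
  have [k2|k2] := leP k (-2).
    have : k * unit_order <= -2 * unit_order by rewrite ler_pM2r.
    by lia.
  have [k3|k3] := leP 2 k; last by lia.
  have : 2 * unit_order <= k * unit_order by rewrite ler_pM2r.
  by lia.
have : k = -1 \/ k = 0 \/ k = 1 by lia.
by case=> [|[]] kk; rewrite kk in kE; lia.
Qed.

Section OnePair.
Variables (w : {perm (pmset n)}) (t : point).
Hypotheses (wW : w \in weylC n) (wt : shuffle_pair w t).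
Local Notation val_ := (value w t).

Lemma value_eqE x y : (val_ x == val_ y) =
  [|| expo w t x == expo w t y, (2 * expo w t x == unit_order) && (2 * expo w t y == - unit_order)
   | (2 * expo w t x == - unit_order) && (2 * expo w t y == unit_order)].
Proof. by apply: expz_eq; apply: expo_bound. Qed.

Lemma value_orbit_inj x k : val_ ((w ^+ k)%g x) = val_ x -> (w ^+ k)%g x = x.
Proof.
have t0 := unit_order_gt0.
have aux z : 2 * expo w t z = unit_order -> 2 * expo w t ((w ^+ k)%g z) != - unit_order.
  by move/(expo_max_shift wW k t0) => ->; lia.
move/eqP; rewrite value_eqE => /or3P[/eqP|/andP[a b]|/andP[a b]].
- exact: expo_orbit_inj.
- have := aux (pmopp x); rewrite expo_opp // mulrN (eqP b) opprK => /(_ erefl).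
  by rewrite (weylCP _ (weylC_expg k wW)) expo_opp // mulrN (eqP a) eqxx.
- by have := aux x (eqP b); rewrite a.
Qed.

Lemma value_porbit_inj x : {in porbit w x &, injective val_}.
Proof.
move=> y z /porbitP[k ->] zx e; apply/esym.
have [l zE] : exists l, z = (w ^+ l)%g ((w ^+ k)%g x).
  by move: zx; rewrite -(porbit_perm w k x) => /porbitP[l ->]; exists l.
by rewrite zE; apply: value_orbit_inj; rewrite -zE -e.
Qed.

(** Among the points with a given value at most one lies on an orbit stable
   under negation: the permutation preserves the order of these points while
   negation reverses it. *)
Lemma value_negative_inj x y : negative w x -> negative w y -> val_ x = val_ y -> x = y.
Proof.
move=> nx ny /eqP; have t0 := unit_order_gt0.
have notmax z : negative w z -> 2 * expo w t z != unit_order.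
  case/porbitP => k zE; apply/negP => /eqP zt.
  by have := expo_max_shift wW k t0 zt; rewrite -zE expo_opp //; lia.
rewrite value_eqE (negPf (notmax _ nx)) (negPf (notmax _ ny)) andbF orbF /= orbF => /eqP e.
case/porbitP: (nx) => a xa.
have ya : (w ^+ a)%g y = pmopp y.
  case/porbitP: (ny) => b yb.
  
  apply: (value_porbit_inj (x := y)); rewrite ?mem_porbit //.
  by rewrite /value -(expo_eq_shift wW a e) -xa !expo_opp // e.
apply: rk_inj; have [lt|lt|//] := ltngtP (rk x) (rk y).
  have := expo_eq_order wW wt a e lt; rewrite -xa ya !rk_opp.
  by have := rk_lt x; have := rk_lt y; lia.
have := expo_eq_order wW wt a (esym e) lt; rewrite -xa ya !rk_opp.
by have := rk_lt x; have := rk_lt y; lia.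
Qed.
End OnePair.

(** The value [-1] comes from both extreme exponents, which are exchanged by
   negation and so occur equally often. *)
Lemma expo_count w t (z : int) : w \in weylC n -> - unit_order <= 2 * z <= unit_order ->
  #|[set x | expo w t x == z]%SET|.*2 =
  if (2 * z == unit_order) || (2 * z == - unit_order) then #|[set x | value w t x == g ^ z]%SET|
  else #|[set x | value w t x == g ^ z]%SET|.*2.
Proof.
move=> wW zb; have t0 := unit_order_gt0.
have vE x : (value w t x == g ^ z) =
  [|| expo w t x == z, (2 * expo w t x == unit_order) && (2 * z == - unit_order)
   | (2 * expo w t x == - unit_order) && (2 * z == unit_order)].
  by apply: expz_eq zb; apply: expo_bound.
case: ifP => zt; last first.
  by congr (_.*2); apply: eq_card => x; rewrite !inE vE; move: zt; lia.
have -> : [set x | value w t x == g ^ z]%SET =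
    [set x | expo w t x == z]%SET :|: [set x | expo w t x == - z]%SET.
  by apply/setP => x; rewrite !inE vE; move: zt; lia.
have opp : #|[set x | expo w t x == - z]%SET| = #|[set x | expo w t x == z]%SET|.
  rewrite -(card_imset _ (can_inj (@pmoppK n))); apply: eq_card => x; rewrite inE.
  rewrite -[x in LHS]pmoppK mem_imset; last exact/can_inj/pmoppK.
  by rewrite inE expo_opp // eqr_opp.
have := cardsUI [set x | expo w t x == z]%SET [set x | expo w t x == - z]%SET.
have -> : ([set x | expo w t x == z] :&: [set x | expo w t x == - z] = finset.set0)%SET.
  by apply/setP => x; rewrite !inE; move: zt; lia.
by rewrite cards0 addn0 opp addnn.
Qed.

(** The exponents decrease along the order of the signed indices, so they are
   determined by their multiset, and this by the values. *)
Lemma values_determine_pair w t w' t' :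
  w \in weylC n -> w' \in weylC n -> shuffle_pair w t -> shuffle_pair w' t' ->
  \prod_x ('X - (value w t x)%:P) = \prod_x ('X - (value w' t' x)%:P) ->
  w = w' /\ t = t'.
Proof.
move=> wW wW' wt wt' prodE.
have cval a : #|[set x | value w t x == a]%SET| = #|[set x | value w' t' x == a]%SET|.
  apply: (@perm_eq_card _ _ (value w t) (value w' t') (pred1 a)).
  by apply: prod_XsubC_eq; rewrite !big_map.
have cexp z : #|[set x | expo w t x == z]%SET| = #|[set x | expo w' t' x == z]%SET|.
  case: (boolP (- unit_order <= 2 * z <= unit_order)) => [zb|nzb].
    by apply: double_inj; rewrite !expo_count // !cval.
  rewrite !eq_card0 // => x; rewrite inE; apply: contraNF nzb => /eqP <-; exact: expo_bound.
have pe := fibre_perm_eq cexp.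
have seg v s z x : v \in weylC n -> shuffle_pair v s ->
    (z <= expo v s x) = (rk x < #|[set y | (z <= expo v s y)%R]%SET|)%N.
  move=> vW vs; apply/idP/idP => [zx|]; last first.
    apply: contraTT => nzx; rewrite -leqNgt -[X in (_ <= X)%N](card_rk_lt (ltnW (rk_lt x))).
    apply/subset_leq_card/fintype.subsetP => y; rewrite !inE => zy.
    rewrite ltnNge leq_eqVlt; apply: contra nzx => /orP[/eqP/rk_inj -> //|lt].
    exact: le_trans zy (expo_mono vs lt).
  rewrite -{1}[(rk x).+1](card_rk_lt (rk_lt x)).
  apply/subset_leq_card/fintype.subsetP => y; rewrite !inE ltnS leq_eqVlt.
  case/orP => [/eqP/rk_inj -> //|lt]; exact: le_trans zx (expo_mono vs lt).
have expoE x : expo w t x = expo w' t' x.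
  have cE z : (z <= expo w t x) = (z <= expo w' t' x) by rewrite !seg // (perm_eq_card (fun a => z <= a)%R pe).
  by apply/eqP; rewrite eq_le -cE lexx cE lexx.
apply: letters_determine_perm => // x.
have := expo_shift t (w^-1%g x) wW; have := expo_shift t' (w'^-1%g x) wW'.
rewrite !permKV expoE => ->.
move: (digit_bound t (w^-1%g x)) (digit_bound t' (w'^-1%g x)).
move: (digit _ _) (digit _ _) (expo _ _ _) (expo _ _ _) => d d' a b hd hd'.
(* the exponent of [x] determines modulo [q] its last digit, which is the letter of
   [x] *)
have [Q' QE] : exists Q', unit_order = q%:Z * Q' - 1.
  exists (q ^ (period n').-1)%:Z; rewrite /unit_order -{1}(prednK (period_gt0 n')) expnS PoszM //.
rewrite QE => e; have {}e : d - d' = q%:Z * (Q' * d - Q' * d' - b + a) by nia.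
move: (Q' * d - _ - _ + _) e => k e.
have : k = 0 by nia.
by move=> k0; rewrite k0 mulr0 in e; lia.
Qed.
End Values.

(** * The polynomial of a shuffle *)

Section OrbitPolynomials.
Variables (n' m : nat) (F L : finFieldType) (i : {rmorphism F -> L}) (g : L).
Local Notation n := n'.+1.
Local Notation point := {ffun 'I_n -> 'I_m.+1}.
Local Notation q := (m.*2.+1).
Hypotheses (m0 : (0 < m)%N) (cF : #|F| = q) (cL : #|L| = (q ^ period n')%N).
Hypotheses (g0 : g != 0) (gord : forall k, (g ^+ k == 1) = (#|L|.-1 %| k)%N).
Variables (w : {perm (pmset n)}) (t : point).
Hypotheses (wW : w \in weylC n) (wt : shuffle_pair w t).
Implicit Types (x y : pmset n).
Local Notation val_ := (value g w t).

Lemma orbit_values x :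
  [seq val_ x ^+ (#|F| ^ k) | k <- iota 0 #|porbit w x|] =
  [seq val_ z | z <- traject w x #|porbit w x|].
Proof.
apply: (@eq_from_nth _ 0) => [|k]; rewrite !size_map size_iota ?size_traject // => kd.
rewrite (nth_map 0%N) ?size_iota // (nth_map x) ?size_traject // nth_iota // nth_traject //.
by rewrite -permX (value_iter m0 cF cL g0 gord).
Qed.

Lemma orbit_poly x : exists p : {poly F},
  [/\ map_poly i p = \prod_(z in porbit w x) ('X - (val_ z)%:P),
      p \is monic, irreducible_poly p & size p = (#|porbit w x|).+1].
Proof.
have cE : \prod_(z in porbit w x) ('X - (val_ z)%:P) = conj_prod F #|porbit w x| (val_ x).
  rewrite conj_prodE orbit_values big_map.
  rewrite (eq_bigl (fun z => z \in traject w x #|porbit w x|)); last exact: porbit_traject.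
  by rewrite big_uniq ?uniq_traject_porbit.
have xd : val_ x ^+ (#|F| ^ #|porbit w x|) = val_ x.
  by rewrite -(value_iter m0 cF cL g0 gord) // permX iter_porbit.
have [p pE] := conj_prod_descent i xd; exists p.
have [] := @conj_prod_irreducible _ _ i #|porbit w x| (val_ x) p => //.
- exact: porbit_gt0.
- rewrite orbit_values map_inj_in_uniq ?uniq_traject_porbit // => y z.
  by rewrite -!porbit_traject; apply: (value_porbit_inj m0 cF cL g0 gord wW wt).
by move=> mp ip sp; split; rewrite // pE cE.
Qed.

Lemma negative_porbit x y : y \in porbit w x -> negative w y = negative w x.
Proof.
move=> yx; have : cycle_type w x = cycle_type w y.
  by apply: cycle_type_connect => //; rewrite mem_cycle_porbit // yx.
by case.
Qed.

(** The cycles of [w] correspond to the factors of the polynomial with roots the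
   values of the signed indices: a positive cycle to a pair [phi * bar phi], a
   negative cycle to a self-dual [phi]. *)
Lemma pieces_of_pair : exists P S : seq {poly F},
  [/\ forall p, p \in P -> irreducible_at0 p,
      forall p, p \in S -> [/\ irreducible_at0 p, poly_bar p = p, p.[1] != 0 & p.[-1] != 0],
      uniq S,
      map_poly i (\prod_(p <- P) (p * poly_bar p) * \prod_(p <- S) p) =
        \prod_x ('X - (val_ x)%:P) &
      forall l, count (fun p : {poly F} => (size p).-1 == l) P = npos_cycles w l /\
                count (fun p : {poly F} => (size p).-1 == l.*2) S = nneg_cycles w l].
Proof.
have [phi phiP] := choice orbit_poly.
have phi_at0 x : irreducible_at0 (phi x).
  have [pE mp ip _] := phiP x; split=> //.
  rewrite -(fmorph_eq0 i) -horner_map pE rmorph0 horner_prod; apply/prodf_neq0 => z _.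
  by rewrite !hornerE oppr_eq0 value_neq0.
have phi_bar x : poly_bar (phi x) = phi (pmopp x).
  apply: (map_poly_inj i); have [pE _ _ _] := phiP x; have [pE' _ _ _] := phiP (pmopp x).
  rewrite map_bar pE pE' -flip_true porbit_flip // big_imset /=; last first.
    by move=> ? ? _ _; apply: flip_inj.
  rewrite -big_enum bar_prod_XsubC; last by move=> z; apply: value_neq0.
  rewrite -[RHS]big_enum; apply: eq_bigr => z _.
  by rewrite flip_true value_opp.
pose Bp := [set j in cycle_bases w | ~~ negative w (j, false)]%SET.
pose Bn := [set j in cycle_bases w | negative w (j, false)]%SET.
pose P := [seq phi (j, false) | j <- enum Bp].
pose S := [seq phi (j, false) | j <- enum Bn].
have conn x y : cycle_base w x.1 = cycle_base w y.1 <->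
    (y \in porbit w x) || (pmopp y \in porbit w x).
  by rewrite -mem_cycle_porbit // -cycle_base_eq //; split=> /eqP.
exists P, S; split.
- by move=> _ /mapP[j _ ->].
- move=> p /mapP[j]; rewrite mem_enum inE => /andP[_ nj] ->.
  have [pE mp ip sp] := phiP (j, false); have s2 : size (phi (j, false)) != 2.
    rewrite sp eqSS; apply/negP => /eqP c1.
    by have := porbit_neg_even wW nj; rewrite c1.
  split=> //; try exact: irreducible_no_root.
  rewrite phi_bar; apply: (map_poly_inj i); have [pE' _ _ _] := phiP (pmopp (j, false)).
  rewrite pE pE'; apply: eq_bigl => z.
  suff -> : porbit w (pmopp (j, false)) = porbit w (j, false) by [].
  by apply/eqP; rewrite eq_porbit_mem.
- rewrite map_inj_in_uniq ?enum_uniq // => j k.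
  rewrite !mem_enum => /setIdP[jb nj] /setIdP[kb nk] e.
  have [pE _ _ _] := phiP (j, false); have [pE' _ _ _] := phiP (k, false).
  have : root (map_poly i (phi (j, false))) (val_ (j, false)).
    by rewrite pE (bigD1 (j, false)) ?porbit_id //= rootM root_XsubC eqxx.
  rewrite e pE' /root horner_prod => /prodf_eq0[z zk]; rewrite !hornerE subr_eq0 => /eqP vE.
  have nz : negative w z by rewrite (negative_porbit zk).
  have jz := value_negative_inj m0 cF cL g0 gord wW wt nj nz vE.
  rewrite -(cycle_base_id jb) -(cycle_base_id kb).
  by apply/esym/(conn (k, false) (j, false)); rewrite jz zk.
- rewrite rmorphM !rmorph_prod /= /P /S !big_map !big_enum /=.
  rewrite [RHS](partition_big (fun x => cycle_base w x.1) (mem (cycle_bases w))) /=; last first.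
    by move=> x _; apply: cycle_base_in.
  rewrite [RHS](bigID (fun j => negative w (j, false))) /= mulrC; congr (_ * _).
    rewrite [LHS](eq_bigl (fun j => (j \in cycle_bases w) && negative w (j, false))); last first.
      by move=> j; rewrite inE.
    apply: eq_bigr => j /andP[jb nj]; have [-> _ _ _] := phiP (j, false).
    apply: eq_bigl => x; apply/idP/eqP => [xj|e].
      by rewrite -[RHS](cycle_base_id jb); apply/esym/(conn (j, false)); rewrite xj.
    have := proj1 (conn (j, false) x); rewrite /= (cycle_base_id jb) e => /(_ erefl) /orP[//|xo].
    have : porbit w (pmopp x) = porbit w (j, false) by apply/eqP; rewrite eq_porbit_mem.
    have := negative_porbit xo; rewrite nj => no; move=> <-.
    by rewrite porbit_sym -[x]pmoppK; move: no; rewrite /negative porbit_sym pmoppK.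
  rewrite [LHS](eq_bigl (fun j => (j \in cycle_bases w) && ~~ negative w (j, false))); last first.
    by move=> j; rewrite inE.
  apply: eq_bigr => j /andP[jb nj]; rewrite rmorphM /= phi_bar.
  have [-> _ _ _] := phiP (j, false); have [-> _ _ _] := phiP (pmopp (j, false)).
  have baseE x : (cycle_base w x.1 == j) =
      (x \in porbit w (j, false)) || (x \in porbit w (pmopp (j, false))).
    rewrite -{1}[j](cycle_base_id jb) eq_sym.
    have -> : (x \in porbit w (pmopp (j, false))) = (pmopp x \in porbit w (j, false)).
      by rewrite -flip_true porbit_flip // mem_flip_imset.
    by rewrite -(mem_cycle_porbit (j, false)) // -cycle_base_eq.
  rewrite [RHS](bigID (mem (porbit w (j, false)))) /=; congr (_ * _).
    by apply: eq_bigl => x; rewrite baseE; case: (x \in porbit w (j, false)); rewrite ?andbF.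
  apply: eq_bigl => x; rewrite baseE; case: (boolP (x \in porbit w (j, false))) => xj /=; rewrite ?andbT ?andbF //.
  apply/negP; rewrite -flip_true porbit_flip // mem_flip_imset flip_true => xo.
  case/negP: nj; rewrite -(negative_porbit xj) /negative.
  by have /eqP -> : porbit w x == porbit w (j, false) by rewrite eq_porbit_mem.
- move=> l; rewrite npos_cyclesE // nneg_cyclesE // /P /S !count_map.
  have cnt (A : {set 'I_n}) (Q : pred 'I_n) : count Q (enum A) = #|[set j in A | Q j]%SET|.
    by rewrite -sum1_count big_enum_cond sum1dep_card.
  rewrite !cnt; split; apply: eq_card => j; rewrite !inE /=; have [_ _ _ ->] := phiP (j, false);
    by rewrite /= xpair_eqE; case: negative; rewrite ?andbF ?andbT.
Qed.
End OrbitPolynomials.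

(** * Factorizations of self-reciprocal polynomials *)

Section FactorizationExists.
Variable F : finFieldType.
Implicit Types (p phi psi : {poly F}) (P S D : seq {poly F}).

Lemma irreducible_at0_bar p : irreducible_at0 p -> irreducible_at0 (poly_bar p).
Proof.
by case=> mp ip p0; split; [exact: bar_monic | exact: bar_irreducible | exact: bar_horner0_neq0].
Qed.

(** Each member of [P] either raises the exponent of a representative of its pair
   already present in [D] or becomes the representative of a new pair. *)
Lemma bar_factorization_exists P S :
  (forall p, p \in P -> irreducible_at0 p) ->
  (forall p, p \in S -> [/\ irreducible_at0 p, poly_bar p = p, p.[1] != 0 & p.[-1] != 0]) ->
  uniq S ->
  exists D r s, bar_factorization (\prod_(p <- P) (p * poly_bar p) * \prod_(p <- S) p) D r s /\
    forall l, lambda_of D r l = count (fun p : {poly F} => (size p).-1 == l) P /\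
              mu_of D s l = count (fun p : {poly F} => (size p).-1 == l.*2) S.
Proof.
move=> HP HS uS; elim: P HP => [_|p P IH HP].
  exists S, (fun=> 0%N), (fun p => p \in S); split; last first.
    move=> l; split; first by rewrite /lambda_of big1.
    rewrite /mu_of -sum1_count big_mkcond [RHS]big_mkcond; apply: eq_big_seq => p pS.
    by have [_ -> _ _] := HS p pS; rewrite eqxx pS.
  split=> //.
  - by move=> p /HS[[]].
  - by move=> p /HS[_ -> _ _].
  - split; apply/negP => /HS[_ _]; rewrite !hornerE ?subrr ?eqxx //.
    by rewrite addNr eqxx.
  rewrite big_nil mul1r [X in _ = X * _]big1 ?mul1r => [|p _]; last by rewrite expr0.
  rewrite [RHS]big_mkcond; apply: eq_big_seq => p pS.
  by have [_ -> _ _] := HS p pS; rewrite eqxx pS expr1.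
have [|D [r [s [[uD irrD barD [s1 sN1] fE] cnt]]]] := IH.
  by move=> ? ?; apply: HP; rewrite inE orbC; apply/orP; left.
have pat : irreducible_at0 p by apply: HP; rewrite mem_head.
have [mp ip p0] := pat.
have [Dp|nDp] := boolP ((p \in D) || (poly_bar p \in D)).
  have [d [dD dE sd]] : exists d, [/\ d \in D, d * poly_bar d = p * poly_bar p & size d = size p].
    case/orP: Dp => pD; first by exists p.
    by exists (poly_bar p); rewrite barK // mulrC size_bar.
  exists D, (fun x => r x + (x == d))%N, s; split; last first.
    move=> l; have [c1 c2] := cnt l; split=> //=; rewrite -c1.
    rewrite /lambda_of big_split /= addnC; congr (_ + _)%N.
    rewrite big_mkcond (bigD1_seq d) //= eqxx sd big1 ?addn0 => [|x /negPf ->]; last by case: ifP.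
    by case: eqP.
  split=> //; rewrite big_cons -mulrA fE mulrA; congr (_ * _).
  under [RHS]eq_bigr => x _ do rewrite exprD.
  rewrite big_split /= mulrC; congr (_ * _).
  by rewrite (bigD1_seq d) //= eqxx expr1 dE big1 ?mulr1 // => x /negPf ->.
move: nDp; rewrite negb_or => /andP[pD bD].
have neD x : x \in D -> (x == p) = false by move=> xD; apply: contraNF pD => /eqP <-.
exists (p :: D), (fun x => if x == p then 1%N else r x), (fun x => (x != p) && s x); split; last first.
  move=> l; have [c1 c2] := cnt l; split; rewrite /= -?c1 -?c2.
    rewrite /lambda_of big_cons eqxx /=; set e := (X in _ = (_ + X)%N).
    have -> : (\sum_(x <- D | (size x).-1 == l) (if x == p then 1 else r x) = e)%N.
      rewrite big_seq_cond [RHS]big_seq_cond; apply: eq_bigr => x /andP[xD _].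
      by rewrite neD.
    by case: eqP.
  rewrite /mu_of big_cons eqxx /=; set e := (X in _ = X).
  have -> : (\sum_(x <- D | (x == poly_bar x) && ((size x).-1 == l.*2)) ((x != p) && s x : nat) = e)%N.
    rewrite big_seq_cond [RHS]big_seq_cond; apply: eq_bigr => x /andP[xD _].
    by rewrite neD.
  by case: ifP.
split.
- by rewrite /= pD.
- by move=> x; rewrite inE => /orP[/eqP ->|/irrD].
- move=> x; rewrite !inE => /orP[/eqP ->|xD] /orP[/eqP|]; rewrite ?(negPf bD) //.
    by move=> bx; case/negP: bD; rewrite -bx barK //; case: (irrD x xD).
  exact: barD.
- by rewrite s1 sN1 !andbF.
rewrite [in LHS]big_cons -mulrA fE mulrA !big_cons eqxx /= expr1.
congr (_ * _ * _); last first.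
  have eqs : \prod_(x <- D | x == poly_bar x) x ^+ s x =
      \prod_(x <- D | x == poly_bar x) x ^+ ((x != p) && s x).
    rewrite big_seq_cond [RHS]big_seq_cond; apply: eq_bigr => x /andP[xD _].
    by rewrite neD.
  by case: ifP; rewrite eqs // expr0 mul1r.
by apply: eq_big_seq => x xD; rewrite neD.
Qed.
End FactorizationExists.

Section FactorizationUnique.
Variable F : finFieldType.
Implicit Types (p phi psi f : {poly F}) (D : seq {poly F}).

Lemma mup_irreducible (L : finFieldType) (i : {rmorphism F -> L}) (y : L) p r :
  irreducible_at0 p -> irreducible_at0 r -> root (map_poly i p) y ->
  mup y (map_poly i r) = (r == p).
Proof.
move=> [mp ip _] [mr ir _] py; case: eqP => [->|ne].
  have [_ u ->] := irreducible_conj_prod mp ip py.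
  rewrite conj_prodE mu_prod_XsubC count_uniq_mem //.
  suff -> : y \in [seq y ^+ (#|F| ^ k) | k <- iota 0 (size p).-1] by [].
  apply/mapP; exists 0%N; last by rewrite expr1.
  by rewrite mem_iota add0n; case: ip; case: (size p) => [|[]].
apply: mupNroot; apply/negP => ry; apply: ne.
apply/esym/irreducible_monic_dvd => //; exact: irreducible_root_dvd ip py ry.
Qed.

Lemma mupX (L : fieldType) (y : L) (h : {poly L}) k : h != 0 ->
  mup y (h ^+ k) = (k * mup y h)%N.
Proof.
move=> h0; elim: k => [|k IH].
  by rewrite expr0 mul0n; apply: mupNroot; rewrite rootE hornerC oner_eq0.
by rewrite exprS mupM ?expf_neq0 // IH mulSn.
Qed.

Lemma mup_prod (L : fieldType) (y : L) (I : eqType) (D : seq I) (Q : pred I)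
    (h : I -> {poly L}) : {in D, forall x, h x != 0} ->
  mup y (\prod_(x <- D | Q x) h x) = (\sum_(x <- D | Q x) mup y (h x))%N.
Proof.
elim: D => [|x D IH] h0.
  by rewrite !big_nil; apply: mupNroot; rewrite rootE hornerC oner_eq0.
have hD : {in D, forall z, h z != 0} by move=> z zD; apply: h0; rewrite inE zD orbT.
rewrite !big_cons; case: ifP => _; last exact: IH.
rewrite mupM ?IH // ?h0 ?mem_head // prodf_seq_neq0.
by apply/allP => z zD; rewrite hD ?implybT.
Qed.

(** Irreducible polynomials are separable, so each factor equal to [p] contributes
   one to the multiplicity of the root [y]. *)
Lemma bar_factorization_mup f D r s (L : finFieldType) (i : {rmorphism F -> L}) y p :
  bar_factorization f D r s -> irreducible_at0 p -> root (map_poly i p) y ->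
  mup y (map_poly i f) =
  (\sum_(x <- D) r x * ((x == p) + (poly_bar x == p)) +
   \sum_(x <- D | x == poly_bar x) s x * (x == p))%N.
Proof.
move=> [uD irrD barD _ ->] pa py.
have Da x : x \in D -> irreducible_at0 x by move/irrD.
have nz x : irreducible_at0 x -> map_poly i x != 0.
  by case=> mx _ _; rewrite map_poly_eq0 monic_neq0.
have nzD x : x \in D -> map_poly i x != 0 by move/Da/nz.
have nzB x : x \in D -> map_poly i (poly_bar x) != 0 by move/Da/irreducible_at0_bar/nz.
have nz1 k x : x \in D -> map_poly i (x ^+ k) != 0.
  by move=> xD; rewrite rmorphXn expf_neq0 // nzD.
have nz2 k x : x \in D -> map_poly i ((x * poly_bar x) ^+ k) != 0.
  move=> xD; have [mx _ _] := Da x xD; have [mb _ _] := irreducible_at0_bar (Da x xD).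
  by rewrite map_poly_eq0 expf_neq0 // mulf_neq0 // monic_neq0.
rewrite rmorphM !rmorph_prod /= mupM; last 2 first.
- by rewrite prodf_seq_neq0; apply/allP => x xD /=; apply: nz2.
- by rewrite prodf_seq_neq0; apply/allP => x xD; apply/implyP => _; apply: nz1.
rewrite !mup_prod; last 2 first.
- by move=> x xD; apply: nz1.
- by move=> x xD; apply: nz2.
congr (_ + _)%N.
  have mM (a b : {poly F}) : map_poly i (a * b) = map_poly i a * map_poly i b by rewrite rmorphM.
  apply: eq_big_seq => x xD; rewrite rmorphXn /= mM mupX ?mulf_neq0 ?nzB ?nzD //.
  rewrite (mupM _ (nzD x xD) (nzB x xD)) (mup_irreducible pa (Da x xD) py).
  by rewrite (mup_irreducible pa (irreducible_at0_bar (Da x xD)) py).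
rewrite big_seq_cond [RHS]big_seq_cond; apply: eq_bigr => x /andP[xD _].
by rewrite rmorphXn /= mupX ?nzD // (mup_irreducible pa (Da x xD) py).
Qed.

Definition same_pair p x := (x == p) || (poly_bar x == p).

Lemma pair_count_le1 f D r s p : bar_factorization f D r s -> irreducible_at0 p ->
  (\sum_(x <- D | same_pair p x) 1 <= 1)%N.
Proof.
move=> [uD irrD barD _ _] pa; rewrite sum1_count -size_filter.
case E: (filter _ _) => [|x [|z l]] //; exfalso.
have mem a : a \in [:: x, z & l] -> a \in D /\ same_pair p a.
  by rewrite -E mem_filter => /andP[].
have [xD xp] := mem x (mem_head _ _).
have [|zD zp] := mem z; first by rewrite !inE eqxx orbT.
have xz : x != z.
  by have := filter_uniq (same_pair p) uD; rewrite E /= inE negb_or => /andP[/andP[]].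
have K a : a \in D -> poly_bar (poly_bar a) = a by case/irrD => ? _ ?; rewrite barK.
case/orP: xp => /eqP xp; case/orP: zp => /eqP zp.
- by rewrite xp zp eqxx in xz.
- have e : poly_bar z = z by apply: barD => //; rewrite zp -xp.
  by rewrite xp -zp e eqxx in xz.
- have e : poly_bar x = x by apply: barD => //; rewrite xp -zp.
  by rewrite zp -xp e eqxx in xz.
- by rewrite -(K x) // -(K z) // xp zp eqxx in xz.
Qed.
Section TwoFactorizations.
Variables (f : {poly F}) (D D' : seq {poly F}) (r r' : {poly F} -> nat)
  (s s' : {poly F} -> bool).
Hypotheses (fD : bar_factorization f D r s) (fD' : bar_factorization f D' r' s').

Let DP p : p \in D -> irreducible_at0 p.
Proof. by case: fD => _ h _ _ _; apply: h. Qed.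
Let DP' p : p \in D' -> irreducible_at0 p.
Proof. by case: fD' => _ h _ _ _; apply: h. Qed.

Lemma s_count_le1 f0 D0 r0 (s0 : {poly F} -> bool) p : bar_factorization f0 D0 r0 s0 ->
  (\sum_(x <- D0 | x == poly_bar x) s0 x * (x == p) <= 1)%N.
Proof.
case=> uD _ _ _ _; apply: (@leq_trans (\sum_(x <- D0) (x == p))).
  by rewrite big_mkcond; apply: leq_sum => x _; case: ifP => // _; case: (s0 x); case: eqP.
have -> : (\sum_(x <- D0) (x == p) = count_mem p D0)%N.
  by rewrite -sum1_count [RHS]big_mkcond; apply: eq_bigr => x _ /=; case: eqP.
by rewrite count_uniq_mem //; case: (_ \in _).
Qed.

(** The multiplicity of a root of [p] determines the exponent of the pair
   [p, bar p], and for self-dual [p] its parity determines the exponent [s]. *)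
Lemma exponents_determined p : irreducible_at0 p ->
  (\sum_(x <- D | same_pair p x) r x = \sum_(x <- D' | same_pair p x) r' x)%N /\
  (p = poly_bar p -> (\sum_(x <- D | x == poly_bar x) s x * (x == p) =
    \sum_(x <- D' | x == poly_bar x) s' x * (x == p))%N).
Proof.
move=> pa; have [mp ip p0] := pa; have [L [i [y [_ py]]]] := irreducible_root_extension ip.
have m1 := bar_factorization_mup fD pa py; have m2 := bar_factorization_mup fD' pa py.
have := s_count_le1 p fD; have := s_count_le1 p fD'.
rewrite m1 in m2; move: m2.
have rE D0 (r0 : {poly F} -> nat) : (forall x, x \in D0 -> irreducible_at0 x) ->
    (\sum_(x <- D0) r0 x * ((x == p) + (poly_bar x == p)) =
     (if p == poly_bar p then 2 else 1) * \sum_(x <- D0 | same_pair p x) r0 x)%N.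
  move=> D0P; rewrite big_distrr /= [RHS]big_mkcond /=; apply: eq_big_seq => x xD.
  have K : poly_bar (poly_bar x) = x by have [? _ ?] := D0P x xD; rewrite barK.
  rewrite /same_pair; have [xp|xp] := eqVneq x p.
    by subst x; rewrite eq_sym; case: eqP => _ /=; lia.
  have [bp|bp] /= := eqVneq (poly_bar x) p; last by rewrite muln0.
  have -> : (p == poly_bar p) = false.
    by apply: contraNF xp => /eqP e; rewrite -[x]K bp -e.
  by rewrite muln1 mul1n.
rewrite !rE; [|exact: DP'|exact: DP].
have [e|ne] := eqVneq p (poly_bar p) => m2 l1 l2; first by lia.
have z (D0 : seq {poly F}) (s0 : {poly F} -> bool) :
    (\sum_(x <- D0 | x == poly_bar x) s0 x * (x == p) = 0)%N.
  by apply: big1 => x /eqP xb; case: eqP => [xp|]; rewrite ?muln0 //; rewrite -xp -xb eqxx in ne.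
by rewrite !z in m2; split=> [|e]; [lia | rewrite -e eqxx in ne].
Qed.

(** Each pair has at most one representative in either list; by symmetry the
   inequality is an equality. *)
Lemma lambda_le l : (lambda_of D r l <= lambda_of D' r' l)%N.
Proof.
rewrite /lambda_of.
apply: (@leq_trans (\sum_(p <- D | (size p).-1 == l) \sum_(x <- D' | same_pair p x) r' x)).
  rewrite big_seq_cond [X in (_ <= X)%N]big_seq_cond; apply: leq_sum => p /andP[pD _].
  rewrite -(proj1 (exponents_determined (DP pD))).
  by rewrite (big_rem p) //= /same_pair eqxx leq_addr.
rewrite (exchange_big_dep xpredT) //= [X in (_ <= X)%N]big_mkcond /=.
rewrite big_seq [X in (_ <= X)%N]big_seq; apply: leq_sum => x xD'.
have [mx ix x0] := DP' xD'.
have pairE p : p \in D -> same_pair p x = same_pair x p.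
  move=> /DP[mp _ p0]; rewrite /same_pair eq_sym; congr (_ || _).
  by apply/eqP/eqP => <-; rewrite barK.
set c := (if _ then r' x else 0)%N.
apply: (@leq_trans (\sum_(p <- D | same_pair x p) c * 1)).
  rewrite big_seq_cond big_mkcond [X in (_ <= X)%N]big_mkcond; apply: leq_sum => p _.
  case: ifP => // /andP[pD /andP[/eqP pl px]]; rewrite -pairE // px muln1 /c.
  have -> : size x = size p.
    by case/orP: px => /eqP <- //; rewrite size_bar.
  by rewrite pl eqxx.
by rewrite -big_distrr /= -[X in (_ <= X)%N]muln1 leq_mul2l (pair_count_le1 fD (DP' xD')) orbT.
Qed.

Lemma mu_le l : (mu_of D s l <= mu_of D' s' l)%N.
Proof.
rewrite /mu_of.
apply: (@leq_trans (\sum_(p <- D | (p == poly_bar p) && ((size p).-1 == l.*2))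
    \sum_(x <- D' | x == poly_bar x) s' x * (x == p))).
  rewrite big_seq_cond [X in (_ <= X)%N]big_seq_cond; apply: leq_sum => p /and3P[pD /eqP pb _].
  rewrite -(proj2 (exponents_determined (DP pD)) pb).
  by rewrite (big_rem p) //= -pb eqxx muln1 leq_addr.
rewrite (exchange_big_dep xpredT) //= [X in (_ <= X)%N]big_mkcond /=.
rewrite big_seq [X in (_ <= X)%N]big_seq; apply: leq_sum => x xD'.
set c := (if _ then (s' x : nat) else 0)%N.
apply: (@leq_trans (\sum_(p <- D | same_pair x p) c * 1)).
  rewrite big_mkcond [X in (_ <= X)%N]big_mkcond; apply: leq_sum => p _.
  case: ifP => // /andP[/andP[/eqP pb pl] xb]; have [xp|] := eqVneq x p; last by rewrite muln0.
  by rewrite /same_pair -xp eqxx /= muln1 muln1 /c xb xp pl.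
by rewrite -big_distrr /= -[X in (_ <= X)%N]muln1 leq_mul2l (pair_count_le1 fD (DP' xD')) orbT.
Qed.
End TwoFactorizations.

Lemma factorization_numbers_unique f D r s D' r' s' l :
  bar_factorization f D r s -> bar_factorization f D' r' s' ->
  lambda_of D r l = lambda_of D' r' l /\ mu_of D s l = mu_of D' s' l.
Proof.
move=> fD fD'; split; apply/eqP; rewrite eqn_leq.
  by rewrite (lambda_le fD fD') (lambda_le fD' fD).
by rewrite (mu_le fD fD') (mu_le fD' fD).
Qed.
End FactorizationUnique.

(** * From shuffles to semisimple classes *)

Section Assembly.
Variables (n' m : nat) (F L : finFieldType) (i : {rmorphism F -> L}) (g : L).
Local Notation n := n'.+1.
Local Notation point := {ffun 'I_n -> 'I_m.+1}.
Local Notation q := (m.*2.+1).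
Hypotheses (m0 : (0 < m)%N) (cF : #|F| = q) (cL : #|L| = (q ^ period n')%N).
Hypotheses (g0 : g != 0) (gord : forall k, (g ^+ k == 1) = (#|L|.-1 %| k)%N).
Hypothesis odd_char : 2%:R != 0 :> F.
Implicit Types (w : {perm (pmset n)}) (t : point) (x : 'M[F]_(n + n)).

Definition realizes (p : {perm (pmset n)} * point) x : Prop :=
  [/\ x \in Sp F n, semisimple_mx x,
      map_poly i (char_poly x) = \prod_y ('X - (value g p.1 p.2 y)%:P) &
      exists D r s, bar_factorization (char_poly x) D r s /\
        forall l, lambda_of D r l = npos_cycles p.1 l /\ mu_of D s l = nneg_cycles p.1 l].

Lemma mem_shuffle_pairs w t :
  ((w, t) \in shuffle_pairs n' m) = (w \in weylC n) && shuffle_pair w t.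
Proof. by rewrite inE. Qed.

Lemma shuffle_pair_realized p : p \in shuffle_pairs n' m -> exists x, realizes p x.
Proof.
case: p => w t; rewrite mem_shuffle_pairs => /andP[wW wt].
have [P [S [HP HS uS prodE cnt]]] := pieces_of_pair i m0 cF cL g0 gord wW wt.
have [|x [xS xss xE]] := @realize_char_poly F odd_char n' P S HP HS.
  rewrite -(size_map_poly i) prodE size_prod_XsubC -(count_predT (index_enum _)).
  rewrite -sum1_count sum1_card.
  by rewrite card_prod card_ord card_bool muln2.
have [D [r [s [fD cD]]]] := bar_factorization_exists HP HS uS.
exists x; split; rewrite ?xE //; exists D, r, s; split=> // l.
by have [-> ->] := cD l; apply: cnt.
Qed.

Lemma realizes_inj p p' x : p \in shuffle_pairs n' m -> p' \in shuffle_pairs n' m ->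
  realizes p x -> realizes p' x -> p = p'.
Proof.
case: p p' => w t [w' t']; rewrite !mem_shuffle_pairs => /andP[wW wt] /andP[wW' wt'].
case=> _ _ e _ [_ _ e' _]; move: e e' => /= -> e.
by have [-> ->] := values_determine_pair m0 cF cL g0 gord wW wW' wt wt' e.
Qed.

Lemma Phi_realized p x : p \in shuffle_pairs n' m -> realizes p x ->
  Phi (Sp_class x) = (p.1 ^: weylC n)%g.
Proof.
case: p => w t; rewrite mem_shuffle_pairs => /andP[wW _] [_ _ _ [D [r [s [fD cD]]]]].
apply/setP => v; rewrite inE; apply/andP/idP => [[vW /asboolP]|vC].
  case=> x' x'x [D' [r' [s' [fD' cD']]]].
  rewrite (Sp_class_char_poly x'x) in fD'.
  apply: weylC_conjugate => // l l0; have [-> ->] := cD' l l0.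
  by have [<- <-] := cD l; have [-> ->] := factorization_numbers_unique l fD fD'.
have vW : v \in weylC n by case/imsetP: vC => h hW ->; rewrite groupJ.
split=> //; apply/asboolP; exists x; first exact: Sp_class_refl.
exists D, r, s; split=> // l _; have [-> ->] := cD l.
by have [-> ->] := cycle_numbers_class l wW vC.
Qed.

(** A self-reciprocal polynomial of degree [2n] with constant term [1] is
   determined by its coefficients of degree [1, ..., n]. *)
Lemma card_semisimple_classes_le : (#|semisimple_classes F n| <= q ^ n)%N.
Proof.
pose good c x := [/\ x \in Sp F n, semisimple_mx x & c = Sp_class x].
have ex c : exists x, c \in semisimple_classes F n -> good c x.
  case: (boolP (c \in semisimple_classes F n)) => [|_]; last by exists 0.
  by case/imsetP => x /setIdP[xS /asboolP xss] ->; exists x.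
have [rep repP] := choice ex.
pose code c : {ffun 'I_n -> F} := [ffun j : 'I_n => (char_poly (rep c))`_j.+1].
rewrite -[X in (_ <= X)%N](_ : #|{ffun 'I_n -> F}| = _); last by rewrite card_ffun cF card_ord.
rewrite -(card_in_imset (f := code)); first exact: max_card.
move=> c c' cS c'S e.
have [xS xss ->] := repP c cS; have [xS' xss' ->] := repP c' c'S.
apply: Sp_class_eq => //; set p := char_poly _; set p' := char_poly _.
have [_ sp p0 bp] := Sp_char_poly odd_char xS xss.
have [_ sp' p0' bp'] := Sp_char_poly odd_char xS' xss'.
have low k : (k <= n)%N -> p`_k = p'`_k.
  case: k => [_|k kn]; first by rewrite -!horner_coef0 p0 p0'.
  by have /ffunP/(_ (Ordinal kn)) := e; rewrite !ffunE.
have sym (r : {poly F}) : size r = (n.*2).+1 -> r.[0] = 1 -> poly_bar r = r ->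
    forall k, (k <= n.*2)%N -> r`_k = r`_(n.*2 - k).
  by move=> sr r0 br k kn; rewrite -{1}br /poly_bar r0 invr1 scale1r coef_poly sr ltnS kn.
apply/polyP => k; have [kn|kn] := leqP k n; first exact: low.
have [kn2|kn2] := leqP k n.*2; last by rewrite !nth_default ?sp ?sp'.
by rewrite (sym p) // (sym p') // low //; lia.
Qed.

(** There are at least [q^n] shuffle pairs, they inject into the classes, and there
   are at most [q^n] classes. *)
Lemma semisimple_classes_shuffle :
  #|semisimple_classes F n| = (q ^ n)%N /\
  forall C : {set {perm (pmset n)}}, C \in classes (weylC n) ->
    uniform_prob (semisimple_classes F n) (fun c => Phi c == C) =
    \sum_(w in C) cellini_coef q w.
Proof.
have ex p : exists x, p \in shuffle_pairs n' m -> realizes p x.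
  case: (boolP (p \in shuffle_pairs n' m)) => [/shuffle_pair_realized[x ?]|_]; last by exists 0.
  by exists x.
have [cx cxP] := choice ex; pose f p := Sp_class (cx p).
have finj : {in shuffle_pairs n' m &, injective f}.
  move=> p p' pP p'P e; have [_ _ pE fact] := cxP p pP; have r' := cxP p' p'P.
  have cE : char_poly (cx p) = char_poly (cx p').
    by apply: Sp_class_char_poly; rewrite -/(f p') -e Sp_class_refl.
  have [xS' xss' _ _] := r'.
  have r : realizes p (cx p') by split; rewrite -?cE.
  exact: realizes_inj pP p'P r r'.
have fsub : f @: shuffle_pairs n' m \subset semisimple_classes F n.
  apply/fintype.subsetP => _ /imsetP[p pP ->]; have [xS xss _ _] := cxP p pP.
  by apply/imsetP; exists (cx p) => //; apply/setIdP; split=> //; apply/asboolP.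
have cSC : #|semisimple_classes F n| = (q ^ n)%N.
  apply/eqP; rewrite eqn_leq card_semisimple_classes_le /=.
  apply: leq_trans (card_shuffle_pairs n' m) _.
  by rewrite -(card_in_imset finj) subset_leq_card.
have fE : f @: shuffle_pairs n' m = semisimple_classes F n.
  by apply/eqP; rewrite eqEcard fsub cSC card_in_imset // card_shuffle_pairs.
split=> // C CW; have [w0 w0W CE] := imsetP CW.
have inC w : (w ^: weylC n == C)%g = (w \in C).
  by rewrite CE; apply/eqP/class_eqP.
have CsW w : w \in C -> w \in weylC n.
  by rewrite CE => /imsetP[h hW ->]; rewrite groupJ.
have -> : \sum_(w in C) cellini_coef q w =
    \sum_(w in C) (q%:R ^+ n)^-1 * #|[set t : point | shuffle_pair w t]%SET|%:R.
  by apply: eq_bigr => w /CsW wW; rewrite cellini_coefE.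
rewrite -big_distrr /= -natr_sum /uniform_prob cSC mulrC natrX; congr (_ * _%:R).
rewrite -fE; transitivity #|[set p in shuffle_pairs n' m | p.1 \in C]%SET|.
  have -> : [set c in f @: shuffle_pairs n' m | Phi c == C]%SET =
      f @: [set p in shuffle_pairs n' m | p.1 \in C]%SET.
    apply/setP => c; rewrite inE; apply/andP/imsetP.
      case=> /imsetP[p pP ->]; rewrite (Phi_realized pP (cxP p pP)) inC => pC.
      by exists p => //; apply/setIdP.
    case=> p /setIdP[pP pC] ->; split; first exact: imset_f.
    by rewrite (Phi_realized pP (cxP p pP)) inC.
  by apply: card_in_imset => p p' /setIdP[pP _] /setIdP[p'P _]; apply: finj.
rewrite -sum1dep_card (eq_bigl (fun p => (p.1 \in C) && shuffle_pair p.1 p.2)); last first.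
  case=> w t; rewrite mem_shuffle_pairs /=; case: (boolP (w \in C)) => [/CsW ->|]; rewrite ?andbF ?andbT //.
rewrite -(pair_big_dep (fun w => w \in C) (fun w t => shuffle_pair w t) (fun _ _ => 1%N)) /=.
by apply: eq_bigr => w _; rewrite sum1dep_card.
Qed.
End Assembly.

Theorem theorem4 (n q : nat) (F : finFieldType)
    (hn : (1 <= n)%N)
    (hq : exists p e : nat, [/\ prime p, odd p, (0 < e)%N & q = (p ^ e)%N])
    (hF : #|F| = q) :
  #|semisimple_classes F n| = (q ^ n)%N /\
  forall C : {set {perm (pmset n)}}, C \in classes (weylC n) ->
    uniform_prob (semisimple_classes F n) (fun c => Phi c == C) =
    \sum_(w in C) cellini_coef q w.
Proof.
case: hq => p [e [pp op e0 qE]].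
have odd_char : 2%:R != 0 :> F.
  have pF : p \in [pchar F] by apply: (card_finPcharP _ pp); rewrite hF qE.
  rewrite -(dvdn_pcharf pF); apply/negP => /dvdn_leq p2.
  by have := prime_gt1 pp; move: (p2 isT) op; case: (p) => [|[|[|k]]].
have oq : odd q by rewrite qE oddX op orbT.
have [m qm] : exists m, q = m.*2.+1 by exists q./2; rewrite -{1}(odd_double_half q) oq.
have m0 : (0 < m)%N.
  by have := card_field_gt1 F; rewrite hF qm; case: (m).
case: n hn => // n' _; have [L [i cL]] := extension_of_degree F (period_gt0 n').
have [g [g0 _ gord]] := unit_generator L.
rewrite hF qm in cL; rewrite qm in hF *.
exact: (semisimple_classes_shuffle i m0 hF cL g0 gord odd_char).
Qed.
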